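(* Let $\mathcal{L}$ be a lattice in $\mathbb{R}^d$, $d\ge1$. For some $m\in\mathbb{N}$, let $\mathbf{p}=\{p_i,i\in\mathcal{L}\}$ be a strictly stationary $m$-dependent random field in $\mathbb{R}^d$ such that $\mathbb{E}|p_0|^d<\infty$. Then the corresponding perturbed lattice $\Xi=\sum_{i\in\mathcal{L}}\delta_{i+p_i+U}$ is hyperuniform.
   Context: A lattice $\mathcal{L}\subset\mathbb{R}^d$ is the set of all integer linear combinations of a basis $(a_1,\dots,a_d)$ of $\mathbb{R}^d$; its fundamental domain is $\mathcal{D}=\{\sum_{j=1}^d t_ja_j:\ (t_1,\dots,t_d)\in[0,1)^d\}$. $|\cdot|$ is the Euclidean norm, $\lambda^d$ is Lebesgue measure, and $B_r$ is the closed Euclidean ball of radius $r$ centered at $0$. A random field $\{p_i,i\in\mathcal{L}\}$ of $\mathbb{R}^d$-valued random vectors is strictly stationary if $\{p_i,i\in\Lambda\}$ and $\{p_{i+j},i\in\Lambda\}$ have the same distribution for all $\Lambda\subset\mathcal{L}$ and $j\in\mathcal{L}$. It is $m$-dependent if $p_i$ and $p_j$ are independent random variables whenever $|i-j|>m$. The corresponding perturbed lattice is the stationary random counting measure $\Xi=\sum_{i\in\mathcal{L}}\delta_{i+p_i+U}$, where $U$ is uniformly distributed on $\mathcal{D}$ and independent of $\mathbf{p}$. A stationary point process $\mu$ on $\mathbb{R}^d$ is hyperuniform if $\mathrm{Var}(\mu(B_r))/\lambda^d(B_r)\to0$ as $r\to\infty$. *)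

(* Defs.v *)
(* MathComp-Analysis; [R^d] is the type ['rV[R]_d] of row vectors over an
   abstract [R : realType]. *)
From HB Require Import structures.
From mathcomp Require Import all_boot all_order all_algebra.
From mathcomp Require Import all_classical all_reals all_analysis.

Set Implicit Arguments.
Unset Strict Implicit.
Unset Printing Implicit Defensive.

Import Order.TTheory GRing.Theory Num.Theory.
Import numFieldNormedType.Exports.

Local Open Scope classical_set_scope.
Local Open Scope ring_scope.

(* Row vectors carry the product sigma-algebra, as tuples do in the library;
   over a [realType] this is the Borel sigma-algebra of R^n. *)
Definition measure_rV_display : measure_display -> measure_display.
Proof. exact. Qed.

Section measurable_rV.
Context (dT : measure_display) (T : measurableType dT) (n : nat).

Let coors : 'I_n -> 'rV[T]_n -> T := fun i v => v ord0 i.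

Let rV_set0 : g_sigma_preimage coors set0.
Proof. exact: sigma_algebra0. Qed.

Let rV_setC A : g_sigma_preimage coors A -> g_sigma_preimage coors (~` A).
Proof. exact: sigma_algebraC. Qed.

Let rV_bigcup (F : (set 'rV[T]_n)^nat) :
  (forall i, g_sigma_preimage coors (F i)) ->
  g_sigma_preimage coors (\bigcup_i (F i)).
Proof. exact: sigma_algebra_bigcup. Qed.

HB.instance Definition _ := @isMeasurable.Build (measure_rV_display dT)
  'rV[T]_n (g_sigma_preimage coors) rV_set0 rV_setC rV_bigcup.

End measurable_rV.

Section lebesgue_rV.
Context (R : realType).

Definition rV_cons n (xv : R * 'rV[R]_n) : 'rV[R]_n.+1 :=
  \row_i oapp (xv.2 ord0) xv.1 (unlift ord0 i).

(* The [n]-fold product of the Lebesgue measure on the line. *)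
Fixpoint lebesgue_rV n : set 'rV[R]_n -> \bar R :=
  if n is n'.+1
  then pushforward (@lebesgue_measure R \x @lebesgue_rV n')%E (@rV_cons n')
  else dirac (0 : 'rV[R]_0).

Lemma measurable_rV_coord n (i : 'I_n) :
  measurable_fun [set: 'rV[R]_n] (fun v : 'rV[R]_n => v ord0 i).
Proof.
move=> _ Y mY; rewrite setTI; apply: sub_sigma_algebra => /=.
rewrite -bigcup_seq/=; exists i => /=; first by rewrite mem_index_enum.
by exists Y => //; rewrite setTI.
Qed.

Lemma measurable_fun_rV d (T : measurableType d) n (f : T -> 'rV[R]_n) :
  (forall i, measurable_fun [set: T] (fun x => f x ord0 i)) ->
  measurable_fun [set: T] f.
Proof.
move=> mf _ A mA; rewrite setTI.
suff : (g_sigma_preimage (fun i : 'I_n => fun v : 'rV[R]_n => v ord0 i))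
    `<=` [set A | measurable (f @^-1` A)] by exact.
apply: smallest_sub.
  split => /=.
  - by rewrite preimage_set0.
  - by move=> B mB; rewrite setTD preimage_setC; exact: measurableC.
  - by move=> F mF; rewrite preimage_bigcup; exact: bigcup_measurable.
move=> B; rewrite -bigcup_seq/= => -[i _ [C mC <-]].
by rewrite !setTI; have := mf i measurableT C mC; rewrite setTI.
Qed.

Lemma measurable_rV_cons n : measurable_fun [set: R * 'rV[R]_n] (@rV_cons n).
Proof.
apply: measurable_fun_rV => i; under eq_fun do rewrite mxE.
case: (unliftP ord0 i) => [j _|_] /=; last exact: measurable_fst.
apply: (@measurableT_comp _ _ _ _ _ _ (fun v : 'rV[R]_n => v ord0 j)).
  exact: measurable_rV_coord.
exact: measurable_snd.
Qed.

Definition rV_uncons n (v : 'rV[R]_n.+1) : R * 'rV[R]_n :=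
  (v ord0 ord0, \row_j v ord0 (lift ord0 j)).

Lemma rV_consK n : cancel (@rV_cons n) (@rV_uncons n).
Proof.
move=> [x v]; rewrite /rV_uncons mxE unlift_none; congr (_, _).
by apply/rowP => j; rewrite !mxE liftK.
Qed.

Lemma measurable_rV_uncons n : measurable_fun [set: 'rV[R]_n.+1] (@rV_uncons n).
Proof.
apply/measurable_fun_pairP; split; first exact: measurable_rV_coord.
apply: measurable_fun_rV => i; rewrite /comp /=.
by under eq_fun do rewrite mxE; exact: measurable_rV_coord.
Qed.

Let measure_spec n (mu : set 'rV[R]_n -> \bar R) :=
  [/\ mu set0 = 0%E, (forall A, (0 <= mu A)%E), semi_sigma_additive mu
    & sigma_finite setT mu].

Let lebesgue_rVS n (m : {sigma_finite_measure set 'rV[R]_n -> \bar R}) :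
  measure_spec (pushforward (@lebesgue_measure R \x m)%E (@rV_cons n)).
Proof.
have mcons : measurable_fun [set: (measurableTypeR R * 'rV[R]_n)%type]
    (@rV_cons n) by exact: measurable_rV_cons.
pose mu : {measure set (measurableTypeR R * 'rV[R]_n)%type -> \bar R} :=
  product_measure1 (@lebesgue_measure R) m.
pose nu := pushforward mu (@rV_cons n).
split.
- exact: (measure0 nu).
- exact: (measure_ge0 nu).
- exact: (@measure_semi_sigma_additive _ _ _ nu).
- have /sigma_finiteP[F [TF ndF Foo]] := sigma_finiteT (@lebesgue_measure R).
  have /sigma_finiteP[G [TG ndG Goo]] := sigma_finiteT m.
  exists (fun i => @rV_uncons n @^-1` (F i `*` G i)).
    rewrite -preimage_bigcup (_ : \bigcup_i _ = setT) ?preimage_setT//.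
    rewrite -subTset => -[x y] _.
    have [i _ Fx] : (\bigcup_k F k) x by rewrite -TF.
    have [j _ Gy] : (\bigcup_k G k) y by rewrite -TG.
    exists (maxn i j) => //; split => /=.
    + by move: x Fx; exact/subsetPset/ndF/leq_maxl.
    + by move: y Gy; exact/subsetPset/ndG/leq_maxr.
  move=> i; have [mF muF] := Foo i; have [mG muG] := Goo i; split.
    rewrite -[X in measurable X]setTI; apply: measurable_rV_uncons => //.
    exact: measurableX.
  rewrite /pushforward -comp_preimage (_ : _ \o _ = id); last first.
    by apply/funext => x; exact: rV_consK.
  by rewrite product_measure1E// lte_mul_pinfty// ge0_fin_numE.
Qed.

Let lebesgue_rV_spec n : measure_spec (@lebesgue_rV n).
Proof.
elim: n => [|n [mu0 mu_ge0 mu_sadd mu_sfin]].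
  pose mu : {finite_measure set 'rV[R]_0 -> \bar R} := dirac (0 : 'rV[R]_0).
  split; [exact: (measure0 mu)|exact: (measure_ge0 mu)
         |exact: (@measure_semi_sigma_additive _ _ _ mu)
         |exact: (sigma_finiteT mu)].
pose H1 := isMeasure.Build _ _ _ (@lebesgue_rV n) mu0 mu_ge0 mu_sadd.
pose m1 : {measure set 'rV[R]_n -> \bar R} := HB.pack (@lebesgue_rV n) H1.
pose H2 := Measure_isSigmaFinite.Build _ _ _ m1 mu_sfin.
pose m2 : {sigma_finite_measure set 'rV[R]_n -> \bar R} :=
  HB.pack (Measure.sort m1) H2.
exact: (lebesgue_rVS m2).
Qed.

Let lebesgue_rV0 n : @lebesgue_rV n set0 = 0%E.
Proof. by have [] := lebesgue_rV_spec n. Qed.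

Let lebesgue_rV_ge0 n A : (0 <= @lebesgue_rV n A)%E.
Proof. by have [] := lebesgue_rV_spec n. Qed.

Let lebesgue_rV_sigma_additive n : semi_sigma_additive (@lebesgue_rV n).
Proof. by have [] := lebesgue_rV_spec n. Qed.

Let lebesgue_rV_sigma_finite n : sigma_finite setT (@lebesgue_rV n).
Proof. by have [] := lebesgue_rV_spec n. Qed.

HB.instance Definition _ n := isMeasure.Build _ _ _ (@lebesgue_rV n)
  (@lebesgue_rV0 n) (@lebesgue_rV_ge0 n) (@lebesgue_rV_sigma_additive n).

HB.instance Definition _ n := Measure_isSigmaFinite.Build _ _ _
  (@lebesgue_rV n) (@lebesgue_rV_sigma_finite n).

Lemma lebesgue_rV_box n (B : 'I_n -> set (measurableTypeR R)) :
  (forall i, measurable (B i)) ->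
  @lebesgue_rV n [set v | forall i, B i (v ord0 i)] =
  (\prod_(i < n) lebesgue_measure (B i))%E.
Proof.
elim: n B => [|n IHn] B mB.
  by rewrite big_ord0 /= diracE mem_set// => -[].
pose T := [set v : 'rV[R]_n | forall i, B (lift ord0 i) (v ord0 i)].
have mT : measurable T.
  rewrite (_ : T = \bigcap_(i in [set: 'I_n])
      (fun v : 'rV[R]_n => v ord0 i) @^-1` B (lift ord0 i)).
    apply: fin_bigcap_measurable => // i _; rewrite -[X in measurable X]setTI.
    exact: (@measurable_rV_coord n i measurableT _ (mB (lift ord0 i))).
  by apply/seteqP; split => v /= h i => [_|]; apply: h.
rewrite big_ord_recl -IHn//= /pushforward -product_measure1E//; congr product_measure1.
apply/seteqP; split => -[x v] /=.
  by move=> h; split => [|i]/=;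
    [have := h ord0|have := h (lift ord0 i)]; rewrite mxE ?unlift_none ?liftK.
move=> [/= Bx Tv] i; rewrite mxE; case: unliftP => [j ->|->] //=.
Qed.

End lebesgue_rV.
Arguments lebesgue_rV {R} n.

Section euclidean.
Context (R : realType) (d : nat).
Implicit Types (x : 'rV[R]_d) (a : d.-tuple 'rV[R]_d).

(* The library norm [`|x|] on row vectors is the sup norm. *)
Definition enorm x : R := Num.sqrt (\sum_(i < d) x ord0 i ^+ 2).

Definition eball (r : R) : set 'rV[R]_d := [set x | enorm x <= r].

Definition lattice a : set 'rV[R]_d :=
  [set x | exists z : 'I_d -> int, x = \sum_(j < d) tnth a j *~ z j].

Definition fundamental_domain a : set 'rV[R]_d :=
  [set x | exists2 t : 'I_d -> R, (forall j, 0 <= t j < 1) &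
           x = \sum_(j < d) t j *: tnth a j].

End euclidean.

(* The sigma-algebra on [I -> T] generated by the evaluations at the points
   of [L]: its members depend on the coordinates in [L] only, and it is the
   product sigma-algebra of T^L. *)
Definition field_sigma (I : Type) dT (T : measurableType dT) (L : set I) :
    set (set (I -> T)) :=
  <<s [set A | exists i B, [/\ L i, measurable B & A = [set f | B (f i)]]] >>.

Section probability.
Context (R : realType) dO (Omega : measurableType dO) (P : probability Omega R).

Definition independent_RV d1 d2 (T1 : measurableType d1)
    (T2 : measurableType d2) (X : Omega -> T1) (Y : Omega -> T2) : Prop :=
  forall A B, measurable A -> measurable B ->
    P (X @^-1` A `&` Y @^-1` B) = (P (X @^-1` A) * P (Y @^-1` B))%E.

(* Variance of an extended-real random variable; it is [+oo] as soon as the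
   mean is infinite. *)
Definition evariance (X : Omega -> \bar R) : \bar R :=
  (\int[P]_w (X w - \int[P]_v X v) ^+ 2)%E.

Lemma evariance_EFin (X : Omega -> R) :
  P.-integrable setT (EFin \o X) -> evariance (EFin \o X) = 'V_P[X]%E.
Proof.
move=> iX; rewrite /evariance /variance !unlock; apply: eq_integral => w _ /=.
have /fineK <- : (\int[P]_v (X v)%:E)%E \is a fin_num.
  exact: integrable_fin_num.
by rewrite -EFinB -EFinM.
Qed.

Section random_fields.
Context (d : nat).

(* A random field indexed by [L] is a family indexed by all of R^d whose
   values outside of [L] play no role. *)
Implicit Types (L D : set 'rV[R]_d) (p : 'rV[R]_d -> {RV P >-> 'rV[R]_d}).
Implicit Types (U : {RV P >-> 'rV[R]_d}).

Definition strictly_stationary L p : Prop :=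
  forall (La : set 'rV[R]_d) (j : 'rV[R]_d), La `<=` L -> L j ->
  forall A, field_sigma La A ->
    P [set w | A (fun i => p i w)] = P [set w | A (fun i => p (i + j) w)].

Definition m_dependent L (m : nat) p : Prop :=
  forall i j, L i -> L j -> m%:R < enorm (i - j) ->
    independent_RV (p i) (p j).

Definition uniform_on D U : Prop :=
  forall B, measurable B ->
    distribution P U B = (lebesgue_rV d (B `&` D) / lebesgue_rV d D)%E.

Definition independent_of_field L U p : Prop :=
  forall A B, field_sigma L A -> measurable B ->
    P ([set w | A (fun i => p i w)] `&` U @^-1` B) =
    (P [set w | A (fun i => p i w)] * P (U @^-1` B))%E.

Definition perturbed_lattice L p U (w : Omega) (B : set 'rV[R]_d) : \bar R :=
  \esum_(i in L) \d_(i + p i w + U w) B.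

(* [mu] is a random measure, [mu w B] being the mass of [B]. *)
Definition hyperuniform (mu : Omega -> set 'rV[R]_d -> \bar R) : Prop :=
  (evariance (fun w => mu w (@eball R d r)) / lebesgue_rV d (@eball R d r))%E
    @[r --> +oo] --> 0%E.

End random_fields.
End probability.

(* Main.v *)
Require Import Defs.
From HB Require Import structures.
From mathcomp Require Import all_boot all_order all_algebra.
From mathcomp Require Import all_classical all_reals all_analysis.
From mathcomp Require Import measurable_realfun ring lra zify.

Set Implicit Arguments.
Unset Strict Implicit.
Unset Printing Implicit Defensive.

Import Order.TTheory GRing.Theory Num.Theory.
Import numFieldNormedType.Exports.

Local Open Scope classical_set_scope.
Local Open Scope ring_scope.

(* The variance of the number of points in a ball is controlled by pair overlaps.
   Write g_r(y) = |B_r cap (B_r - y)|, V_r = |B_r| and |D| for the covolume. Averaging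
   over U undoes the lattice periodicity, so E N = V_r / |D| and
   E N^2 = |D|^-1 sum_k E g_r(k + p_k - p_0). For |k| > m, independence replaces p_k
   by an independent copy p'_0 of p_0, so up to finitely many k this is
   |D|^-1 E sum_k g_r(k + p'_0 - p_0). The sum over the whole lattice is at most
   V_r^2 / |D| + C r^(d-1), uniformly in the shift p'_0 - p_0: this is Poisson
   summation, where a Fejer kernel on D makes all sums finite, and where the Fourier
   transform of the ball satisfies |1_{B_r}^(x)|^2 <= C r^(d-1) |x|^-(d+1). Hence
   |D|^2 Var N <= C r^(d-1) + |D| sum_{|k| <= m} (V_r - E g_r(k + p'_0 - p_0)), and
   each of the finitely many terms is o(V_r) because g_r(y) / V_r -> 1 for fixed y. *)

(** * Lebesgue measure of affine images and balls *)

(** Only an upper bound on the variance is wanted, so Poisson summation is needed as an inequality.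
    A nonnegative kernel with finitely many frequencies provides it: integrated over the whole space
    against the overlap function, it gives a finite sum over pairs of frequencies; and since nearly
    all its mass lies near one point of each cell, enlarging the radius by eps makes this integral
    dominate the lattice sum. Letting the cutoff grow and then eps shrink removes both losses. The
    exponent d + 1 is decisive: it exceeds the dimension of the dual lattice, so the nonzero
    frequencies have a summable contribution. This decay is obtained without Bessel asymptotics,
    from a monotone energy for a first-order system that ties the Fourier integral of the ball to
    that of the truncated paraboloid 1 - |x|^2. Counts, second moments and lattice sums live in
    [0, +oo] until a bound makes them finite; identities are therefore arranged so that no possibly
    infinite quantities are subtracted. *)

Section affine.
Context (R : realType).
Local Open Scope ereal_scope.

(** Both sides are measures of [A]; they agree on half-open intervals, and uniqueness of the
    Lebesgue measure does the rest. *)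
Lemma lebesgue_measure_affine_pos (c y : R) (A : set (measurableTypeR R)) : (0 < c)%R ->
  measurable A ->
  c%:E * lebesgue_measure ((fun x : measurableTypeR R => c * x + y : measurableTypeR R)%R @^-1` A)
    = lebesgue_measure A.
Proof.
move=> c0 mA.
have mT : measurable_fun [set: measurableTypeR R]
    (fun x : measurableTypeR R => c * x + y : measurableTypeR R)%R.
  by apply: measurable_funD => //; apply: measurable_funM.
pose T := (fun x : measurableTypeR R => c * x + y : measurableTypeR R)%R.
pose nu := mscale (NngNum (ltW c0)) (pushforward lebesgue_measure T).
rewrite [RHS](@lebesgue_measure_unique _ (nu mT))// => _ [[a b]] _ <-.
transitivity (c%:E * lebesgue_measure (T @^-1` `]a, b]%classic)); last by [].
rewrite (_ : (_ @^-1` _) = `](a - y) / c, (b - y) / c]%classic)%R; last first.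
  apply/seteqP; split => x /=; rewrite /T !in_itv/= ltr_pdivrMr// ler_pdivlMr//;
  by rewrite ltrBlDr lerBrDr [(x * c)%R]mulrC.
rewrite !lebesgue_measure_itv/= !lte_fin ltr_pM2r ?invr_gt0// ltrD2r.
case: ifP => ab; last by rewrite mule0.
rewrite -!EFinB -EFinM -mulrBl; congr (_%:E); field; exact: lt0r_neq0.
Qed.

Lemma lebesgue_measure_affine (c y : R) (A : set (measurableTypeR R)) : (c != 0)%R ->
  measurable A ->
  `|c|%:E * lebesgue_measure ((fun x : measurableTypeR R => c * x + y : measurableTypeR R)%R @^-1` A)
    = lebesgue_measure A.
Proof.
move=> c0 mA; have [cp|cn|ce] := ltgtP 0%R c.
- by rewrite gtr0_norm// lebesgue_measure_affine_pos.
- rewrite ltr0_norm// -[RHS](@lebesgue_measure_affine_pos (- c) y)// ?oppr_gt0//.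
  congr (_ * _); rewrite -[RHS]lebesgue_measureN; last first.
    rewrite -[X in measurable X]setTI; apply: measurable_funD => //; exact: measurable_funM.
  by congr (lebesgue_measure _); apply/seteqP; split => x /=; rewrite mulrNN.
- by rewrite -ce eqxx in c0.
Qed.

End affine.

Section rV_measurability.
Context (R : realType) (n : nat).
Context dT (T : measurableType dT).
Implicit Types f g : T -> 'rV[R]_n.

Lemma measurable_rV_comp f (i : 'I_n) : measurable_fun setT f ->
  measurable_fun setT (fun x => f x ord0 i).
Proof.
move=> mf; apply: (@measurableT_comp _ _ _ _ _ _ (fun v : 'rV[R]_n => v ord0 i)) => //.
exact: measurable_rV_coord.
Qed.

Lemma measurable_funD_rV f g : measurable_fun setT f -> measurable_fun setT g ->
  measurable_fun setT (fun x => f x + g x).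
Proof.
move=> mf mg; apply: measurable_fun_rV => i; under eq_fun do rewrite mxE.
by apply: measurable_funD; exact: measurable_rV_comp.
Qed.

Lemma measurable_funZ_rV (h : T -> R) f :
  measurable_fun setT h -> measurable_fun setT f ->
  measurable_fun setT (fun x => h x *: f x).
Proof.
move=> mh mf; apply: measurable_fun_rV => i; under eq_fun do rewrite mxE.
by apply: measurable_funM => //; exact: measurable_rV_comp.
Qed.

Lemma measurable_funN_rV f : measurable_fun setT f ->
  measurable_fun setT (fun x => - f x).
Proof.
move=> mf; apply: measurable_fun_rV => i; under eq_fun do rewrite mxE.
by apply: measurableT_comp => //; exact: measurable_rV_comp.
Qed.

Lemma measurable_funB_rV f g : measurable_fun setT f -> measurable_fun setT g ->
  measurable_fun setT (fun x => f x - g x).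
Proof. by move=> mf mg; apply: measurable_funD_rV => //; exact: measurable_funN_rV. Qed.

End rV_measurability.

Section lebesgue_rV_affine.
Context (R : realType).
Local Open Scope ereal_scope.

(** Induction on the dimension: with the first coordinate split off, the sections scale by the
    induction hypothesis and the outer integral by the one-dimensional case. The factor sits on the
    side of the preimage, so no division of extended reals occurs. *)
Lemma lebesgue_rV_affine n (c : R) (y : 'rV[R]_n) (A : set 'rV[R]_n) :
  (c != 0)%R -> measurable A ->
  (`|c| ^+ n)%:E * lebesgue_rV n ((fun x => c *: x + y)%R @^-1` A) = lebesgue_rV n A.
Proof.
move=> c0; elim: n => [|n IH] in y A *; move=> mA.
  rewrite expr0 mul1e /=; congr (dirac _ _).
  by apply/seteqP; split => x /=; rewrite (_ : (c *: x + y)%R = x)//; apply/rowP => -[].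
rewrite /= /pushforward /product_measure1.
have mcons := @measurable_rV_cons R n.
have mA' : measurable (@rV_cons R n @^-1` A).
  by rewrite -[X in measurable X]setTI; exact: mcons.
pose F (x : measurableTypeR R) := lebesgue_rV n (xsection (@rV_cons R n @^-1` A) x).
have mF : measurable_fun setT F.
  by apply: measurable_fun_xsection.
pose y0 : R := y ord0 ord0.
pose y' : 'rV[R]_n := (\row_j y ord0 (lift ord0 j))%R.
have E (x : R) : (`|c| ^+ n)%:E * (lebesgue_rV n \o xsection (@rV_cons R n @^-1`
    ((fun x => c *: x + y)%R @^-1` A))) x = F (c * x + y0)%R.
  rewrite /F -[RHS](IH y') ; last exact: measurable_xsection.
  congr (_ * lebesgue_rV n _); apply/seteqP; split => v /=;
  rewrite !xsectionE /=;
  rewrite (_ : (c *: rV_cons (x, v) + y)%R = rV_cons ((c * x + y0)%R, (c *: v + y')%R))//;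
  by apply/rowP => i; rewrite !mxE; case: unliftP => [j ->|->] //=; rewrite !mxE.
rewrite exprS EFinM -muleA.
have mTA : measurable (@rV_cons R n @^-1` ((fun x => c *: x + y)%R @^-1` A)).
  rewrite -comp_preimage -[X in measurable X]setTI; apply: (@measurable_funD_rV _ _ _ _ _ (cst y)) => //.
  by apply: (@measurable_funZ_rV _ _ _ _ (cst c)).
rewrite -ge0_integralZl//; last first.
  by apply: measurable_fun_xsection.
rewrite (eq_integral (fun x : measurableTypeR R => F (c * x + y0)%R)); last by move=> x _; exact: E.
pose T := (fun x : measurableTypeR R => c * x + y0 : measurableTypeR R)%R.
have mT : measurable_fun setT T.
  by apply: measurable_funD => //; exact: measurable_funM.
pose nu := mscale (NngNum (normr_ge0 c)) (pushforward lebesgue_measure T).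
rewrite [RHS](@eq_measure_integral _ _ _ _ (nu mT)); last first.
  by move=> B mB _; exact: (esym (lebesgue_measure_affine y0 c0 mB)).
rewrite ge0_integral_mscale//= ge0_integral_pushforward//.
Qed.
End lebesgue_rV_affine.

Section integral_affine.
Context (R : realType) (n : nat).
Local Notation lambda := (@lebesgue_rV R n).

Lemma measurable_affine_rV (c : R) (y : 'rV[R]_n) :
  measurable_fun [set: 'rV[R]_n] (fun x => c *: x + y).
Proof.
apply: (@measurable_funD_rV _ _ _ _ _ (cst y)) => //.
by apply: (@measurable_funZ_rV _ _ _ _ (cst c)).
Qed.

Lemma ge0_integral_affine (c : R) (y : 'rV[R]_n) (f : 'rV[R]_n -> \bar R) :
  c != 0 -> measurable_fun setT f -> (forall x, 0 <= f x)%E ->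
  ((`|c| ^+ n)%:E * \int[lambda]_x f (c *: x + y)%R = \int[lambda]_x f x)%E.
Proof.
move=> c0 mf f0; pose T := fun x : 'rV[R]_n => c *: x + y.
have mT : measurable_fun setT T by exact: measurable_affine_rV.
have cn0 : 0 <= `|c| ^+ n by rewrite exprn_ge0.
pose nu := mscale (NngNum cn0) (pushforward lambda T).
rewrite [RHS](@eq_measure_integral _ _ _ _ (nu mT)); last first.
  by move=> B mB _; exact: (esym (lebesgue_rV_affine y c0 mB)).
by rewrite ge0_integral_mscale//= ge0_integral_pushforward.
Qed.

Lemma ge0_integral_translation (y : 'rV[R]_n) (f : 'rV[R]_n -> \bar R) :
  measurable_fun setT f -> (forall x, 0 <= f x)%E ->
  (\int[lambda]_x f (x + y)%R = \int[lambda]_x f x)%E.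
Proof.
move=> mf f0; rewrite -(ge0_integral_affine y (oner_neq0 R) mf f0).
by rewrite normr1 expr1n mul1e; under [RHS]eq_integral do rewrite scale1r.
Qed.

Lemma Rintegral_affine (c : R) (y : 'rV[R]_n) (f : 'rV[R]_n -> R) :
  c != 0 -> lambda.-integrable setT (EFin \o f) ->
  `|c| ^+ n * \int[lambda]_x f (c *: x + y) = \int[lambda]_x f x.
Proof.
move=> c0 intf; have /integrableP[mf _] := intf.
have mT := measurable_affine_rV c y.
have cn0 : `|c| ^+ n != 0 by rewrite expf_neq0 ?normr_eq0.
pose g := (EFin \o f) \o (fun x : 'rV[R]_n => c *: x + y).
have Ep : ((`|c| ^+ n)%:E * \int[lambda]_x g^\+ x = \int[lambda]_x (EFin \o f)^\+ x)%E.
  rewrite -[RHS](ge0_integral_affine y c0 (measurable_funepos mf))//.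
  by congr (_ * _)%E; apply: eq_integral => x _; rewrite !funeposE.
have Em : ((`|c| ^+ n)%:E * \int[lambda]_x g^\- x = \int[lambda]_x (EFin \o f)^\- x)%E.
  rewrite -[RHS](ge0_integral_affine y c0 (measurable_funeneg mf))//.
  by congr (_ * _)%E; apply: eq_integral => x _; rewrite !funenegE.
rewrite /Rintegral [in RHS]integralE -Ep -Em.
rewrite [in LHS](_ : (fun x => _) = g)//.
(* A positive finite factor cannot turn an infinite integral into a finite one, so integrability
   passes from the parts of [f] to those of [g]. *)
have [a fa Ea] : exists2 a : R, `|c| ^+ n * a = fine (\int[lambda]_x (EFin \o f)^\+ x)%E &
    (\int[lambda]_x g^\+ x = a%:E)%E.
  have := integrable_pos_fin_num measurableT intf; rewrite -Ep.
  have : (0 <= \int[lambda]_x g^\+ x)%E by exact: integral_ge0.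
  case: (integral _ _ (g^\+)%E) => [a| |]//; first by exists a.
  by move=> _; rewrite gt0_muley// lte_fin lt0r cn0 exprn_ge0.
have [b fb Eb] : exists2 a : R, `|c| ^+ n * a = fine (\int[lambda]_x (EFin \o f)^\- x)%E &
    (\int[lambda]_x g^\- x = a%:E)%E.
  have := integrable_neg_fin_num measurableT intf; rewrite -Em.
  have : (0 <= \int[lambda]_x g^\- x)%E by exact: integral_ge0.
  case: (integral _ _ (g^\-)%E) => [a'| |]//; first by exists a'.
  by move=> _; rewrite gt0_muley// lte_fin lt0r cn0 exprn_ge0.
rewrite [in LHS]integralE Ea Eb -EFinM -EFinM -!EFinB/=; ring.
Qed.
End integral_affine.

Section euclid.
Context (R : realType) (d : nat).
Implicit Types x y : 'rV[R]_d.

Definition dotv x y : R := \sum_(i < d) x ord0 i * y ord0 i.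

Lemma enorm_ge0 x : 0 <= enorm x. Proof. exact: sqrtr_ge0. Qed.
Hint Resolve enorm_ge0 : core.

Lemma sqr_enorm x : enorm x ^+ 2 = \sum_(i < d) x ord0 i ^+ 2.
Proof. by rewrite sqr_sqrtr// sumr_ge0// => i _; exact: sqr_ge0. Qed.

Lemma enorm_le x r : 0 <= r -> (enorm x <= r) = (\sum_(i < d) x ord0 i ^+ 2 <= r ^+ 2).
Proof. by move=> r0; rewrite -sqr_enorm ler_pXn2r ?nnegrE. Qed.

Lemma enorm_coord x i : `|x ord0 i| <= enorm x.
Proof.
rewrite -(@ler_pXn2r _ 2%N)// ?nnegrE// sqr_enorm real_normK ?num_real//.
by rewrite (bigD1 i)//= lerDl sumr_ge0// => j _; exact: sqr_ge0.
Qed.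

Lemma enorm0_eq0 x : enorm x = 0 -> x = 0.
Proof.
move=> x0; apply/rowP => i; rewrite mxE; apply/eqP; rewrite -normr_eq0.
by rewrite eq_le normr_ge0 andbT -x0 enorm_coord.
Qed.

Lemma enorm0 : enorm (0 : 'rV[R]_d) = 0.
Proof. by rewrite /enorm big1 ?sqrtr0// => i _; rewrite mxE expr0n. Qed.

Lemma enormZ (c : R) x : enorm (c *: x) = `|c| * enorm x.
Proof.
apply/eqP; rewrite -(@eqrXn2 _ 2%N)// ?mulr_ge0// exprMn !sqr_enorm.
rewrite real_normK ?num_real// mulr_sumr; apply/eqP/eq_bigr => i _.
by rewrite mxE exprMn.
Qed.

Lemma enormN x : enorm (- x) = enorm x.
Proof. by rewrite -scaleN1r enormZ normrN1 mul1r. Qed.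

Lemma dotv_enorm x : dotv x x = enorm x ^+ 2.
Proof. by rewrite sqr_enorm; apply: eq_bigr => i _; rewrite expr2. Qed.

Lemma dotvDl x y z : dotv (x + y) z = dotv x z + dotv y z.
Proof. by rewrite -big_split/=; apply: eq_bigr => i _; rewrite mxE mulrDl. Qed.

Lemma dotvZl c x y : dotv (c *: x) y = c * dotv x y.
Proof. by rewrite mulr_sumr; apply: eq_bigr => i _; rewrite mxE mulrA. Qed.

Lemma dotvC x y : dotv x y = dotv y x.
Proof. by apply: eq_bigr => i _; rewrite mulrC. Qed.

Lemma dotvDr x y z : dotv x (y + z) = dotv x y + dotv x z.
Proof. by rewrite dotvC dotvDl !(dotvC x). Qed.

Lemma dotvZr c x y : dotv x (c *: y) = c * dotv x y.
Proof. by rewrite dotvC dotvZl dotvC. Qed.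

Lemma sqr_enormD x y : enorm (x + y) ^+ 2 = enorm x ^+ 2 + dotv x y *+ 2 + enorm y ^+ 2.
Proof. rewrite -!dotv_enorm dotvDl !dotvDr (dotvC y x); ring. Qed.

(** Cauchy-Schwarz: apart from the degenerate cases, the squared norm of
    [enorm v *: u - enorm u *: v] is nonnegative and a positive factor cancels. *)
Lemma ler_dotv x y : `|dotv x y| <= enorm x * enorm y.
Proof.
suff H u v : dotv u v <= enorm u * enorm v.
  by rewrite ler_norml lerNl -mulN1r -dotvZl H andbT (le_trans (H _ _))// enormZ normrN1 mul1r.
have [u0|u0] := eqVneq (enorm u) 0.
  by rewrite (enorm0_eq0 u0) enorm0 mul0r /dotv big1// => i _; rewrite mxE mul0r.
have [v0|v0] := eqVneq (enorm v) 0.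
  by rewrite (enorm0_eq0 v0) enorm0 mulr0 /dotv big1// => i _; rewrite mxE mulr0.
have up : 0 < enorm u by rewrite lt0r u0/=.
have vp : 0 < enorm v by rewrite lt0r v0/=.
have : 0 <= enorm (enorm v *: u + (- enorm u) *: v) ^+ 2 by exact: sqr_ge0.
rewrite sqr_enormD dotvZl dotvZr !enormZ normrN !ger0_norm//.
have := mulr_gt0 up vp; nra.
Qed.

Lemma ler_enormD x y : enorm (x + y) <= enorm x + enorm y.
Proof.
rewrite -(@ler_pXn2r _ 2%N)// ?nnegrE ?addr_ge0// sqr_enormD.
have := ler_dotv x y; rewrite ler_norml => /andP[_]; nra.
Qed.

End euclid.
#[global] Hint Resolve enorm_ge0 : core.

Section balls.
Context (R : realType) (d : nat).
Implicit Types x y : 'rV[R]_d.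
Local Notation lambda := (@lebesgue_rV R d).

Lemma measurable_dotv dT (T : measurableType dT) (f g : T -> 'rV[R]_d) :
  measurable_fun setT f -> measurable_fun setT g ->
  measurable_fun setT (fun w => dotv (f w) (g w)).
Proof.
move=> mf mg; apply: measurable_sum => i.
by apply: measurable_funM; exact: measurable_rV_comp.
Qed.

Lemma measurable_enorm dT (T : measurableType dT) (f : T -> 'rV[R]_d) :
  measurable_fun setT f -> measurable_fun setT (fun w => enorm (f w)).
Proof.
move=> mf; apply: (@measurableT_comp _ _ _ _ _ _ (@Num.sqrt R)).
  by apply: continuous_measurable_fun; exact: sqrt_continuous.
apply: measurable_sum => i; apply: measurable_funX.
exact: measurable_rV_comp.
Qed.

Lemma measurable_preimage_eball dT (T : measurableType dT) (f : T -> 'rV[R]_d) r :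
  measurable_fun setT f -> measurable (f @^-1` eball r).
Proof.
move=> mf; rewrite (_ : _ @^-1` _ = (fun w => enorm (f w)) @^-1` `]-oo, r]); last first.
  by apply/seteqP; split => x /=; rewrite in_itv.
by rewrite -[X in measurable X]setTI; apply: (measurable_enorm mf).
Qed.

Lemma measurable_eball r : measurable (@eball R d r).
Proof. exact: (@measurable_preimage_eball _ _ id). Qed.

Lemma eballN x r : (@eball R d r) (- x) = (@eball R d r) x.
Proof. by rewrite /eball /= enormN. Qed.

Lemma lebesgue_eball_scale r : 0 < r ->
  lambda (eball r) = ((r ^+ d)%:E * lambda (eball 1))%E.
Proof.
move=> r0; rewrite -(@lebesgue_rV_affine _ _ r 0 (eball r)) ?gt_eqF//; last first.
  exact: measurable_eball.
rewrite gtr0_norm//; congr (_ * lambda _)%E.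
apply/seteqP; split => x; rewrite /eball/= addr0 enormZ gtr0_norm//;
by rewrite -ler_pdivlMl// mulVf ?gt_eqF.
Qed.

Lemma measurable_box (r : R) :
  measurable [set v : 'rV[R]_d | forall i, `|v ord0 i| <= r].
Proof.
rewrite (_ : mkset _ = \bigcap_(i in [set: 'I_d])
    (fun v : 'rV[R]_d => v ord0 i) @^-1` `[- r, r]%classic).
  apply: fin_bigcap_measurable => // i _; rewrite -[X in measurable X]setTI.
  exact: (@measurable_rV_coord R d i).
apply/seteqP; split => v /= h i => [_|]; first by rewrite /= in_itv/= -ler_norml.
by have := h i I; rewrite /= in_itv/= -ler_norml.
Qed.

Lemma lebesgue_box (r : R) : 0 < r ->
  lambda [set v | forall i, `|v ord0 i| <= r] = ((r *+ 2) ^+ d)%:E.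
Proof.
move=> r0; transitivity (lambda [set v | forall i, (fun=> `[- r, r]%classic) i (v ord0 i)]).
  congr (lambda _); apply/seteqP; split => v /= h i; have := h i;
  by rewrite in_itv/= ler_norml.
rewrite (@lebesgue_rV_box R d (fun=> `[- r, r]%classic))// (eq_bigr (fun=> (r *+ 2)%:E)); last first.
  move=> i _; rewrite lebesgue_measure_itv/= lte_fin gtrN// -EFinB opprK.
  by rewrite mulr2n.
by rewrite prodEFin prodr_const card_ord.
Qed.

Lemma lebesgue_eball_fin r : (lambda (eball r) < +oo)%E.
Proof.
have r1 : 0 < `|r| + 1 by rewrite ltr_wpDl.
apply: (@le_lt_trans _ _ (lambda [set v | forall i, `|v ord0 i| <= `|r| + 1])).
  apply: le_measure; rewrite ?inE//; [exact: measurable_eball|exact: measurable_box|].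
  move=> x /= xr i; rewrite (le_trans (enorm_coord _ _))// (le_trans xr)//.
  by rewrite (le_trans (ler_norm _))// lerDl.
by rewrite lebesgue_box// ltry.
Qed.

Lemma lebesgue_eball1_gt0 : (0 < lambda (eball 1))%E.
Proof.
(* A cube of half-side [1/(d+1)] fits in the unit ball because [d / (d+1)^2 <= 1]; using [d+1]
   rather than [d] also covers [d = 0]. *)
pose r : R := d.+1%:R^-1.
have r0 : 0 < r by rewrite invr_gt0.
apply: (@lt_le_trans _ _ (lambda [set v | forall i, `|v ord0 i| <= r])).
  by rewrite lebesgue_box// lte_fin exprn_gt0// mulrn_wgt0.
apply: le_measure; rewrite ?inE//; [exact: measurable_box|exact: measurable_eball|].
suff H (x : 'rV[R]_d) : (forall i, `|x ord0 i| <= r) -> enorm x <= 1 by move=> x /H.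
move=> xr; rewrite enorm_le// expr1n.
apply: (@le_trans _ _ (\sum_(i < d) r ^+ 2)).
  apply: ler_sum => i _; rewrite -[X in X <= _]real_normK ?num_real//.
  by rewrite ler_pXn2r// ?nnegrE// ltW.
rewrite sumr_const card_ord -mulr_natl /r expr2 mulrA -ler_pdivlMr ?invr_gt0//.
rewrite invrK mul1r (@le_trans _ _ 1)//; last by rewrite ler1n.
by rewrite ler_pdivrMr// mul1r ler_nat.
Qed.

Definition vol1 : R := fine (lambda (eball 1)).

Lemma lebesgue_eballE r : 0 < r -> lambda (eball r) = (r ^+ d * vol1)%:E.
Proof.
move=> r0; rewrite lebesgue_eball_scale// EFinM fineK// ge0_fin_numE//.
exact: lebesgue_eball_fin.
Qed.

Lemma vol1_gt0 : 0 < vol1.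
Proof. by rewrite fine_gt0// lebesgue_eball1_gt0 lebesgue_eball_fin. Qed.

Lemma measurable_sphere : measurable [set x : 'rV[R]_d | enorm x = 1].
Proof.
rewrite (_ : mkset _ = (fun x => enorm x) @^-1` [set 1]) //.
rewrite -[X in measurable X]setTI; exact: (@measurable_enorm _ _ id).
Qed.

(** The sphere and the ball of radius [1 - e] are disjoint subsets of the unit ball, so scaling and
    Bernoulli's inequality bound the measure of the sphere by [d * vol1 * e] for every [e] in []0,
    1[]. The sphere is the exceptional set for the differentiability of [bump] below. *)
Lemma lebesgue_sphere : lambda [set x | enorm x = 1] = 0%E.
Proof.
have mS := measurable_sphere.
set S := [set x | _] in mS *.
have Sfin : (lambda S < +oo)%E.
  apply: (le_lt_trans _ (lebesgue_eball_fin 1)).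
  apply: le_measure; rewrite ?inE//; first exact: measurable_eball.
  by move=> x /= Sx; rewrite /eball/= Sx.
have /fineK SE : lambda S \is a fin_num by rewrite ge0_fin_numE.
rewrite -SE; congr (_%:E); apply/eqP; rewrite eq_le fine_ge0// andbT.
have bernoulli k (e : R) : 0 <= e <= 1 -> 1 - k%:R * e <= (1 - e) ^+ k.
  move=> /andP[e0 e1]; elim: k => [|k IH]; first by rewrite mul0r subr0 expr0.
  rewrite exprSr; apply: (@le_trans _ _ ((1 - k%:R * e) * (1 - e))).
    rewrite -natr1; have : 0 <= k%:R * e * e by rewrite !mulr_ge0.
    lra.
  by rewrite ler_wpM2r// subr_ge0.
have H (e : R) : 0 < e < 1 -> fine (lambda S) <= d%:R * vol1 * e.
  move=> /andP[e0 e1].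
  have : (lambda S + lambda (eball (1 - e)) <= lambda (eball 1))%E.
    rewrite -measureU//; last 2 first.
    - exact: measurable_eball.
    - rewrite -subset0 => x [Sx]; rewrite /eball /= Sx leNgt => /negP; apply.
      by rewrite ltrBlDr ltrDl.
    apply: le_measure; rewrite ?inE//; first by apply: measurableU => //; exact: measurable_eball.
      exact: measurable_eball.
    move=> x [Sx|xe]; first by rewrite /eball /= Sx.
    by apply: (le_trans xe); rewrite lerBlDr lerDl ltW.
  rewrite !lebesgue_eballE// ?subr_gt0// expr1n mul1r -SE -EFinD lee_fin -lerBrDr.
  move=> /le_trans; apply.
  have := bernoulli d e; rewrite (ltW e0) (ltW e1) => /(_ isT).
  have := vol1_gt0; nra.
rewrite leNgt; apply/negP => s0.
have v0 := vol1_gt0.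
have D0 : 0 < d%:R * vol1 + 1 by rewrite ltr_wpDl// mulr_ge0// ltW.
have D2 : 0 <= d%:R * vol1 by rewrite mulr_ge0// ltW.
(* The second entry keeps [d * vol1 * e] below half of the supposed measure of the sphere; the first
   keeps [e < 1]. *)
pose e : R := Num.min (1/2) (fine (lambda S) / ((d%:R * vol1 + 1) * 2)).
have e0 : 0 < e by rewrite lt_min divr_gt0// ?divr_gt0// mulr_gt0.
have : fine (lambda S) <= d%:R * vol1 * e.
  by apply: H; rewrite e0/= gt_min; apply/orP; left; lra.
apply/negP; rewrite -ltNge.
apply: (@le_lt_trans _ _ (d%:R * vol1 * (fine (lambda S) / ((d%:R * vol1 + 1) * 2)))).
  by rewrite ler_wpM2l// ge_min lexx orbT.
rewrite mulrA ltr_pdivrMr ?mulr_gt0//; nra.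
Qed.
End balls.

(** * Decay of the Fourier transform of the ball *)

(* [A' = - q] and [q' = A - (a / s) q] is a Bessel system. The function [H] below,
   comparable to [s ^ a (A^2 + q^2)] for [2 a <= s], is nonincreasing there, which
   gives [A s ^ 2 = O(s ^- a)]. *)
Section energy.
Context (R : realType) (k : nat) (a : R) (A q : R -> R).
Hypothesis aE : a = k.+2%:R.
Hypothesis dA : forall s : R, 0 < s -> is_derive s 1 A (- q s).
Hypothesis dq : forall s : R, 0 < s -> is_derive s 1 q (A s - a / s * q s).

Let P (s : R) := A s ^+ 2 + q s ^+ 2.
Let X (s : R) := A s * q s.
Let H (s : R) := s ^+ k * ((s + 2 * a) * (s * P s - a * X s)).
Let H' (s : R) := k%:R * s ^+ k.-1 * ((s + 2 * a) * (s * P s - a * X s)) +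
  s ^+ k * ((s * P s - a * X s) +
    (s + 2 * a) * ((1 - a) * P s + a ^+ 2 / s * X s)).

Let dH (s : R) : 0 < s -> is_derive s 1 H (H' s).
Proof.
move=> s0.
have dAs := dA s0; have dqs := dq s0.
have E : H = (id ^+ k * ((id + cst (2 * a)) * (id * (A ^+ 2 + q ^+ 2) - cst a * (A * q)))).
  by apply/funext => x; rewrite /H /P /X; rewrite !fctE.
rewrite E; apply: is_derive_eq.
rewrite !fctE /= /GRing.scale/= /H' /P /X.
field; exact: lt0r_neq0.
Qed.

Let XP s : `|X s| <= P s / 2.
Proof.
rewrite /X /P ler_norml; have := sqr_ge0 (A s + q s); have := sqr_ge0 (A s - q s).
by rewrite sqrrB sqrrD => *; apply/andP; split; lra.
Qed.

Let P_ge0 s : 0 <= P s. Proof. by rewrite addr_ge0 ?sqr_ge0. Qed.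

Let a_ge2 : 2 <= a. Proof. by rewrite aE ler_nat. Qed.

Let H'_le0 (s : R) : 2 * a <= s -> H' s <= 0.
Proof.
move=> as_; have a2 := a_ge2; have s0 : 0 < s by lra.
(* Up to the factor [s ^+ k * a], a weight [s] in place of [s + 2 * a] would give [s * X s], which
   has no sign. The shift by [2 * a] adds [4 * a * X s - 2 * s * P s], and since [|X| <= P / 2] the
   last term dominates once [2 * a <= s]. *)
have E : s * H' s = s ^+ k * (a * (- (2 * s * P s) + (s + 4 * a) * X s)).
  rewrite /H'; have : k%:R = a - 2 by rewrite aE -addn2 natrD addrK.
  case: k => [|k'] /= kE; first by rewrite expr0 mul0r mul0r (_ : a = 2); [field; exact: lt0r_neq0|lra].
  rewrite exprS kE; field; exact: lt0r_neq0.
rewrite -(pmulr_rle0 _ s0) E pmulr_rle0 ?exprn_gt0// pmulr_rle0; last lra.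
have := XP s; have := P_ge0 s; rewrite ler_norml => P0 /andP[_ X1].
have : (s + 4 * a) * X s <= (s + 4 * a) * (P s / 2) by rewrite ler_wpM2l//; lra.
nra.
Qed.

Lemma energy_decay s : 2 * a <= s ->
  s ^+ k.+2 * A s ^+ 2 <= (2 * a) ^+ k * (14 * a ^+ 2) * (A (2 * a) ^+ 2 + q (2 * a) ^+ 2).
Proof.
move=> as_; have a2 := a_ge2; have a0 : 0 <= 2 * a by lra.
have Hle : H s <= H (2 * a).
  apply: (@ler0_derive1_nincry R H (2 * a)) => //.
  - move=> x; rewrite in_itv/= andbT => ax.
    by have /dH[] : 0 < x by lra.
  - move=> x; rewrite in_itv/= andbT => ax; rewrite derive1E.
    have /dH[_ ->] : 0 < x by lra.
    by rewrite H'_le0// ltW.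
  - apply: derivable_within_continuous => x; rewrite in_itv/= andbT => ax.
    by have /dH[] : 0 < x by lra.
(* As [|X| <= P / 2] and [a <= s / 2], the energy is at least 3/4 of [s ^+ k.+2 * P s]; at
   [s = 2 * a] it is at most [10 * a ^+ 2 * (2 * a) ^+ k * P (2 * a)]. The ratio 40/3 is rounded up
   to 14. *)
have L : s ^+ k.+2 * A s ^+ 2 * (3/4) <= H s.
  rewrite /H !exprSr -!mulrA ler_wpM2l ?exprn_ge0//; first lra.
  have := XP s; have := P_ge0 s; rewrite ler_norml => P0 /andP[_ X1].
  have AP : A s ^+ 2 <= P s by rewrite lerDl sqr_ge0.
  apply: (@le_trans _ _ ((s + 2 * a) * (s * P s * (3/4)))); last first.
    by rewrite ler_wpM2l//; [lra|nra].
  have : s * (s * A s ^+2) <= s * (s * P s) by rewrite !ler_wpM2l//; lra.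
  have : 0 <= 2 * a * (s * P s) by rewrite !mulr_ge0//; lra.
  lra.
have U : H (2 * a) <= (2 * a) ^+ k * (10 * a ^+ 2) * P (2 * a).
  rewrite /H -(mulrA ((2 * a) ^+ k) (10 * a ^+ 2)) ler_wpM2l ?exprn_ge0//.
  have := XP (2 * a); have := P_ge0 (2 * a); rewrite ler_norml => P0 /andP[X1 _].
  have : a * - X (2 * a) <= a * (P (2 * a) / 2) by rewrite ler_wpM2l//; lra.
  move=> Z; apply: (@le_trans _ _ ((2 * a + 2 * a) * (a * P (2 * a) * (5/2)))).
    by apply: ler_wpM2l; [lra|nra].
  by rewrite le_eqVlt; apply/orP; left; apply/eqP; field.
have := P_ge0 (2 * a).
have : 0 <= (2 * a) ^+ k by rewrite exprn_ge0.
rewrite -/(P (2 * a)) => u v.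
have : 0 <= (2 * a) ^+ k * a ^+ 2 * P (2 * a) by rewrite !mulr_ge0//; lra.
lra.
Qed.

End energy.

Section derive_under_integral.
Context (R : realType) dT (T : measurableType dT) (mu : {measure set T -> \bar R}).
Variables (f : R -> T -> R) (df G : T -> R) (delta : R).
Hypothesis delta0 : 0 < delta.
Hypothesis intf : forall t, `|t| < delta -> mu.-integrable setT (EFin \o f t).
Hypothesis mdf : measurable_fun setT df.
Hypothesis intG : mu.-integrable setT (EFin \o G).
Hypothesis fG : forall t y, `|t| < delta -> `|f t y - f 0 y| <= `|t| * G y.
Hypothesis derf : {ae mu, forall y, is_derive (0 : R) 1 (f ^~ y) (df y)}.

Let F t := \int[mu]_y f t y.

(** Dominated convergence along sequences tending to 0. Only a Lipschitz estimate at 0 and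
    differentiability there for almost every [y] are used, which admits integrands with a kink on a
    null set. *)
Let cvgF : h^-1 *: (F (h *: 1 + 0) - F 0) @[h --> (0:R)^'] --> \int[mu]_y df y.
Proof.
apply/cvgr_dnbhsP => t [t0 tcvg].
have i0 : mu.-integrable setT (EFin \o f 0) by apply: intf; rewrite normr0.
(* The value 0 for the finitely many [n] with [|t n| >= delta] makes the domination hold for all
   [n]; that [G] is nonnegative follows from the Lipschitz bound at [delta / 2]. *)
pose g n y : R := if `|t n| < delta then (t n)^-1 * (f (t n) y - f 0 y) else 0.
have ig n : mu.-integrable setT (EFin \o g n).
  rewrite /g /comp; case: (boolP (`|t n| < delta)) => tn; last exact: integrable0.
  under eq_fun do rewrite EFinM.
  apply: integrableZl => //.
  under eq_fun do rewrite EFinB.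
  by apply: integrableB => //; exact: intf.
have gG : {ae mu, forall y n, setT y -> (`|(g n y)%:E| <= (EFin \o G) y)%E}.
  apply/aeW => y n _; rewrite /= lee_fin /g; case: ifPn => tn; last first.
    rewrite normr0; have := @fG (delta / 2) y; rewrite gtr0_norm ?divr_gt0//.
    have h2 : delta / 2 < delta by have := delta0; lra.
    move=> /(_ h2) /(le_trans (normr_ge0 _)).
    by rewrite pmulr_rge0 ?divr_gt0.
  rewrite normrM normfV ler_pdivrMl ?normr_gt0//; exact: fG.
have tdelta : \forall n \near \oo, `|t n| < delta.
  by move/cvgr0_norm_lt : tcvg; apply.
have gcvg : {ae mu, forall y, setT y -> (g n y)%:E @[n --> \oo] --> (df y)%:E}.
  apply: filterS derf => y [dy <-] _.
  apply/fine_cvgP; split; first exact: nearW.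
  have /cvgr_dnbhsP/(_ t) : h^-1 *: (f (h *: 1 + 0) y - f 0 y) @[h --> (0:R)^'] --> 'D_1 (f ^~ y) 0.
    exact: dy.
  move=> /(_ (conj t0 tcvg)); apply: cvg_trans; apply: near_eq_cvg.
  near=> n; rewrite /g/= ifT; last by near: n.
  by rewrite scaler1 addr0.
have [idf _] := @dominated_convergence _ _ _ mu _ measurableT (fun n y => (g n y)%:E)
   (EFin \o df) (EFin \o G) (fun n => measurable_int _ (ig n))
   ltac:(exact/measurable_EFinP) gcvg intG gG.
rewrite -(fineK (integrable_fin_num measurableT idf)).
move=> /fine_cvgP[_]; apply: cvg_trans; apply: near_eq_cvg.
near=> n; rewrite /F /=.
have tn : `|t n| < delta by near: n.
rewrite scaler1 addr0 -RintegralB//; last exact: intf.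
rewrite -[RHS]RintegralZl//; last first.
  rewrite /comp; under eq_fun do rewrite EFinB.
  by apply: integrableB => //; exact: intf.
by apply: eq_Rintegral => y _; rewrite /g tn.
Unshelve. all: by end_near. Qed.

Lemma is_derive_Rintegral0 : is_derive (0 : R) 1 F (\int[mu]_y df y).
Proof.
apply: DeriveDef; first by apply/cvg_ex; exists (\int[mu]_y df y); exact: cvgF.
by apply/cvg_lim => //; exact: cvgF.
Qed.

End derive_under_integral.

Section trigo_bounds.
Context (R : realType).

Lemma ler_dist_cos (x y : R) : `|cos x - cos y| <= `|x - y|.
Proof.
wlog xy : x y / y < x => [H|].
  have [yx|xy|->] := ltgtP y x; [exact: H| |by rewrite !subrr normr0].
  by rewrite distrC (distrC x); exact: H.
have [|c _ ->] := @MVT _ cos (fun z => - sin z) y x xy (fun z _ => is_derive_cos z).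
  by apply: continuous_subspaceT => z; exact: continuous_cos.
rewrite normrM ler_piMl// normrN ler_norml.
have := cos2Dsin2 c; have := sqr_ge0 (cos c); nra.
Qed.

Lemma normr_cos_le1 (x : R) : `|cos x| <= 1.
Proof. by rewrite ler_norml cos_geN1 cos_le1. Qed.

Lemma normr_sin_le1 (x : R) : `|sin x| <= 1.
Proof. by rewrite ler_norml sin_geN1 sin_le1. Qed.

Lemma measurable_cos : measurable_fun [set: R] cos.
Proof. by apply: continuous_measurable_fun; exact: continuous_cos. Qed.

Lemma measurable_sin : measurable_fun [set: R] sin.
Proof. by apply: continuous_measurable_fun; exact: continuous_sin. Qed.

Lemma ler_dist_max0 (a b : R) : `|Num.max 0 a - Num.max 0 b| <= `|a - b|.
Proof.
have := ler_norm (b - a); have := ler_norm (a - b); rewrite (distrC b).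
rewrite ler_norml /Num.max; case: ifPn; case: ifPn; rewrite -?leNgt => *;
by apply/andP; split; lra.
Qed.

Lemma is_derive_max0 (psi : R -> R) (l : R) : is_derive (0 : R) 1 psi l ->
  psi 0 != 0 ->
  is_derive (0 : R) 1 (fun t => Num.max 0 (psi t)) (if 0 < psi 0 then l else 0).
Proof.
move=> dpsi psi0.
have cpsi : {for 0, continuous psi}.
  by apply: differentiable_continuous; apply/derivable1_diffP; case: dpsi.
case: ifPn => [p0|]; last rewrite -leNgt => p0.
  apply: near_eq_is_derive dpsi.
  apply: filterS (@cvgr_gt _ _ _ _ psi (psi 0) cpsi 0 p0) => t pt.
  by rewrite max_r// ltW.
apply: (@near_eq_is_derive _ _ _ (cst 0)).
have p1 : psi 0 < 0 by rewrite lt_neqAle psi0.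
apply: filterS (@cvgr_lt _ _ _ _ psi (psi 0) cpsi 0 p1) => t pt.
by rewrite /cst max_l// ltW.
Qed.

End trigo_bounds.

Section ball_integrals.
Context (R : realType) (d : nat).
Implicit Types (x y e : 'rV[R]_d).
Local Notation lambda := (@lebesgue_rV R d).

Lemma integrable_bounded_eball (f : 'rV[R]_d -> R) (r M : R) :
  measurable_fun setT f -> (forall x, `|f x| <= M * \1_(eball r) x) ->
  lambda.-integrable setT (EFin \o f).
Proof.
move=> mf fM.
have mB := @measurable_eball R d r.
apply: (@le_integrable _ _ _ lambda _ measurableT _ (EFin \o (fun x => M * \1_(eball r) x))).
- exact/measurable_EFinP.
- by move=> x _ /=; rewrite lee_fin (le_trans (fM x))// ler_norm.
- suff : lambda.-integrable setT (fun x => M%:E * (EFin \o \1_(eball r)) x)%E by [].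
  apply: integrableZl => //; apply/integrableP; split; first exact/measurable_EFinP.
  under eq_integral do rewrite /= ger0_norm//.
  by rewrite integral_indic// setIT; exact: lebesgue_eball_fin.
Qed.

(** Lipschitz, with gradient [- 2 x] inside the ball. Up to powers of the frequency, its Fourier
    integral is a Bessel function of order one higher than that of the ball, and the two satisfy
    first-order relations. Translations and dilations are applied to [bump], so the jump of the
    indicator is never differentiated. *)
Definition bump x : R := Num.max 0 (1 - enorm x ^+ 2).

Lemma measurable_bump dT (T : measurableType dT) (f : T -> 'rV[R]_d) :
  measurable_fun setT f -> measurable_fun setT (fun w => bump (f w)).
Proof.
move=> mf; apply: measurable_maxr => //; apply: measurable_funB => //.
by apply: measurable_funX; exact: measurable_enorm.
Qed.

Lemma bump_ge0 x : 0 <= bump x. Proof. by rewrite le_max lexx. Qed.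

Lemma bump_le x : bump x <= \1_(eball 1) x.
Proof.
rewrite indicE; case: (boolP (x \in _)) => /=.
  by move=> _; rewrite ge_max ler01/= gerBl// sqr_ge0.
move/negP; rewrite inE /eball/= => /negP; rewrite -ltNge => x1.
rewrite ge_max lexx subr_le0 exprn_ege1// ltW//.
Qed.

Lemma bump_le1 x : bump x <= 1.
Proof. by rewrite (le_trans (bump_le x))// indicE; case: (_ \in _). Qed.

Lemma ae_bumpE : {ae lambda, forall x, enorm x != 1}.
Proof.
exists [set x | enorm x = 1]; split.
- exact: measurable_sphere.
- exact: lebesgue_sphere.
- by move=> x /= /negP; rewrite negbK => /eqP.
Qed.

Definition ball_cos e (s : R) : R :=
  \int[lambda]_x (\1_(eball 1) x * cos (s * dotv e x)).
Definition bump_cos e (s : R) : R :=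
  \int[lambda]_x (bump x * cos (s * dotv e x)).

Lemma measurable_cosM (g : 'rV[R]_d -> R) : measurable_fun setT g ->
  measurable_fun setT (fun x => cos (g x)).
Proof.
move=> mg; apply: (@measurableT_comp _ _ _ _ _ _ (@cos R)) => //; exact: measurable_cos.
Qed.

Lemma measurable_sinM (g : 'rV[R]_d -> R) : measurable_fun setT g ->
  measurable_fun setT (fun x => sin (g x)).
Proof.
move=> mg; apply: (@measurableT_comp _ _ _ _ _ _ (@sin R)) => //; exact: measurable_sin.
Qed.

Lemma measurable_dotvr e : measurable_fun [set: 'rV[R]_d] (dotv e).
Proof. exact: (@measurable_dotv _ _ _ _ (cst e) id). Qed.

Lemma measurable_scale_dotv (s : R) e : measurable_fun [set: 'rV[R]_d] (fun x => s * dotv e x).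
Proof. by apply: measurable_funM => //; exact: measurable_dotvr. Qed.

Lemma measurable_ball_indic r : measurable_fun [set: 'rV[R]_d] (\1_(eball r) : _ -> R).
Proof. by apply: measurable_indic; exact: measurable_eball. Qed.

Lemma measurable_bumpT : measurable_fun [set: 'rV[R]_d] bump.
Proof. exact: (@measurable_bump _ _ id). Qed.

Lemma integrable_indicM r M (g : 'rV[R]_d -> R) : measurable_fun setT g ->
  (forall x, enorm x <= r -> `|g x| <= M) ->
  lambda.-integrable setT (EFin \o (fun x => \1_(eball r) x * g x)).
Proof.
move=> mg gM; apply: (@integrable_bounded_eball _ r M).
  by apply: measurable_funM => //; exact: measurable_ball_indic.
move=> x; rewrite normrM ger0_norm// indicE mulrC.
case: (boolP (x \in _)) => [|_]; last by rewrite !mulr0.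
by rewrite inE !mulr1; exact: gM.
Qed.

Lemma integrable_bumpM M (g : 'rV[R]_d -> R) : measurable_fun setT g ->
  (forall x, `|g x| <= M) ->
  lambda.-integrable setT (EFin \o (fun x => bump x * g x)).
Proof.
move=> mg gM; apply: (@integrable_bounded_eball _ 1 M).
  by apply: measurable_funM => //; exact: measurable_bumpT.
move=> x; rewrite normrM ger0_norm ?bump_ge0// mulrC.
by rewrite ler_pM ?bump_ge0// bump_le.
Qed.

Section unit_vector.
Variable e : 'rV[R]_d.
Hypothesis e1 : enorm e = 1.

Let dot_le x : `|dotv e x| <= enorm x.
Proof. by rewrite (le_trans (ler_dotv _ _))// e1 mul1r. Qed.

Lemma is_derive_ball_cos0 (s : R) : is_derive s 1 (ball_cos e)
  (- \int[lambda]_x (\1_(eball 1) x * (dotv e x * sin (s * dotv e x)))).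
Proof.
pose f t x := \1_(eball 1) x * cos ((s + t) * dotv e x).
pose df x : R := - (\1_(eball 1) x * (dotv e x * sin (s * dotv e x))).
have mdf : measurable_fun setT (fun x => \1_(eball 1) x * (dotv e x * sin (s * dotv e x))).
  apply: measurable_funM; first exact: measurable_ball_indic.
  apply: measurable_funM; first exact: measurable_dotvr.
  by apply: measurable_sinM; exact: measurable_scale_dotv.
have B := @is_derive_Rintegral0 R _ _ lambda f df (\1_(eball 1)) 1 ltr01.
have -> : ball_cos e = (fun t => \int[lambda]_y f t y) \o (fun u => u - s).
  by apply/funext => u; rewrite /ball_cos /f/= addrC subrK.
have -> : (- \int[lambda]_x (\1_(eball 1) x * (dotv e x * sin (s * dotv e x)))) =
    (\int[lambda]_x df x) * 1.
  rewrite mulr1 -mulN1r -RintegralZl//; last first.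
    apply: (@integrable_indicM 1 1) => [|x x1].
      apply: measurable_funM; first exact: measurable_dotvr.
      by apply: measurable_sinM; exact: measurable_scale_dotv.
    rewrite normrM -[1]mulr1 ler_pM ?normr_sin_le1//.
    exact: le_trans (dot_le _) x1.
  by apply: eq_Rintegral => x _; rewrite mulN1r.
apply: is_derive1_comp; rewrite ?subrr.
apply: B.
- move=> t _; apply: (@integrable_indicM 1 1) => [|x _]; last exact: normr_cos_le1.
  by apply: measurable_cosM; exact: measurable_scale_dotv.
- by apply: measurableT_comp.
- apply: (@integrable_bounded_eball _ 1 1); first exact: measurable_ball_indic.
  by move=> x; rewrite mul1r ger0_norm.
- move=> t x _; rewrite /f -mulrBr normrM ger0_norm//.
  rewrite mulrC indicE; case: (boolP (x \in _)); last by rewrite !mulr0.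
  rewrite inE /eball/= !mulr1 => x1; rewrite (le_trans (ler_dist_cos _ _))//.
  rewrite -mulrBl addr0 addrAC subrr add0r normrM ler_piMr//.
  exact: le_trans (dot_le _) x1.
- apply/aeW => x; rewrite /f /df.
  have -> : (fun t => \1_(eball 1) x * cos ((s + t) * dotv e x)) =
      cst (\1_(eball 1) x) * (cos \o (fun t : R => (s + t) * dotv e x)) by [].
  have dl : is_derive (0 : R) 1 (fun t : R => (s + t) * dotv e x) (dotv e x).
    have -> : (fun t : R => (s + t) * dotv e x) = (cst s + id) * cst (dotv e x) by [].
    apply: is_derive_eq; rewrite /GRing.scale/= /cst; ring.
  have dc := @is_derive1_comp _ cos (fun t : R => (s + t) * dotv e x) _ _ _ (is_derive_cos _) dl.
  apply: is_derive_eq; rewrite /GRing.scale/= /cst addr0; ring.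
- have -> : +%R^~ (- s) = id + cst (- s) by [].
  by apply: is_derive_eq; exact: subr0.
Qed.

Let sqr_enormB x (t : R) : enorm (x - t *: e) ^+ 2 = enorm x ^+ 2 - t * (dotv e x *+ 2) + t ^+ 2.
Proof.
rewrite -scaleNr sqr_enormD dotvZr enormZ e1 mulr1 normrN real_normK ?num_real//.
by rewrite (dotvC x); ring.
Qed.

Let bump_shift_supp x (t : R) : `|t| < 1 -> ~~ (enorm x <= 2) -> bump (x - t *: e) = 0.
Proof.
move=> t1; rewrite -ltNge => x2; rewrite /bump max_l// subr_le0 exprn_ege1//.
have := ler_enormD (x - t *: e) (t *: e); rewrite subrK enormZ e1 mulr1; lra.
Qed.

Lemma bump_sin0 (s : R) : \int[lambda]_x (bump x * sin (s * dotv e x)) = 0.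
Proof.
have N1 : -1 != 0 :> R by rewrite oppr_eq0 oner_eq0.
have ib : lambda.-integrable setT (EFin \o (fun x => bump x * sin (s * dotv e x))).
  apply: (@integrable_bumpM 1) => [|x]; last exact: normr_sin_le1.
  by apply: measurable_sinM; exact: measurable_scale_dotv.
have := Rintegral_affine 0 N1 ib; rewrite normrN1 expr1n mul1r.
under eq_Rintegral => x _ do rewrite addr0 /bump enormZ normrN1 mul1r dotvZr mulrCA mulN1r sinN mulrN -mulN1r.
rewrite RintegralZl// mulN1r; lra.
Qed.

(* Compares the derivatives at [t = 0] of the two sides of
   [\int bump (x - t e) sin (s (e . x)) = sin (s t) bump_cos e s]. *)
Lemma ball_sin (s : R) :
  (\int[lambda]_x (\1_(eball 1) x * (dotv e x * sin (s * dotv e x)))) *+ 2 =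
  s * bump_cos e s.
Proof.
have ms : measurable_fun setT (fun x => sin (s * dotv e x)).
  by apply: measurable_sinM; exact: measurable_scale_dotv.
pose f t x := bump (x - t *: e) * sin (s * dotv e x).
pose df x : R := \1_(eball 1) x * (dotv e x * sin (s * dotv e x)) * 2.
have Ff : (fun t => \int[lambda]_x f t x) = (fun t => sin (s * t) * bump_cos e s).
  apply/funext => t.
  have it : lambda.-integrable setT (EFin \o (fun x => bump x * sin (s * dotv e x + s * t))).
    apply: (@integrable_bumpM 1) => [|x]; last exact: normr_sin_le1.
    apply: measurable_sinM; apply: measurable_funD => //; exact: measurable_scale_dotv.
  have := Rintegral_affine (- (t *: e)) (oner_neq0 R) it.
  rewrite normr1 expr1n mul1r => H.
  transitivity (\int[lambda]_x (bump x * sin (s * dotv e x + s * t))).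
    rewrite -H; apply: eq_Rintegral => x _; rewrite /f scale1r; congr (_ * sin _).
    by rewrite dotvDr -scaleNr dotvZr dotv_enorm e1 expr1n; ring.
  have -> : (fun x => bump x * sin (s * dotv e x + s * t)) = (fun x =>
     cos (s * t) * (bump x * sin (s * dotv e x)) + sin (s * t) * (bump x * cos (s * dotv e x))).
    by apply/funext => x; rewrite sinD; ring.
  have ib1 : lambda.-integrable setT (EFin \o (fun x => bump x * sin (s * dotv e x))).
    by apply: (@integrable_bumpM 1) => // x; exact: normr_sin_le1.
  have ib2 : lambda.-integrable setT (EFin \o (fun x => bump x * cos (s * dotv e x))).
    apply: (@integrable_bumpM 1) => [|x]; last exact: normr_cos_le1.
    by apply: measurable_cosM; exact: measurable_scale_dotv.
  rewrite RintegralD//; [|exact: integrableZl ib1|exact: integrableZl ib2].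
  rewrite RintegralZl// RintegralZl//.
  by rewrite bump_sin0 mulr0 add0r.
have D1 : is_derive (0 : R) 1 (fun t => sin (s * t) * bump_cos e s) (s * bump_cos e s).
  have -> : (fun t => sin (s * t) * bump_cos e s) =
      (sin \o (cst s * id)) * cst (bump_cos e s) by [].
  have dl : is_derive (0 : R) 1 (cst s * id) s.
    by apply: is_derive_eq; rewrite /GRing.scale/= /cst; ring.
  have dc := @is_derive1_comp _ sin (cst s * id) _ _ _ (is_derive_sin _) dl.
  have E : cos ((cst s * id) 0) * s = s.
    by rewrite (_ : (cst s * id) 0 = 0) ?cos0 ?mul1r//; exact: mulr0.
  rewrite E in dc; apply: is_derive_eq; rewrite /GRing.scale/= /cst; ring.
have D2 : is_derive (0 : R) 1 (fun t => \int[lambda]_x f t x) (\int[lambda]_x df x).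
  (* For [|t| < 1] both bumps vanish outside the ball of radius 2, and inside it
     [|2 (e . x) - t| <= 5]. *)
  apply: (@is_derive_Rintegral0 _ _ _ _ _ _ (fun x => 5 * \1_(eball 2) x) 1) => //.
  - move=> t t1; apply: (@integrable_bounded_eball _ 2 1).
      by apply: measurable_funM => //; apply: measurable_bump; exact: measurable_funB_rV.
    move=> x; rewrite mul1r indicE normrM; case: (boolP (x \in _)) => x2.
      by rewrite -[1%:R]mulr1 ler_pM ?normr_sin_le1// ger0_norm ?bump_ge0// bump_le1.
    by rewrite bump_shift_supp ?normr0 ?mul0r//; move: x2; rewrite notin_setE /eball/= => /negP.
  - apply: measurable_funM => //; apply: measurable_funM; first exact: measurable_ball_indic.
    by apply: measurable_funM => //; exact: measurable_dotvr.
  - apply: (@integrable_bounded_eball _ 2 5) => [|x]; last by rewrite ger0_norm ?mulr_ge0.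
    by apply: measurable_funM => //; exact: measurable_ball_indic.
  - move=> t x t1; rewrite /f scale0r subr0 -mulrBl normrM indicE.
    case: (boolP (x \in _)); rewrite ?inE ?notin_setE /eball/= => x2; last first.
      have /negP x2' := x2.
      rewrite bump_shift_supp// (_ : bump x = 0) ?subrr ?normr0 ?mul0r ?mulr0//.
      by have := @bump_shift_supp x 0; rewrite scale0r subr0 normr0; apply.
    rewrite mulr1 -[X in _ <= X]mulr1 ler_pM ?normr_sin_le1//.
    rewrite (le_trans (ler_dist_max0 _ _))// sqr_enormB.
    have -> : 1 - (enorm x ^+ 2 - t * (dotv e x *+ 2) + t ^+ 2) - (1 - enorm x ^+ 2) =
      t * (dotv e x *+ 2 - t) by ring.
    rewrite normrM ler_wpM2l// (le_trans (ler_normB _ _))// normrMn.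
    have := dot_le x; lra.
  - apply: filterS ae_bumpE => x x1.
    have psi0 : (fun t : R => 1 - enorm (x - t *: e) ^+ 2) 0 != 0.
      rewrite scale0r subr0 subr_eq0 eq_sym sqrf_eq1 (negbTE x1)/=.
      by apply/eqP => xN; have := enorm_ge0 x; rewrite xN; lra.
    have dpsi : is_derive (0 : R) 1 (fun t : R => 1 - enorm (x - t *: e) ^+ 2) (dotv e x *+ 2).
      have -> : (fun t : R => 1 - enorm (x - t *: e) ^+ 2) =
        cst (1 - enorm x ^+ 2) + id * cst (dotv e x *+ 2) - id ^+ 2.
        by apply/funext => t; rewrite sqr_enormB !fctE; ring.
      by apply: is_derive_eq; rewrite /GRing.scale/= /cst; ring.
    have := is_derive_max0 dpsi psi0; rewrite scale0r subr0 => dm.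
    have -> : f^~ x = (fun t => Num.max 0 (1 - enorm (x - t *: e) ^+ 2)) * cst (sin (s * dotv e x)) by [].
    apply: is_derive_eq; rewrite /GRing.scale/= mulr0 add0r /df indicE /cst.
    have -> : (0 < 1 - enorm x ^+ 2) = (x \in eball 1).
      have E : (0 < 1 - enorm x ^+ 2) = (enorm x < 1).
        by rewrite subr_gt0 expr_lt1//; exact: enorm_ge0.
      by rewrite E lt_neqAle x1/=; apply/idP/idP; rewrite inE.
    by case: (x \in eball 1) => /=; rewrite ?mul0r ?mulr0 ?mul1r// -mulr_natr; ring.
rewrite -Ff in D1.
have [_ <-] := D1; have [_ ->] := D2.
rewrite RintegralZr//; first by rewrite mulr_natr.
apply: (@integrable_indicM 1 1) => [|x x1].
  by apply: measurable_funM => //; exact: measurable_dotvr.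
rewrite normrM -[1]mulr1 ler_pM ?normr_sin_le1//.
exact: le_trans (dot_le _) x1.
Qed.

Let bumpE x : bump x = \1_(eball 1) x * (1 - enorm x ^+ 2).
Proof.
rewrite indicE /bump; case: (boolP (x \in _)); rewrite ?inE ?notin_setE /eball/= => x1.
  by rewrite mul1r max_r// subr_ge0 exprn_ile1// enorm_ge0.
by rewrite mul0r max_l// subr_le0 exprn_ege1// ltW// ltNge; exact/negP.
Qed.

(* Uses the dilation [x -> (1 + t) x] in place of differentiating the phase. *)
Lemma is_derive_bump_cos0 (s : R) : 0 < s -> is_derive s 1 (bump_cos e)
  (s^-1 * ((ball_cos e s - bump_cos e s) *+ 2 - d%:R * bump_cos e s)).
Proof.
move=> s0; have sn0 : s != 0 by rewrite gt_eqF.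
have mc : measurable_fun setT (fun x => cos (s * dotv e x)).
  by apply: measurable_cosM; exact: measurable_scale_dotv.
pose f t x := bump ((1 + t) *: x) * cos (s * dotv e x).
pose df x : R := \1_(eball 1) x * (enorm x ^+ 2 * cos (s * dotv e x)) * (-2).
have bump0 x (t : R) : `|t| < 1/2 -> ~~ (enorm x <= 2) -> bump ((1 + t) *: x) = 0.
  rewrite -ltNge ltr_norml => /andP[t1 t2] x2.
  rewrite /bump max_l// subr_le0 exprn_ege1// enormZ ger0_norm; last lra.
  nra.
have ib : lambda.-integrable setT (EFin \o (fun x => bump x * cos (s * dotv e x))).
  by apply: (@integrable_bumpM 1) => // x; exact: normr_cos_le1.
have iB : lambda.-integrable setT (EFin \o (fun x => \1_(eball 1) x * cos (s * dotv e x))).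
  by apply: (@integrable_indicM 1 1) => // x _; exact: normr_cos_le1.
(* The radial derivative [- 2 |x|^2] on the ball is twice the difference of [bump] and the
   indicator. This closes the system: no third Fourier integral appears. *)
have Edf : \int[lambda]_x df x = (bump_cos e s - ball_cos e s) * 2.
  have -> : df = (fun x => (bump x * cos (s * dotv e x) - \1_(eball 1) x * cos (s * dotv e x)) * 2).
    by apply/funext => x; rewrite /df bumpE; ring.
  rewrite RintegralZr//; first by rewrite RintegralB.
  exact: (integrableB measurableT ib iB).
have DF : is_derive (0 : R) 1 (fun t => \int[lambda]_x f t x) (\int[lambda]_x df x).
  apply: (@is_derive_Rintegral0 _ _ _ _ _ _ (fun x => 12 * \1_(eball 2) x) (1/2)) => //.
  - move=> t t1; apply: (@integrable_bounded_eball _ 2 1).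
      apply: measurable_funM => //; apply: measurable_bump.
      exact: (@measurable_funZ_rV _ _ _ _ (cst (1 + t)) id).
    move=> x; rewrite mul1r indicE normrM; case: (boolP (x \in _)) => x2.
      by rewrite -[1%:R]mulr1 ler_pM ?normr_cos_le1// ger0_norm ?bump_ge0// bump_le1.
    by rewrite bump0 ?normr0 ?mul0r//; move: x2; rewrite notin_setE /eball/= => /negP.
  - apply: measurable_funM => //; apply: measurable_funM; first exact: measurable_ball_indic.
    apply: measurable_funM => //; apply: measurable_funX; exact: (@measurable_enorm _ _ _ _ id).
  - apply: (@integrable_bounded_eball _ 2 12) => [|x]; last by rewrite ger0_norm ?mulr_ge0.
    by apply: measurable_funM => //; exact: measurable_ball_indic.
  - move=> t x t1; rewrite /f addr0 scale1r -mulrBl normrM indicE.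
    case: (boolP (x \in _)); rewrite ?inE ?notin_setE /eball/= => x2; last first.
      have /negP x2' := x2.
      rewrite bump0// (_ : bump x = 0) ?subrr ?normr0 ?mul0r ?mulr0//.
      by have := @bump0 x 0; rewrite addr0 scale1r normr0; apply.
    rewrite mulr1 -[X in _ <= X]mulr1 ler_pM ?normr_cos_le1//.
    rewrite (le_trans (ler_dist_max0 _ _))// enormZ exprMn real_normK ?num_real//.
    have -> : 1 - (1 + t) ^+ 2 * enorm x ^+ 2 - (1 - enorm x ^+ 2) =
      t * (- ((2 + t) * enorm x ^+ 2)) by ring.
    rewrite normrM ler_wpM2l// normrN normrM (ger0_norm (sqr_ge0 _)).
    have x4 : enorm x ^+ 2 <= 4 by have := enorm_ge0 x; nra.
    have t3 : `|2 + t| <= 3 by move: t1; rewrite ltr_norml ler_norml; lra.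
    by rewrite (_ : 12 = 3 * 4 :> R); [rewrite ler_pM ?sqr_ge0|ring].
  - apply: filterS ae_bumpE => x x1.
    have psi0 : (fun t : R => 1 - enorm ((1 + t) *: x) ^+ 2) 0 != 0.
      rewrite addr0 scale1r subr_eq0 eq_sym sqrf_eq1 (negbTE x1)/=.
      by apply/eqP => xN; have := enorm_ge0 x; rewrite xN; lra.
    have dpsi : is_derive (0 : R) 1 (fun t : R => 1 - enorm ((1 + t) *: x) ^+ 2) (- (enorm x ^+ 2 *+ 2)).
      have -> : (fun t : R => 1 - enorm ((1 + t) *: x) ^+ 2) =
        cst 1 - (cst 1 + id) ^+ 2 * cst (enorm x ^+ 2).
        by apply/funext => t; rewrite enormZ exprMn real_normK ?num_real// !fctE.
      by apply: is_derive_eq; rewrite /GRing.scale/= !fctE /cst; ring.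
    have := is_derive_max0 dpsi psi0; rewrite addr0 scale1r => dm.
    have -> : f^~ x = (fun t => Num.max 0 (1 - enorm ((1 + t) *: x) ^+ 2)) * cst (cos (s * dotv e x)) by [].
    apply: is_derive_eq; rewrite /GRing.scale/= mulr0 add0r /df indicE /cst.
    have -> : (0 < 1 - enorm x ^+ 2) = (x \in eball 1).
      have E : (0 < 1 - enorm x ^+ 2) = (enorm x < 1).
        by rewrite subr_gt0 expr_lt1//; exact: enorm_ge0.
      by rewrite E lt_neqAle x1/=; apply/idP/idP; rewrite inE.
    by case: (x \in eball 1) => /=; rewrite ?mul0r ?mulr0 ?mul1r// -mulr_natr; ring.
(* Substituting [(s / u) x] for [x] freezes the phase at [s] and moves the dependence on [u] into
   [bump], with [t = s / u - 1]. *)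
have QF : \forall u \near s, (fun u => (s / u) ^+ d * \int[lambda]_x f (s / u - 1) x) u = bump_cos e u.
  have : \forall u \near s, 0 < u by exact: lt_nbhsr.
  apply: filterS => u u0.
  have c0 : s / u != 0 by rewrite mulf_neq0// invr_eq0 gt_eqF.
  have iu : lambda.-integrable setT (EFin \o (fun x => bump x * cos (u * dotv e x))).
    apply: (@integrable_bumpM 1) => [|x]; last exact: normr_cos_le1.
    by apply: measurable_cosM; exact: measurable_scale_dotv.
  have := Rintegral_affine 0 c0 iu; rewrite gtr0_norm ?divr_gt0// => H.
  rewrite /bump_cos -H /=.
  congr (_ * _); apply: eq_Rintegral => x _; rewrite /f addrC subrK addr0; congr (_ * cos _).
  by rewrite dotvZr; field; rewrite gt_eqF.
apply: (near_eq_is_derive QF).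
have di : is_derive s 1 (fun u : R => s / u) (- s^-1).
  have dV := @is_deriveV _ (id : R -> R) s 1 1 sn0 (is_derive_id _ _).
  have -> : (fun u : R => s / u) = cst s * (fun y : R => y^-1) by [].
  by apply: is_derive_eq; rewrite /GRing.scale/= /cst; field.
have dg : is_derive s 1 (fun u : R => s / u - 1) (- s^-1).
  have -> : (fun u : R => s / u - 1) = (fun u : R => s / u) - cst 1 by [].
  by apply: is_derive_eq; rewrite subr0.
have sg : s / s - 1 = 0 by rewrite divff// subrr.
have dF : is_derive (s / s - 1) 1 (fun t => \int[lambda]_x f t x) (\int[lambda]_x df x).
  by rewrite sg.
have dc := @is_derive1_comp _ _ (fun u : R => s / u - 1) _ _ _ dF dg.
have dM := is_deriveM (is_deriveX d di) dc.
rewrite (_ : _ * _ = (fun u => (s / u) ^+ d * \int[lambda]_x f (s / u - 1) x)) in dM; last first.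
  by apply/funext => u; rewrite -[LHS]/(((fun u : R => s / u) ^+ d) u * _) exprfctE.
rewrite exprfctE /= sg Edf divff// !expr1n /GRing.scale/= in dM.
rewrite (_ : s^-1 * _ = 1 * ((bump_cos e s - ball_cos e s) * 2 * - s^-1) +
  (\int[lambda]_x f 0 x) * (d%:R * 1 * - s^-1))//.
have -> : \int[lambda]_x f 0 x = bump_cos e s.
  by apply: eq_Rintegral => x _; rewrite /f addr0 scale1r.
by rewrite mulr2n; ring.
Qed.

Lemma Rintegral_indic_eball r : \int[lambda]_x (\1_(eball r) x) = fine (lambda (eball r)).
Proof. by rewrite /Rintegral integral_indic ?setIT//; exact: measurable_eball. Qed.

Lemma integrable_indic_eball r : lambda.-integrable setT (EFin \o (\1_(eball r) : _ -> R)).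
Proof.
apply: (@integrable_bounded_eball _ r 1); first exact: measurable_ball_indic.
by move=> x; rewrite mul1r ger0_norm.
Qed.

Lemma normr_integral_eball (g : 'rV[R]_d -> R) r : measurable_fun setT g ->
  (forall x, `|g x| <= \1_(eball r) x) ->
  `|\int[lambda]_x g x| <= fine (lambda (eball r)).
Proof.
move=> mg gB.
have ig : lambda.-integrable setT (EFin \o g).
  by apply: (@integrable_bounded_eball _ r 1) => // x; rewrite mul1r.
rewrite (le_trans (le_normr_Rintegral _ _))// -Rintegral_indic_eball.
apply: le_Rintegral => //; last exact: integrable_indic_eball.
exact: (integrable_norm ig).
Qed.

Lemma ball_cos_le (s : R) : `|ball_cos e s| <= vol1 R d.
Proof.
apply: normr_integral_eball => [|x].
  apply: measurable_funM; first exact: measurable_ball_indic.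
  by apply: measurable_cosM; exact: measurable_scale_dotv.
by rewrite normrM ger0_norm// ler_piMr// normr_cos_le1.
Qed.

Lemma bump_cos_le (s : R) : `|bump_cos e s| <= vol1 R d.
Proof.
apply: normr_integral_eball => [|x].
  apply: measurable_funM; first exact: measurable_bumpT.
  by apply: measurable_cosM; exact: measurable_scale_dotv.
rewrite normrM ger0_norm ?bump_ge0// (le_trans _ (bump_le x))//.
by rewrite ler_piMr ?bump_ge0// normr_cos_le1.
Qed.

(** With [q t = t * bump_cos e t / 2], the two derivatives computed above form the system of
    [energy_decay] for [a = d + 1]. The energy at [2 * a] is controlled by the trivial bound [vol1]
    on both integrals, which also settles the range [s < 2 * a]. The constant does not depend on the
    direction [e]. *)
Lemma ball_cos_decay_unit : (0 < d)%N ->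
  forall s : R, 0 < s ->
  s ^+ d.+1 * ball_cos e s ^+ 2 <=
  (2 * d.+1%:R) ^+ d.-1 * (14 * d.+1%:R ^+ 2) * (vol1 R d ^+ 2 * (1 + d.+1%:R ^+ 2)).
Proof.
move=> d0 s s0; pose a : R := d.+1%:R; rewrite -/a.
have dE : d.-1.+2 = d.+1 by rewrite prednK.
have aE : a = d.-1.+2%:R by rewrite dE.
have a1 : 1 <= a by rewrite ler1n.
pose q t : R := t * bump_cos e t / 2.
have dA (t : R) : 0 < t -> is_derive t 1 (ball_cos e) (- q t).
  move=> t0; have := is_derive_ball_cos0 t.
  by have := ball_sin t; rewrite -mulr_natr /q => <-; rewrite mulfK.
have dq (t : R) : 0 < t -> is_derive t 1 q (ball_cos e t - a / t * q t).
  move=> t0; have db := is_derive_bump_cos0 t0.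
  rewrite {1}(_ : q = id * bump_cos e * cst 2^-1)//.
  have ad : a = d%:R + 1 by rewrite natr1.
  apply: is_derive_eq; rewrite /GRing.scale/= ad /q /cst mulr2n.
  by field; rewrite gt_eqF.
have Ab := ball_cos_le; have v0 := vol1_gt0 R d.
have Ab2 t : ball_cos e t ^+ 2 <= vol1 R d ^+ 2.
  by rewrite -[X in X <= _]real_normK ?num_real// ler_pXn2r ?nnegrE// ltW.
have qb : q (2 * a) ^+ 2 <= vol1 R d ^+ 2 * a ^+ 2.
  have -> : q (2 * a) = bump_cos e (2 * a) * a by rewrite /q; field.
  rewrite exprMn ler_wpM2r ?sqr_ge0//.
  by rewrite -[X in X <= _]real_normK ?num_real// ler_pXn2r ?nnegrE ?bump_cos_le// ltW.
have c0 : 0 <= (2 * a) ^+ d.-1 by rewrite exprn_ge0//; lra.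
have [as_|sa] := leP (2 * a) s.
  have := energy_decay aE dA dq as_; rewrite dE => /le_trans; apply.
  rewrite ler_wpM2l//; first by rewrite mulr_ge0// mulr_ge0// sqr_ge0.
  rewrite mulrDr mulr1; exact: lerD.
apply: (@le_trans _ _ ((2 * a) ^+ d.+1 * vol1 R d ^+ 2)).
  apply: ler_pM => //; [by rewrite exprn_ge0// ltW|exact: sqr_ge0|].
  by rewrite ler_pXn2r ?nnegrE// ?ltW//; lra.
rewrite -dE !exprSr -!mulrA ler_wpM2l//.
have : 0 <= vol1 R d ^+ 2 by exact: sqr_ge0.
have : 0 <= a ^+ 2 * vol1 R d ^+ 2 by rewrite mulr_ge0 ?sqr_ge0.
have : 0 <= a ^+ 2 * a ^+ 2 * vol1 R d ^+ 2 by rewrite mulr_ge0 ?sqr_ge0// mulr_ge0 ?sqr_ge0.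
move=> *; nra.
Qed.

End unit_vector.

Definition decay_const : R :=
  (2 * d.+1%:R) ^+ d.-1 * (14 * d.+1%:R ^+ 2) * (vol1 R d ^+ 2 * (1 + d.+1%:R ^+ 2)).

Lemma decay_const_ge0 : 0 <= decay_const.
Proof. by rewrite !mulr_ge0// ?exprn_ge0// ?mulr_ge0// ?addr_ge0 ?sqr_ge0// ltW// vol1_gt0. Qed.

(** The Fourier transform of the indicator of the ball; its sine part vanishes by symmetry. *)
Definition ball_transform (r : R) (kappa : 'rV[R]_d) : R :=
  \int[lambda]_x (\1_(eball r) x * cos (dotv kappa x)).

(** Dilation by [r] reduces to the unit ball at frequency [r * enorm kappa]; the squared Jacobian
    splits into [r ^+ d.+1], absorbed by the decay, and [r ^+ d.-1]. *)
Lemma ball_transform_decay (r : R) (kappa : 'rV[R]_d) : (0 < d)%N -> 0 < r ->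
  ball_transform r kappa ^+ 2 * enorm kappa ^+ d.+1 <= decay_const * r ^+ d.-1.
Proof.
move=> d0 r0.
have [->|k0] := eqVneq (enorm kappa) 0.
  by rewrite expr0n mulr0 mulr_ge0 ?decay_const_ge0// exprn_ge0// ltW.
have kp : 0 < enorm kappa by rewrite lt0r k0 enorm_ge0.
pose e := (enorm kappa)^-1 *: kappa.
have e1 : enorm e = 1 by rewrite enormZ ger0_norm ?invr_ge0 ?enorm_ge0// mulVf.
have rn0 : r != 0 by rewrite gt_eqF.
have E : ball_transform r kappa = r ^+ d * ball_cos e (r * enorm kappa).
  have ig : lambda.-integrable setT (EFin \o (fun x => \1_(eball r) x * cos (dotv kappa x))).
    apply: (@integrable_indicM r 1) => [|x _]; last exact: normr_cos_le1.
    by apply: measurable_cosM; exact: measurable_dotvr.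
  have H := Rintegral_affine 0 rn0 ig.
  rewrite /ball_transform -H gtr0_norm//; congr (_ * _); apply: eq_Rintegral => x _.
  rewrite addr0; congr (_ * cos _).
    rewrite !indicE; congr (nat_of_bool _)%:R; apply/idP/idP; rewrite !inE /eball/= enormZ gtr0_norm//;
    by rewrite -ler_pdivlMl// mulVf.
  by rewrite dotvZr /e dotvZl; field.
have := ball_cos_decay_unit e1 d0 (mulr_gt0 r0 kp); rewrite -/decay_const => D.
rewrite E exprMn.
have -> : r ^+ d ^+ 2 * ball_cos e (r * enorm kappa) ^+ 2 * enorm kappa ^+ d.+1 =
  ((r * enorm kappa) ^+ d.+1 * ball_cos e (r * enorm kappa) ^+ 2) * r ^+ d.-1.
  have -> : r ^+ d ^+ 2 = r ^+ d.+1 * r ^+ d.-1.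
    by rewrite -exprM -exprD; congr (_ ^+ _); lia.
  rewrite exprMn; ring.
by rewrite ler_wpM2r// exprn_ge0// ltW.
Qed.

End ball_integrals.

(** * Lattices and fundamental domains *)

Section esum_countType.
Context (R : realType) (I : countType).
Local Open Scope ereal_scope.
Implicit Type f : I -> \bar R.

(** Turns the unordered sum into a series over codes, with 0 at the integers that code nothing, so
    that the theorems on series of nonnegative functions apply. *)
Lemma esum_pickle f : (forall i, 0 <= f i) ->
  \esum_(i in [set: I]) f i = \sum_(n <oo) oapp f 0 (pickle_inv n : option I).
Proof.
move=> f0; rewrite nneseries_esumT; last by move=> n; case: pickle_inv => /=.
have -> : \esum_(i in [set: I]) f i =
    \esum_(n in range (@pickle I)) oapp f 0 (pickle_inv n : option I).
  rewrite esum_image; first by apply: eq_esum => i _; rewrite pickleK_inv.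
  by move=> i j _ _ /(pcan_inj pickleK).
rewrite esum_mkcond; apply: eq_esum => n _.
case: (boolP (n \in _)) => // /negP nP; case E : (pickle_inv n : option I) => [i|]//.
exfalso; apply: nP; rewrite inE; exists i => //.
by have := @pickle_invK I n; rewrite E.
Qed.

Lemma esum_single f (i : I) : (forall j, 0 <= f j) ->
  (forall j, j != i -> f j = 0) -> \esum_(j in [set: I]) f j = f i.
Proof.
move=> f0 fi; rewrite -[RHS](esum_set1 (f0 i)) [RHS]esum_mkcond.
apply: eq_esum => j _; case: ifPn => //; rewrite notin_setE/= => /eqP; exact: fi.
Qed.

Lemma esum_ge_term f (i : I) : (forall j, 0 <= f j) -> f i <= \esum_(j in [set: I]) f j.
Proof.
by move=> f0; apply: esum_ge; exists [set i]; [split|rewrite fsbig_set1].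
Qed.

Lemma esumZl f (x : \bar R) : 0 <= x -> (forall i, 0 <= f i) ->
  \esum_(i in [set: I]) (x * f i) = x * \esum_(i in [set: I]) f i.
Proof.
move=> x0 f0; have xf0 i : 0 <= x * f i by exact: mule_ge0.
case: x x0 xf0 => [x| |]// x0 xf0.
  rewrite !esum_pickle// -nneseriesZl//; last by move=> n _; case: pickle_inv => /=.
  by apply: eq_eseriesr => n _; case: pickle_inv => //=; rewrite mule0.
have [f00|/existsNP[i /eqP fi]] := pselect (forall i, f i = 0).
  by rewrite !esum1 ?mule0// => i _; rewrite f00 mule0.
have fi0 : 0 < f i by rewrite lt0e fi f0.
rewrite [RHS]gt0_mulye ?(lt_le_trans fi0)// ?esum_ge_term//.
apply/eqP; rewrite -leye_eq.
by have := esum_ge_term i xf0; rewrite gt0_mulye.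
Qed.

Context dT (T : measurableType dT) (mu : {measure set T -> \bar R}).

Lemma measurable_esum (F : I -> T -> \bar R) :
  (forall i x, 0 <= F i x) -> (forall i, measurable_fun setT (F i)) ->
  measurable_fun setT (fun x => \esum_(i in [set: I]) F i x).
Proof.
move=> F0 mF; under eq_fun do rewrite esum_pickle//.
apply: ge0_emeasurable_sum.
  by move=> n x _ _; case: pickle_inv => //=.
by move=> n _; case: pickle_inv => [i|] /=; [exact: mF|exact: measurable_cst].
Qed.

Lemma ge0_integral_esum (F : I -> T -> \bar R) (E : set T) : measurable E ->
  (forall i x, 0 <= F i x) -> (forall i, measurable_fun setT (F i)) ->
  \int[mu]_(x in E) (\esum_(i in [set: I]) F i x) = \esum_(i in [set: I]) \int[mu]_(x in E) F i x.
Proof.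
move=> mE F0 mF; under eq_integral do rewrite esum_pickle//.
rewrite esum_pickle; last by move=> i; exact: integral_ge0.
rewrite integral_nneseries//.
- by apply: eq_eseriesr => n _; case: pickle_inv => [i|] //=; rewrite integral0.
- move=> n; case: pickle_inv => [i|] /=; last exact: measurable_cst.
  by apply: measurable_funTS; exact: mF.
- by move=> n x _; case: pickle_inv => //=.
Qed.

End esum_countType.

Section lattice_coordinates.
Context (R : realType) (d : nat) (a : d.-tuple 'rV[R]_d).
Hypothesis a_basis : basis_of fullv a.
Implicit Types (x y : 'rV[R]_d) (z : {ffun 'I_d -> int}).

(** Integer coordinates are finite functions: they form a countable additive group with decidable
    equality, over which sums can be reindexed and exchanged with integrals. *)
Definition lat z : 'rV[R]_d := \sum_(j < d) tnth a j *~ z j.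

(** The dual basis: the coordinate forms of [a] written as scalar products, so that Cauchy-Schwarz
    and measurability of [dotv] apply to them. *)
Definition dual_vec (j : 'I_d) : 'rV[R]_d := \row_i coord a j (delta_mx ord0 i).

Lemma dual_vecE j x : dotv (dual_vec j) x = coord a j x.
Proof.
rewrite {2}(row_sum_delta x) linear_sum/=; apply: eq_bigr => i _.
by rewrite linearZ/= mxE mulrC.
Qed.

Lemma dual_vec_tnth i j : dotv (dual_vec j) (tnth a i) = (i == j)%:R.
Proof.
rewrite dual_vecE (tnth_nth 0) coord_free//; exact: basis_free a_basis.
Qed.

Lemma dual_vec_sum j (t : 'I_d -> R) :
  dotv (dual_vec j) (\sum_(i < d) t i *: tnth a i) = t j.
Proof.
rewrite dual_vecE linear_sum/= (bigD1 j)//= big1 ?addr0; last first.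
  by move=> i ij; rewrite linearZ/= -dual_vecE dual_vec_tnth (negbTE ij) mulr0.
by rewrite linearZ/= -dual_vecE dual_vec_tnth eqxx mulr1.
Qed.

Lemma dual_vec_expansion x : x = \sum_(j < d) dotv (dual_vec j) x *: tnth a j.
Proof.
rewrite {1}(coord_basis a_basis (memvf x)); apply: eq_bigr => j _.
by rewrite dual_vecE (tnth_nth 0).
Qed.

Lemma latE z : lat z = \sum_(j < d) (z j)%:~R *: tnth a j.
Proof. by apply: eq_bigr => j _; rewrite scaler_int. Qed.

Lemma dual_vec_lat j z : dotv (dual_vec j) (lat z) = (z j)%:~R.
Proof. by rewrite latE dual_vec_sum. Qed.

Lemma latD z1 z2 : lat (z1 + z2) = lat z1 + lat z2.
Proof. by rewrite -big_split/=; apply: eq_bigr => j _; rewrite ffunE mulrzDr. Qed.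

Lemma latN z : lat (- z) = - lat z.
Proof. by rewrite -sumrN; apply: eq_bigr => j _; rewrite ffunE mulrNz. Qed.

Lemma lat0 : lat 0 = 0.
Proof. by rewrite /lat big1// => j _; rewrite ffunE. Qed.

Lemma lat_inj : injective lat.
Proof.
move=> z1 z2 E; apply/ffunP => j.
have := dual_vec_lat j z1; rewrite E dual_vec_lat => /esym.
by move/eqP; rewrite eqr_int => /eqP.
Qed.

Lemma lat_lattice z : lattice a (lat z).
Proof. by exists z. Qed.

Lemma lattice_lat x : lattice a x -> exists z, x = lat z.
Proof. by move=> [z ->]; exists (finfun z); apply: eq_bigr => j _; rewrite ffunE. Qed.

Lemma esum_lattice (f : 'rV[R]_d -> \bar R) :
  (\esum_(x in lattice a) f x = \esum_(z in [set: {ffun 'I_d -> int}]) f (lat z))%E.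
Proof.
apply: reindex_esum; split.
- by move=> z _; exact: lat_lattice.
- by move=> z1 z2 _ _; exact: lat_inj.
- by move=> x /lattice_lat[z ->]; exists z.
Qed.

Lemma fundamental_domainP x :
  fundamental_domain a x <-> forall j, 0 <= dotv (dual_vec j) x < 1.
Proof.
split; first by move=> [t t01 ->] j; rewrite dual_vec_sum.
by move=> h; exists (fun j => dotv (dual_vec j) x) => //; exact: dual_vec_expansion.
Qed.

Definition floorv x : {ffun 'I_d -> int} := [ffun j => Num.floor (dotv (dual_vec j) x)].

Lemma fundamental_domain_shift x z :
  fundamental_domain a (x - lat z) <-> z = floorv x.
Proof.
have E j : dotv (dual_vec j) (x - lat z) = dotv (dual_vec j) x - (z j)%:~R.
  by rewrite dotvDr -latN dual_vec_lat ffunE mulrNz.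
rewrite fundamental_domainP; split => [h|-> j].
  apply/ffunP => j; rewrite ffunE; apply/esym/eqP; rewrite floor_eq.
  by have := h j; rewrite E intrD mulr1z subr_ge0 ltrBlDl.
have := floor_itv (dotv (dual_vec j) x).
by rewrite dotvDr -latN dual_vec_lat !ffunE mulrNz intrD mulr1z subr_ge0 ltrBlDl.
Qed.

Lemma measurable_fundamental_domain : measurable (fundamental_domain a).
Proof.
rewrite (_ : fundamental_domain a = \bigcap_(j in [set: 'I_d])
    (dotv (dual_vec j)) @^-1` `[0, 1[%classic).
  apply: fin_bigcap_measurable => // j _; rewrite -[X in measurable X]setTI.
  exact: measurable_dotvr.
apply/seteqP; split => x /=.
  by move/fundamental_domainP => h j _; rewrite /= in_itv/=; exact: h.
by move=> h; apply/fundamental_domainP => j; have := h j I; rewrite /= in_itv.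
Qed.

Local Notation lambda := (@lebesgue_rV R d).
Local Notation D := (fundamental_domain a).
Local Notation Z := {ffun 'I_d -> int}.

Lemma integral_indicE dT (T : measurableType dT) (mu : {measure set T -> \bar R})
    (E : set T) (f : T -> \bar R) : measurable E ->
  (\int[mu]_(w in E) f w = \int[mu]_w (f w * (\1_E w)%:E))%E.
Proof. by move=> mE; rewrite integral_mkcond epatch_indic. Qed.

Lemma indic_shift_fundamental x z : \1_D (x - lat z) = (z == floorv x)%:R :> R.
Proof.
rewrite indicE; congr (nat_of_bool _)%:R; apply/idP/eqP.
  by rewrite inE => /fundamental_domain_shift.
by move=> zx; rewrite inE; apply/fundamental_domain_shift.
Qed.

Lemma measurable_comp_rV dT (T : measurableType dT) dY (Y : measurableType dY)
    (g : 'rV[R]_d -> Y) (f : T -> 'rV[R]_d) :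
  measurable_fun setT g -> measurable_fun setT f -> measurable_fun setT (fun w => g (f w)).
Proof. by move=> mg mf; exact: (measurableT_comp mg mf). Qed.

Lemma measurable_addcst (c : 'rV[R]_d) : measurable_fun [set: 'rV[R]_d] (fun x => x + c).
Proof. exact: (@measurable_funD_rV _ _ _ _ id (cst c)). Qed.

Lemma measurable_cstadd (c : 'rV[R]_d) : measurable_fun [set: 'rV[R]_d] (fun x => c + x).
Proof. exact: (@measurable_funD_rV _ _ _ _ (cst c) id). Qed.

Lemma measurable_indicD : measurable_fun setT (\1_D : 'rV[R]_d -> R).
Proof. by apply: measurable_indic; exact: measurable_fundamental_domain. Qed.

Local Open Scope ereal_scope.

(** Each [x] lies in exactly one translate of [D], the one indexed by [floorv x], so inserting the
    sum of all indicators changes nothing. *)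
Lemma ge0_integral_tile (h : 'rV[R]_d -> \bar R) : measurable_fun setT h ->
  (forall x, 0 <= h x) ->
  \int[lambda]_x h x = \esum_(z in [set: Z]) \int[lambda]_(u in D) h (lat z + u)%R.
Proof.
move=> mh h0.
pose F (z : Z) x := h x * (\1_D (x - lat z)%R)%:E.
have F0 z x : 0 <= F z x by rewrite mule_ge0.
have mF z : measurable_fun setT (F z).
  apply: emeasurable_funM => //; apply/measurable_EFinP.
  apply: (@measurable_comp_rV _ _ _ _ (\1_D : 'rV[R]_d -> R)).
    exact: measurable_indicD.
  exact: measurable_addcst.
transitivity (\int[lambda]_x (\esum_(z in [set: Z]) F z x)).
  apply: eq_integral => x _; rewrite (@esum_single _ _ (F ^~ x) (floorv x))//.
    by rewrite /F indic_shift_fundamental eqxx mule1.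
  by move=> z zx; rewrite /F indic_shift_fundamental (negbTE zx) mule0.
rewrite ge0_integral_esum//; apply: eq_esum => z _.
rewrite -(ge0_integral_translation (lat z) (mF z))//.
rewrite [RHS]integral_indicE; last exact: measurable_fundamental_domain.
by apply: eq_integral => x _; rewrite /F addrK addrC.
Qed.

(** The translate [D + y] also meets every class modulo the lattice exactly once: cut along the
    tiling, its pieces are brought back into [D] by periodicity and cover it once. *)
Lemma ge0_integral_periodic (f : 'rV[R]_d -> \bar R) (y : 'rV[R]_d) :
  measurable_fun setT f -> (forall x, 0 <= f x) ->
  (forall x z, f (x + lat z)%R = f x) ->
  \int[lambda]_(u in D) f (u + y)%R = \int[lambda]_(u in D) f u.
Proof.
move=> mf f0 fz.
have mD := measurable_fundamental_domain.
have mI (c : 'rV[R]_d) : measurable_fun setT (fun x => (\1_D (x + c)%R)%:E : \bar R).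
  apply/measurable_EFinP; apply: (@measurable_comp_rV _ _ _ _ (\1_D : 'rV[R]_d -> R)).
    exact: measurable_indicD.
  exact: measurable_addcst.
pose h x := f x * (\1_D (x - y)%R)%:E.
have h0 x : 0 <= h x by rewrite mule_ge0.
have mh : measurable_fun setT h by apply: emeasurable_funM.
transitivity (\int[lambda]_x h x).
  rewrite -(ge0_integral_translation y mh)// [LHS]integral_indicE//.
  by apply: eq_integral => x _; rewrite /h addrK.
rewrite ge0_integral_tile// -ge0_integral_esum//; last first.
  move=> z; apply: (@measurable_comp_rV _ _ _ _ h) => //; exact: measurable_cstadd.
apply: eq_integral => u _.
rewrite (@esum_single _ _ (fun z => h (lat z + u)%R) (- floorv (u - y)%R)%R)//.
  rewrite /h addrC fz addrAC latN indic_shift_fundamental eqxx mule1//.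
move=> z zu; rewrite /h.
have -> : (lat z + u - y = (u - y) - lat (- z))%R by rewrite latN opprK [RHS]addrC addrA.
by rewrite indic_shift_fundamental eqr_oppLR (negbTE zu) mule0.
Qed.

Lemma ler_enorm_sum (I : Type) (r : seq I) (F : I -> 'rV[R]_d) :
  (enorm (\sum_(i <- r) F i) <= \sum_(i <- r) enorm (F i))%R.
Proof.
elim/big_ind2: _ => [|x1 x2 y1 y2 h1 h2|//]; first by rewrite enorm0.
by rewrite (le_trans (ler_enormD _ _))// lerD.
Qed.

Lemma fundamental_domain_bounded x : D x ->
  (enorm x <= \sum_(j < d) enorm (tnth a j))%R.
Proof.
move=> [t t01 ->]; rewrite (le_trans (ler_enorm_sum _ _))//; apply: ler_sum => j _.
have /andP[t0 t1] := t01 j.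
by rewrite enormZ ger0_norm// ler_piMl ?enorm_ge0// ltW.
Qed.

Definition volD : R := fine (lambda D).

Lemma lebesgue_fundamental_domain : lambda D = volD%:E.
Proof.
rewrite fineK// ge0_fin_numE//.
apply: (le_lt_trans _ (lebesgue_eball_fin d (\sum_(j < d) enorm (tnth a j))%R)).
apply: le_measure; rewrite ?inE//; first exact: measurable_fundamental_domain.
  exact: measurable_eball.
by move=> x /fundamental_domain_bounded.
Qed.

(** If [D] were null, the tiling would make the whole space null, although it contains a ball of
    positive volume. No determinant is involved. *)
Lemma volD_gt0 : (0 < volD)%R.
Proof.
rewrite lt0r fine_ge0// andbT; apply/eqP => v0.
have : \int[lambda]_x (cst 1 x) = 0.
  rewrite ge0_integral_tile// esum1// => z _.
  rewrite integral_cst; last exact: measurable_fundamental_domain.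
  transitivity (1 * (0 : \bar R)); last exact: mule0.
  by congr (_ * _); have := lebesgue_fundamental_domain; rewrite v0.
rewrite integral_cst// mul1e => l0.
have := @lebesgue_eball1_gt0 R d; rewrite ltNge => /negP; apply.
rewrite -l0; apply: le_measure; rewrite ?inE//; exact: measurable_eball.
Qed.

End lattice_coordinates.

(** * Fejer kernels *)

Section finite_sums.
Context (R : realType) dT (T : measurableType dT) (mu : {measure set T -> \bar R}).

Lemma integrable_sumR (D : set T) (I : Type) (s : seq I) (F : I -> T -> R) :
  measurable D -> (forall i, mu.-integrable D (EFin \o F i)) ->
  mu.-integrable D (EFin \o (fun x => \sum_(i <- s) F i x)).
Proof.
move=> mD iF.
rewrite (_ : EFin \o _ = (fun x => \sum_(i <- s) (EFin \o F i) x)%E).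
  exact: integrable_sum.
by apply/funext => x; rewrite /= sumEFin.
Qed.

Lemma Rintegral_sum (D : set T) (I : Type) (s : seq I) (F : I -> T -> R) :
  measurable D -> (forall i, mu.-integrable D (EFin \o F i)) ->
  \int[mu]_(x in D) (\sum_(i <- s) F i x) = \sum_(i <- s) \int[mu]_(x in D) F i x.
Proof.
move=> mD iF; elim: s => [|i s IH].
  rewrite big_nil (_ : (fun x => _) = cst 0); first by rewrite Rintegral_cst// mul0r.
  by apply/funext => x; rewrite big_nil.
rewrite big_cons -IH -RintegralD//; last exact: integrable_sumR.
by apply: eq_Rintegral => x _; rewrite big_cons.
Qed.

End finite_sums.

Lemma cosD2pi_int (R : realType) (x : R) (k : int) :
  cos (x + (pi *+ 2) * k%:~R) = cos x.
Proof.
case: k => n; first by rewrite -pmulrn mulr_natr (periodicn (@cosD2pi R)).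
rewrite NegzE mulrNz mulrN -pmulrn mulr_natr.
by rewrite -[LHS](periodicn (@cosD2pi R) n.+1) subrK.
Qed.

Section waves.
Context (R : realType) (d : nat) (a : d.-tuple 'rV[R]_d).
Hypothesis a_basis : basis_of fullv a.
Local Notation lambda := (@lebesgue_rV R d).
Local Notation D := (fundamental_domain a).
Local Notation Z := {ffun 'I_d -> int}.
Implicit Types (k z : Z) (x y : 'rV[R]_d).

(** The points of [2 pi] times the dual lattice, that is, the frequencies whose cosines are periodic
    with respect to the lattice. *)
Definition wave k : 'rV[R]_d := (pi *+ 2) *: \sum_j (k j)%:~R *: dual_vec a j.

Lemma dotv_suml (I : Type) (s : seq I) (F : I -> 'rV[R]_d) x :
  dotv (\sum_(i <- s) F i) x = \sum_(i <- s) dotv (F i) x.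
Proof.
elim/big_rec2 : _ => [|i y1 y2 _ <-]; last by rewrite dotvDl.
by rewrite /dotv big1// => i _; rewrite mxE mul0r.
Qed.

Lemma dotvNl x y : dotv (- x) y = - dotv x y.
Proof. by rewrite -scaleN1r dotvZl mulN1r. Qed.

Lemma dotv_wave k x :
  dotv (wave k) x = (pi *+ 2) * \sum_j (k j)%:~R * dotv (dual_vec a j) x.
Proof.
rewrite dotvZl dotv_suml; congr (_ * _).
by apply: eq_bigr => j _; rewrite dotvZl.
Qed.

Lemma waveD k1 k2 : wave (k1 + k2) = wave k1 + wave k2.
Proof.
rewrite -scalerDr -big_split/=; congr (_ *: _); apply: eq_bigr => j _.
by rewrite ffunE intrD scalerDl.
Qed.

Lemma waveN k : wave (- k) = - wave k.
Proof.
rewrite -scalerN -sumrN; congr (_ *: _); apply: eq_bigr => j _.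
by rewrite ffunE mulrNz scaleNr.
Qed.

Lemma dotv_wave_tnth k j : dotv (wave k) (tnth a j) = (pi *+ 2) * (k j)%:~R.
Proof.
rewrite dotv_wave (bigD1 j)//= big1 ?addr0; last first.
  by move=> i ij; rewrite dual_vec_tnth// eq_sym (negbTE ij) mulr0.
by rewrite dual_vec_tnth// eqxx mulr1.
Qed.

Lemma dotv_wave_lat k z : dotv (wave k) (lat a z) = (pi *+ 2) * (\sum_j k j * z j)%:~R.
Proof.
rewrite dotv_wave; congr (_ * _); rewrite rmorph_sum/=; apply: eq_bigr => j _.
by rewrite dual_vec_lat// intrM.
Qed.

Lemma cos_wave_lat k z x phi :
  cos (dotv (wave k) (x + lat a z) + phi) = cos (dotv (wave k) x + phi).
Proof. by rewrite dotvDr dotv_wave_lat addrAC cosD2pi_int. Qed.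

Lemma integrable_boundedD (g : 'rV[R]_d -> R) (M : R) : measurable_fun setT g ->
  (forall x, `|g x| <= M) -> lambda.-integrable D (EFin \o g).
Proof.
move=> mg gM; have mD := measurable_fundamental_domain a_basis.
apply: measurable_bounded_integrable => //.
- by have := lebesgue_fundamental_domain a_basis => /= ->; rewrite ltry.
- exact: measurable_funTS.
- exists M; split; first exact: num_real.
  by move=> y My x _; apply: le_trans (ltW My); exact: gM.
Qed.

Lemma RintegralD_cst (c : R) : \int[lambda]_(u in D) c = c * volD a.
Proof.
by rewrite (@Rintegral_cst _ _ _ lambda D)//; exact: measurable_fundamental_domain.
Qed.

Lemma measurable_cos_wave k phi :
  measurable_fun setT (fun x => cos (dotv (wave k) x + phi)).
Proof.
by apply: measurable_cosM; apply: measurable_funD => //; exact: measurable_dotvr.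
Qed.

Lemma integrable_cos_wave k phi :
  lambda.-integrable D (EFin \o (fun u => cos (dotv (wave k) u + phi))).
Proof.
apply: (@integrable_boundedD _ 1); first exact: measurable_cos_wave.
by move=> x; exact: normr_cos_le1.
Qed.

(* Translating by [y], which changes the phase by [pi], turns the integral into its opposite. *)
Lemma integral_wave0 k phi : k != 0 ->
  \int[lambda]_(u in D) cos (dotv (wave k) u + phi) = 0.
Proof.
move=> k0.
have [j kj] : exists j, k j != 0.
  apply/existsP; apply: contraNT k0; rewrite negb_exists => /forallP h.
  by apply/eqP/ffunP => j; rewrite ffunE; apply/eqP; have := h j; rewrite negbK.
have kjR : (k j)%:~R != 0 :> R by rewrite intr_eq0.
pose y := ((k j)%:~R *+ 2)^-1 *: tnth a j.
pose c u := cos (dotv (wave k) u + phi).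
have cy u : c (u + y) = - c u.
  rewrite /c dotvDr /y dotvZr dotv_wave_tnth.
  have -> : dotv (wave k) u + ((k j)%:~R *+ 2)^-1 * (pi *+ 2 * (k j)%:~R) + phi =
    dotv (wave k) u + phi + pi.
    by rewrite -(mulr_natr (k j)%:~R) -(mulr_natr pi); field.
  exact: cosDpi.
have mD := measurable_fundamental_domain a_basis.
have m1 : measurable_fun setT (fun x => (1 + c x)%:E).
  by apply/measurable_EFinP; apply: measurable_funD => //; exact: measurable_cos_wave.
have P : (\int[lambda]_(u in D) (1 + c (u + y))%:E = \int[lambda]_(u in D) (1 + c u)%:E)%E.
  apply: (ge0_integral_periodic a_basis y m1).
  - by move=> x; rewrite lee_fin -lerBlDl sub0r cos_geN1.
  - by move=> x z; rewrite /c cos_wave_lat.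
have ic := integrable_cos_wave k phi.
have i1 : lambda.-integrable D (EFin \o cst 1).
  by apply: (@integrable_boundedD _ 1) => // x; rewrite normr1.
have : \int[lambda]_(u in D) (1 - c u) = \int[lambda]_(u in D) (1 + c u).
  rewrite /Rintegral -P; congr fine; apply: eq_integral => u _.
  by rewrite cy.
rewrite RintegralB// RintegralD// => E.
suff : \int[lambda]_(u in D) c u *+ 2 = 0 by move/eqP; rewrite mulrn_eq0/= => /eqP.
rewrite mulr2n; move: E; rewrite /c; lra.
Qed.

Lemma integral_wave k phi :
  \int[lambda]_(u in D) cos (dotv (wave k) u + phi) = (k == 0)%:R * cos phi * volD a.
Proof.
have [->|k0] := eqVneq k 0; last by rewrite integral_wave0// !mul0r.
rewrite mul1r -RintegralD_cst; apply: eq_Rintegral => u _.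
by rewrite dotv_wave big1 ?mulr0 ?add0r// => j _; rewrite ffunE mul0r.
Qed.

(** Pairing [wave k] with [tnth a j] gives [2 pi] times [k j], so Cauchy-Schwarz bounds the norm of
    a frequency from below by its integer coordinates. *)
Lemma wave_coord_le k j : `|(k j)%:~R| <= enorm (wave k) * \sum_i enorm (tnth a i) :> R.
Proof.
have h : (pi *+ 2) * `|(k j)%:~R| <= enorm (wave k) * enorm (tnth a j) :> R.
  have := ler_dotv (wave k) (tnth a j).
  have p0 : 0 <= pi *+ 2 :> R by have := pi_ge0 R; lra.
  by rewrite dotv_wave_tnth normrM (ger0_norm p0).
apply: (@le_trans _ _ (enorm (wave k) * enorm (tnth a j))).
  apply: le_trans h; rewrite ler_peMl//; have := pi_ge2 R; lra.
rewrite ler_wpM2l ?enorm_ge0// (bigD1 j)//= lerDl sumr_ge0// => i _.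
exact: enorm_ge0.
Qed.

End waves.

(** * Inverse power sums over cubes of frequencies *)

Section counting.
Variables (d N : nat).
Local Notation I := {ffun 'I_d -> 'I_N}.

Lemma card_ffun_prod (F : 'I_d -> pred 'I_N) :
  #|[pred n : I | [forall j, F j (n j)]]| = (\prod_(j < d) #|F j|)%N.
Proof.
rewrite (eq_card (B := family F));   first by rewrite card_family foldrE big_map big_enum.
by move=> n; rewrite !inE.
Qed.

Lemma card_ffun_coord (j : 'I_d) (m : 'I_N) :
  (#|[pred n : I | n j == m]| * N = N ^ d)%N.
Proof.
pose F i : pred 'I_N := if i == j then pred1 m else predT.
rewrite (eq_card (B := [pred n : I | [forall i, F i (n i)]])); last first.
  move=> n; rewrite !inE; apply/idP/forallP => [nj i|/(_ j)]; last by rewrite /F eqxx.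
  by rewrite /F; case: eqP => [->|].
rewrite card_ffun_prod (bigD1 j)//= /F eqxx card1 mul1n.
rewrite (eq_bigr (fun=> N)); last by move=> i /negbTE ->; rewrite card_ord.
rewrite prod_nat_const cardC1 card_ord -expnSr.
by rewrite prednK//; exact: leq_ltn_trans (leq0n j) (ltn_ord j).
Qed.

Lemma card_ord_close (m s : nat) : (#|[pred i : 'I_N | `|(m%:Z - (i : nat)%:Z)%R| <= s]| <= s.*2.+1)%N.
Proof.
rewrite cardE -(size_map val).
apply: (@leq_trans (size (iota (m - s) (s.*2.+1)))); last by rewrite size_iota.
apply: uniq_leq_size; first by rewrite map_inj_uniq ?enum_uniq//; exact: val_inj.
move=> x /mapP[i]; rewrite mem_enum mem_iota => + ->; rewrite inE /=; lia.
Qed.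

Lemma card_ffun_close (n : I) (s : nat) :
  (#|[pred n' : I | [forall j, (`|((n j : nat)%:Z - (n' j : nat)%:Z)%R| <= s)%N]]| <= s.*2.+1 ^ d)%N.
Proof.
rewrite (@card_ffun_prod (fun j => [pred i : 'I_N | `|((n j : nat)%:Z - (i : nat)%:Z)%R| <= s]%N)).
apply: (@leq_trans (\prod_(j < d) s.*2.+1)%N); last by rewrite prod_nat_const card_ord.
by apply: leq_prod => j _; exact: card_ord_close.
Qed.

End counting.

Section inverse_power_sums.
Context (R : realType).

(** The sharper bound [2 - 1/n] for the sum up to [n] is the one that passes through the
    induction. *)
Lemma sum_inv_sqr (M : nat) : \sum_(1 <= s < M) s%:R ^- 2 <= 2 :> R.
Proof.
have H n : \sum_(1 <= s < n.+2) s%:R ^- 2 <= 2 - n.+1%:R^-1 :> R.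
  elim: n => [|n IH]; first by rewrite big_nat1 expr1n; lra.
  rewrite big_nat_recr//=; apply: (le_trans (lerD IH (lexx _))).
  have -> : n.+2%:R = n.+1%:R + 1 :> R by rewrite natr1.
  set x : R := n.+1%:R; have x1 : 1 <= x by rewrite ler1n.
  rewrite -subr_ge0.
  have -> : 2 - (x + 1)^-1 - (2 - x^-1 + (x + 1) ^- 2) = (x * (x + 1) ^+ 2)^-1.
    by field; rewrite !gt_eqF//; lra.
  by rewrite invr_ge0 mulr_ge0 ?sqr_ge0//; lra.
case: M => [|[|M]]; [by rewrite big_geq|by rewrite big_geq|].
by apply: (le_trans (H M)); rewrite gerBl invr_ge0.
Qed.

(* [rho ^- d.+1] is compared with the sum of [s ^- d.+2] over [rho <= s < 2 rho],
   which reduces a sum over lattice points to the cardinals of cubes. *)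
Lemma inv_expr_le_sum (d rho M : nat) : (0 < rho)%N -> (rho.*2 <= M)%N ->
  rho%:R ^- d.+1 <= 2 ^+ d.+2 * \sum_(1 <= s < M | (rho <= s)%N) s%:R ^- d.+2 :> R.
Proof.
move=> r0 rM; have rp : 0 < rho%:R :> R by rewrite ltr0n.
have H : \sum_(rho <= s < rho.*2) (rho.*2)%:R ^- d.+2 <=
    \sum_(1 <= s < M | (rho <= s)%N) s%:R ^- d.+2 :> R.
  rewrite (big_cat_nat (n := rho) (m := 1) (p := M))//=; last lia.
  rewrite [X in _ <= X + _]big_nat_cond [X in _ <= X + _]big1 ?add0r; last by move=> i; lia.
  rewrite (big_cat_nat (n := rho.*2) (m := rho) (p := M))//=; last lia.
  rewrite -[X in X <= _]addr0 lerD//; last first.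
    by apply: sumr_ge0 => i _; rewrite invr_ge0 exprn_ge0.
  rewrite [X in X <= _]big_nat_cond [X in _ <= X]big_nat_cond.
  rewrite (eq_bigl (fun i => (rho <= i < rho.*2) && (rho <= i))%N); last by move=> i /=; lia.
  apply: ler_sum => i /andP[/andP[ri ir] _].
  have ip : 0 < i%:R :> R by rewrite ltr0n; lia.
  by rewrite lef_pV2 ?posrE ?exprn_gt0// ?ltr0n ?double_gt0// ler_pXn2r ?nnegrE// ler_nat ltnW.
apply: (@le_trans _ _ (2 ^+ d.+2 * (rho%:R * (rho.*2)%:R ^- d.+2))); last first.
  rewrite ler_wpM2l ?exprn_ge0//; apply: le_trans H.
  by rewrite sumr_const_nat -addnn addnK mulr_natl.
rewrite -mul2n natrM exprMn (exprS rho%:R d.+1).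
have p0 : rho%:R ^+ d.+1 != 0 :> R by rewrite expf_neq0// gt_eqF.
have q0 : 2 ^+ d.+2 != 0 :> R by rewrite expf_neq0// pnatr_eq0.
have x0 : rho%:R != 0 :> R by rewrite gt_eqF.
move: (rho%:R ^+ d.+1 : R) (2 ^+ d.+2 : R) (rho%:R : R) p0 q0 x0 => p q x p0 q0 x0.
by rewrite le_eqVlt; apply/orP; left; apply/eqP; field; rewrite ?p0 ?q0 ?x0.
Qed.

(** Once each [rho ^- d.+1] is spread over the values of [s], the sums are exchanged: at most
    [(2 s + 1)^d <= (3 s)^d] indices satisfy [rho n' <= s], and the sum of [s ^- 2] is left. The
    bound depends on neither [N] nor [n]. *)
Lemma lattice_sum_bound (d N : nat) (n : {ffun 'I_d -> 'I_N}) (rho : {ffun 'I_d -> 'I_N} -> nat) :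
  (forall n', n' != n -> (0 < rho n')%N) -> (forall n', (rho n' <= N)%N) ->
  (forall (n' : {ffun 'I_d -> 'I_N}) j, (`|((n j : nat)%:Z - (n' j : nat)%:Z)%R| <= rho n')%N) ->
  \sum_(n' | n' != n) (rho n')%:R ^- d.+1 <= 2 ^+ d.+3 * 3 ^+ d :> R.
Proof.
move=> rho0 rhoN rhoj.
apply: (@le_trans _ _ (\sum_(n' | n' != n) 2 ^+ d.+2 *
    \sum_(1 <= s < N.*2.+1 | (rho n' <= s)%N) s%:R ^- d.+2)).
  apply: ler_sum => n' n'n; apply: inv_expr_le_sum; first exact: rho0.
  by have := rhoN n'; lia.
rewrite -mulr_sumr (exprSr 2 d.+2) -[in leRHS]mulrA.
apply: ler_wpM2l; first by rewrite exprn_ge0.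
rewrite (exchange_big_dep xpredT) //.
apply: (@le_trans _ _ (\sum_(1 <= s < N.*2.+1) 3 ^+ d * s%:R ^- 2)); last first.
  by rewrite -mulr_sumr mulrC ler_wpM2r ?exprn_ge0// sum_inv_sqr.
rewrite big_nat_cond [X in _ <= X]big_nat_cond; apply: ler_sum => s /andP[/andP[s1 _] _].
rewrite sumr_const -[X in X <= _]mulr_natl.
have sp : 0 < s%:R :> R by rewrite ltr0n.
have C : (#|[pred n' | (n' != n) && (rho n' <= s)%N]|)%:R <= (3 * s%:R) ^+ d :> R.
  rewrite -natrM; apply: (@le_trans _ _ (s.*2.+1%:R ^+ d)); last first.
    by rewrite lerXn2r ?nnegrE// ler_nat; lia.
  rewrite -natrX ler_nat.
  apply: leq_trans (card_ffun_close n s); apply: subset_leq_card; apply/fintype.subsetP => n'.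
  by rewrite !inE => /andP[_ h]; apply/forallP => j; exact: leq_trans (rhoj n' j) h.
apply: (@le_trans _ _ ((3 * s%:R) ^+ d * s%:R ^- d.+2)).
  by apply: ler_wpM2r; [rewrite invr_ge0 exprn_ge0|exact: C].
have -> : s%:R ^+ d.+2 = s%:R ^+ d * s%:R ^+ 2 :> R by rewrite -exprD addn2.
rewrite exprMn invfM -mulrA (mulrA (s%:R ^+ d)) divff ?mul1r//.
by rewrite expf_neq0// gt_eqF.
Qed.

End inverse_power_sums.

(** * The Fejer kernel of the dual lattice and its concentration *)

Section fejer_kernel.
Context (R : realType) (d : nat) (a : d.-tuple 'rV[R]_d).
Hypothesis a_basis : basis_of fullv a.
Variable M : nat.
Local Notation N := M.+1.
Local Notation lambda := (@lebesgue_rV R d).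
Local Notation D := (fundamental_domain a).
Local Notation Z := {ffun 'I_d -> int}.
Local Notation I := {ffun 'I_d -> 'I_N}.
Implicit Types (k z : Z) (x y c w : 'rV[R]_d).

Definition freq (n : I) : Z := [ffun j => (n j : nat)%:Z].

Lemma freq_inj : injective freq.
Proof.
move=> n n' /ffunP E; apply/ffunP => j; apply: val_inj.
by have := E j; rewrite !ffunE => -[].
Qed.

Definition freq_diff (p : I * I) : Z := freq p.1 - freq p.2.

(** The product Fejer kernel: [N ^- d] times the squared modulus of the exponential sum over the
    frequencies with coordinates in [0, ..., M]. In this expansion over pairs, the integral over [D]
    counts the diagonal. *)
Definition fejer w : R :=
  (N%:R ^+ d)^-1 * \sum_(p : I * I) cos (dotv (wave a (freq_diff p)) w).

Lemma fejer_ge0 w : 0 <= fejer w.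
Proof.
rewrite mulr_ge0 ?invr_ge0 ?exprn_ge0//.
pose A (n : I) := dotv (wave a (freq n)) w.
have -> : \sum_(p : I * I) cos (dotv (wave a (freq_diff p)) w) =
    (\sum_n cos (A n)) ^+ 2 + (\sum_n sin (A n)) ^+ 2.
  rewrite !expr2 !big_distrlr/= -big_split/=.
  rewrite -(pair_bigA _ (fun n n' => cos (dotv (wave a (freq_diff (n, n'))) w)))/=.
  apply: eq_bigr => n _; rewrite -big_split/=; apply: eq_bigr => n' _.
  by rewrite -cosB /freq_diff waveD waveN dotvDl dotvNl.
by rewrite addr_ge0 ?sqr_ge0.
Qed.

Lemma integral_wave_shift k c :
  \int[lambda]_(u in D) cos (dotv (wave a k) (u - c)) = (k == 0)%:R * volD a.
Proof.
transitivity (\int[lambda]_(u in D) cos (dotv (wave a k) u + dotv (wave a k) (- c))).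
  by apply: eq_Rintegral => u _; rewrite dotvDr.
rewrite integral_wave//; have [->|_] := eqVneq k 0; last by rewrite !mul0r.
rewrite dotv_wave big1 ?mulr0 ?cos0 ?mulr1// => j _; by rewrite ffunE mul0r.
Qed.

Lemma measurable_cos_wave_shift k c :
  measurable_fun setT (fun w => cos (dotv (wave a k) (w + c))).
Proof.
apply: measurable_cosM; apply: (@measurable_dotv _ _ _ _ (cst (wave a k)) (fun w => w + c)) => //.
exact: measurable_addcst.
Qed.

Lemma measurable_fejer c : measurable_fun setT (fun w => fejer (w + c)).
Proof.
by apply: measurable_funM => //; apply: measurable_sum => p; exact: measurable_cos_wave_shift.
Qed.

Lemma integrable_cos_wave_shift k c :
  lambda.-integrable D (EFin \o (fun u => cos (dotv (wave a k) (u - c)))).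
Proof.
apply: (@integrable_boundedD _ _ _ a_basis _ 1); first exact: measurable_cos_wave_shift.
by move=> x; exact: normr_cos_le1.
Qed.

Let NI : (\sum_(n : I) 1) = N%:R ^+ d :> R.
Proof. by rewrite sumr_const card_ffun !card_ord -natrX. Qed.

Let Nd0 : (N%:R ^+ d : R) != 0. Proof. by rewrite expf_neq0// pnatr_eq0. Qed.

Lemma integral_fejer c : \int[lambda]_(u in D) fejer (u - c) = volD a.
Proof.
have mD := measurable_fundamental_domain a_basis.
rewrite RintegralZl//; last by apply: integrable_sumR => // p; exact: integrable_cos_wave_shift.
rewrite Rintegral_sum//; last by move=> p; exact: integrable_cos_wave_shift.
under eq_bigr do rewrite integral_wave_shift.
rewrite -big_distrl/= mulrA -[RHS]mul1r; congr (_ * _).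
rewrite -[RHS](mulVf Nd0); congr (_ * _).
rewrite -NI -(pair_bigA _ (fun n n' => (freq_diff (n, n') == 0)%:R))/=.
apply: eq_bigr => n _; rewrite (bigD1 n)//= big1 ?addr0; first by rewrite /freq_diff subrr eqxx.
by move=> n' /negbTE n'n; rewrite /freq_diff subr_eq0 (inj_eq freq_inj) eq_sym n'n.
Qed.

Definition unitz (j : 'I_d) : Z := [ffun i => (i == j)%:Z].

(** The pairs counted are [(n, n + unitz j)]; an index [n] has such a partner unless [n j] is the
    last value [M], which excludes a fraction [1 / N] of the cube. *)
Let count_shift j : \sum_(p : I * I) (freq_diff p + unitz j == 0)%:R >= N%:R ^+ d * (1 - N%:R^-1) :> R.
Proof.
rewrite -(pair_bigA _ (fun n n' => (freq_diff (n, n') + unitz j == 0)%:R))/=.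
apply: (@le_trans _ _ (\sum_(n : I) (n j != ord_max)%:R)).
  have : \sum_(n : I) (n j != ord_max)%:R + \sum_(n : I) (n j == ord_max)%:R = N%:R ^+ d :> R.
    rewrite -big_split/= -NI; apply: eq_bigr => n _; case: eqP => _ /=; ring.
  have E : (\sum_(n : I) (n j == ord_max)%:R) * N%:R = N%:R ^+ d :> R.
    rewrite -natrX -(card_ffun_coord j (ord_max : 'I_N)) natrM; congr (_ * _).
    by rewrite -sum1_card natr_sum [RHS]big_mkcond/=; apply: eq_bigr => n _; rewrite inE; case: eqP.
  set S := \sum_(n : I) (n j == ord_max)%:R in E *; set S1 := \sum_n _ => E2.
  have -> : S1 = N%:R ^+ d - S by rewrite -E2 addrK.
  have N0 : N%:R != 0 :> R by [].
  by rewrite -E le_eqVlt; apply/orP; left; apply/eqP; field.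
apply: ler_sum => n _; case: eqP => [_|nj] /=; first exact: sumr_ge0.
pose n' : I := [ffun i => if i == j then inord (n j).+1 else n i].
rewrite (bigD1 n')//= (_ : freq_diff (n, n') + unitz j = 0).
  by rewrite eqxx lerDl sumr_ge0.
apply/ffunP => i; rewrite !ffunE/= /n'; case: eqP => [->|_]; last by rewrite subrr addr0.
rewrite inordK ?eqxx; first by move: (n j : nat) => q; lia.
have : (n j : nat) != M by apply/eqP => E; apply: nj; apply: val_inj.
by rewrite ltnS ltn_neqAle => ->; exact: leq_ord.
Qed.

(** The product formula for cosines shifts the frequencies by [unitz j] in both directions, and the
    two counts agree by exchanging the members of each pair. A Fourier coefficient this close to the
    total mass forces the kernel to concentrate where the cosine is near 1. *)
Lemma integral_fejer_cos j c :
  volD a * (1 - N%:R^-1) <=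
  \int[lambda]_(u in D) (fejer (u - c) * cos (dotv (wave a (unitz j)) (u - c))).
Proof.
have mD := measurable_fundamental_domain a_basis.
have v0 := volD_gt0 a_basis.
pose F p u := cos (dotv (wave a (freq_diff p + unitz j)) (u - c)) +
  cos (dotv (wave a (freq_diff p - unitz j)) (u - c)).
have -> : (fun u => fejer (u - c) * cos (dotv (wave a (unitz j)) (u - c))) =
    (fun u => ((N%:R ^+ d)^-1 * 2^-1) * \sum_(p : I * I) F p u).
  apply/funext => u; rewrite /fejer -!mulrA; congr (_ * _).
  rewrite mulr_suml mulr_sumr; apply: eq_bigr => p _.
  rewrite /F (waveD a (freq_diff p) (unitz j)) (waveD a (freq_diff p) (- unitz j)) waveN.
  by rewrite !dotvDl dotvNl cosB cosD; field.
have iF p : lambda.-integrable D (EFin \o F p).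
  exact: (integrableD mD (integrable_cos_wave_shift _ _) (integrable_cos_wave_shift _ _)).
rewrite RintegralZl//; last exact: integrable_sumR.
rewrite Rintegral_sum//.
have -> : \sum_(p : I * I) \int[lambda]_(x in D) F p x =
    (\sum_(p : I * I) (freq_diff p + unitz j == 0)%:R +
     \sum_(p : I * I) (freq_diff p - unitz j == 0)%:R) * volD a.
  rewrite -big_split/= mulr_suml; apply: eq_bigr => p _.
  rewrite RintegralD//; try exact: integrable_cos_wave_shift.
  by rewrite !integral_wave_shift mulrDl.
have -> : \sum_(p : I * I) (freq_diff p - unitz j == 0)%:R =
    \sum_(p : I * I) (freq_diff p + unitz j == 0)%:R :> R.
  rewrite -(pair_bigA _ (fun n n' => (freq_diff (n, n') - unitz j == 0)%:R))/= exchange_big/=.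
  rewrite pair_bigA/=; apply: eq_bigr => -[n n'] _ /=.
  by rewrite /freq_diff/= -oppr_eq0 opprD opprB opprK.
have := count_shift j; set S := \sum_p _ => cS.
have -> : (N%:R ^+ d)^-1 / 2 * ((S + S) * volD a) = volD a * (S / N%:R ^+ d) by field.
apply: ler_wpM2l; first exact: ltW.
by rewrite ler_pdivlMr ?exprn_gt0// mulrC.
Qed.

End fejer_kernel.

Section fejer_concentration.
Context (R : realType) (d : nat) (a : d.-tuple 'rV[R]_d).
Hypothesis a_basis : basis_of fullv a.
Local Notation lambda := (@lebesgue_rV R d).
Local Notation D := (fundamental_domain a).

Definition asum : R := \sum_(j < d) enorm (tnth a j).

Lemma asum_ge0 : 0 <= asum.
Proof. by apply: sumr_ge0 => j _; exact: enorm_ge0. Qed.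

(** The kernel is recentred at the middle of [D]: the coordinates of [u - centerD] then lie in
    [[-1/2, 1/2[], where [cos (2 pi t)] equals 1 only at 0. *)
Definition centerD : 'rV[R]_d := \sum_(j < d) 2^-1 *: tnth a j.

Lemma measurable_fejer_cos M j :
  measurable_fun [set: 'rV[R]_d]
    (fun u => fejer a M (u - centerD) * cos (dotv (wave a (unitz j)) (u - centerD))).
Proof.
by apply: measurable_funM; [exact: measurable_fejer|exact: measurable_cos_wave_shift].
Qed.

Lemma fejer_le M w : fejer a M w <= M.+1%:R ^+ d.
Proof.
rewrite /fejer ler_pdivrMl ?exprn_gt0// (le_trans (ler_norm _))//.
rewrite (le_trans (ler_norm_sum _ _ _))//.
apply: (@le_trans _ _ (\sum_(p : {ffun 'I_d -> 'I_M.+1} * {ffun 'I_d -> 'I_M.+1}) 1)).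
  by apply: ler_sum => p _; exact: normr_cos_le1.
by rewrite sumr_const card_prod card_ffun !card_ord natrM natrX.
Qed.

Lemma normr_fejer_le M w : `|fejer a M w| <= M.+1%:R ^+ d.
Proof. by rewrite ger0_norm ?fejer_le// fejer_ge0. Qed.

Let indicE_ball (eps : R) (w : 'rV[R]_d) : \1_(eball eps) w = (enorm w <= eps)%R%:R :> R.
Proof. by rewrite indicE; congr (nat_of_bool _)%:R; apply/idP/idP; rewrite inE. Qed.

(** Outside the [eps]-ball some basis coordinate exceeds [dl] in absolute value, so one of the terms
    [1 - cos] is at least [q]; the witness for [ce] is [1 / q]. *)
Let far_coord (eps : R) : 0 < eps -> exists2 ce : R, 0 < ce &
  forall u, D u -> 1 - \1_(eball eps) (u - centerD) <=
    ce * \sum_j (1 - cos (dotv (wave a (unitz j)) (u - centerD))) :> R.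
Proof.
move=> e0; have s0 := asum_ge0.
(* The second entry gives [dl * asum <= eps], so that a point with all coordinates at most [dl] is
   in the ball; the first keeps [2 pi dl] where the cosine decreases. *)
pose dl : R := Num.min (1/4) (eps / (asum + 1)).
have dl0 : 0 < dl by rewrite lt_min divr_gt0//= divr_gt0// ltr_wpDl.
have dl4 : dl <= 1/4 by rewrite ge_min lexx.
have dle : dl * asum <= eps.
  apply: (@le_trans _ _ (eps / (asum + 1) * asum)).
    by rewrite ler_wpM2r// ge_min lexx orbT.
  rewrite -mulrA ler_piMr//; first exact: ltW.
  by rewrite mulrC ler_pdivrMr ?ltr_wpDl// mul1r lerDl.
have p0 := pi_gt0 R; have p2 : 0 < pi *+ 2 :> R by rewrite mulrn_wgt0.
have p2' : 0 <= pi *+ 2 :> R by exact: ltW.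
pose q : R := 1 - cos ((pi *+ 2) * dl).
have q0 : 0 < q.
  rewrite subr_gt0 -[X in _ < X]cos0 ltr_cos ?in_itv/=.
  - by rewrite mulr_gt0.
  - by rewrite lexx ltW.
  - by apply/andP; split; [rewrite mulr_ge0// ltW|rewrite mulr2n; nra].
exists q^-1; first by rewrite invr_gt0.
move=> u /(fundamental_domainP a_basis) Du.
pose t j : R := dotv (dual_vec a j) (u - centerD).
have tE j : t j = dotv (dual_vec a j) u - 2^-1.
  by rewrite /t dotvDr -scaleN1r dotvZr mulN1r dual_vec_sum.
have wt j : dotv (wave a (unitz j)) (u - centerD) = (pi *+ 2) * t j.
  rewrite dotv_wave; congr (_ * _); rewrite (bigD1 j)//= big1 ?addr0; last first.
    by move=> i /negbTE ij; rewrite ffunE ij mul0r.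
  by rewrite ffunE eqxx mul1r.
have sum0 : 0 <= \sum_j (1 - cos (dotv (wave a (unitz j)) (u - centerD))) :> R.
  by apply: sumr_ge0 => j _; rewrite subr_ge0 cos_le1.
rewrite indicE_ball; case: (boolP (enorm (u - centerD) <= eps)) => ue.
  by rewrite subrr mulr_ge0// invr_ge0 ltW.
rewrite subr0 mulrC ler_pdivlMr// mul1r.
have [j tj] : exists j, dl < `|t j|.
  apply/existsP; apply: contraNT ue; rewrite negb_exists => /forallP tdl.
  rewrite (dual_vec_expansion a_basis (u - centerD)) (le_trans (ler_enorm_sum _ _))//.
  rewrite (le_trans _ dle)// mulr_sumr ler_sum// => j _.
  by rewrite enormZ ler_wpM2r ?enorm_ge0// leNgt; exact: tdl.
rewrite (bigD1 j)//=.
have : q <= 1 - cos (dotv (wave a (unitz j)) (u - centerD)).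
  have -> : cos (dotv (wave a (unitz j)) (u - centerD)) = cos ((pi *+ 2) * `|t j|).
    by rewrite wt; have [h|h] := ger0P (t j); rewrite ?mulrN ?cosN.
  have th : `|t j| <= 1/2.
    by have /andP[t1 t2] := Du j; rewrite tE ler_norml; apply/andP; split; lra.
  rewrite lerD2l lerN2 leNgt ltr_cos ?in_itv/= -?leNgt.
  - by rewrite ler_pM2l// ltW.
  - by apply/andP; split; [rewrite mulr_ge0// ltW|rewrite mulr2n; nra].
  - by apply/andP; split; [rewrite mulr_ge0// ltW|rewrite mulr2n; nra].
move=> /le_trans; apply; rewrite lerDl; apply: sumr_ge0 => i _.
by rewrite subr_ge0 cos_le1.
Qed.

(** Markov's inequality: in each direction the kernel integrates [1 - cos] to at most [volD a / N],
    and by [far_coord] these functions dominate the indicator of the complement of the ball. [C]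
    depends on [eps] but not on the cutoff. *)
Lemma fejer_concentration (eps : R) : 0 < eps -> exists2 C : R, 0 <= C & forall M,
  volD a * (1 - C / M.+1%:R) <=
  \int[lambda]_(u in D) (fejer a M (u - centerD) * \1_(eball eps) (u - centerD)).
Proof.
move=> e0; have [ce ce0 Hce] := far_coord e0.
exists (ce * d%:R); first by rewrite mulr_ge0// ltW.
move=> M; have mD := measurable_fundamental_domain a_basis.
have v0 := volD_gt0 a_basis.
pose K u := fejer a M (u - centerD).
have mK : measurable_fun setT K by exact: measurable_fejer.
have iK : lambda.-integrable D (EFin \o K).
  by apply: (@integrable_boundedD _ _ _ a_basis _ (M.+1%:R ^+ d)) => // x; exact: normr_fejer_le.
pose C j u := K u * cos (dotv (wave a (unitz j)) (u - centerD)).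
have iC j : lambda.-integrable D (EFin \o C j).
  apply: (@integrable_boundedD _ _ _ a_basis _ (M.+1%:R ^+ d)).
    exact: measurable_fejer_cos.
  move=> x; rewrite normrM -[leRHS]mulr1 ler_pM//; first exact: normr_fejer_le.
  exact: normr_cos_le1.
have iKC j : lambda.-integrable D (EFin \o (fun u => K u - C j u)).
  exact: (integrableB mD iK (iC j)).
have iS := @integrable_sumR _ _ _ lambda D _ (index_enum 'I_d) (fun j u => K u - C j u) mD iKC.
have iI : lambda.-integrable D (EFin \o (fun u => K u * \1_(eball eps) (u - centerD))).
  apply: (@integrable_boundedD _ _ _ a_basis _ (M.+1%:R ^+ d)).
    apply: measurable_funM => //.
    apply: (@measurable_comp_rV _ _ _ _ _ _ (\1_(eball eps) : 'rV[R]_d -> R)).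
      exact: measurable_ball_indic.
    exact: measurable_addcst.
  move=> x; rewrite normrM -[leRHS]mulr1 ler_pM//; first exact: normr_fejer_le.
  by rewrite indicE; case: (_ \in _); rewrite /= ?normr1 ?normr0.
have iZ : lambda.-integrable D (EFin \o (fun u => ce * \sum_j (K u - C j u))).
  exact: (integrableZl mD ce iS).
apply: (@le_trans _ _ (\int[lambda]_(u in D) (K u - ce * \sum_j (K u - C j u)))).
  rewrite RintegralB// RintegralZl// Rintegral_sum// integral_fejer//.
  have Bj j : \int[lambda]_(u in D) (K u - C j u) <= volD a / M.+1%:R.
    rewrite RintegralB// integral_fejer// lerBlDr.
    by have := integral_fejer_cos a_basis M j centerD; rewrite mulrBr mulr1 lerBlDl.
  have := ler_sum (index_enum 'I_d) (fun j (_ : true) => Bj j).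
  rewrite sumr_const card_ord -[X in _ <= X]mulr_natl => B.
  have -> : volD a * (1 - ce * d%:R / M.+1%:R) = volD a - ce * (d%:R * (volD a / M.+1%:R)) by ring.
  by rewrite lerD2l lerN2; apply: ler_wpM2l B; exact: ltW.
apply: le_Rintegral => //.
  exact: (integrableB mD iK iZ).
move=> u Du; have := Hce u Du.
have K0 : 0 <= K u by exact: fejer_ge0.
have -> : \sum_j (K u - C j u) = K u * \sum_j (1 - cos (dotv (wave a (unitz j)) (u - centerD))).
  by rewrite mulr_sumr; apply: eq_bigr => j _; rewrite /C mulrBr mulr1.
rewrite -[fejer a M (u - centerD)]/(K u) => h.
have := ler_wpM2l K0 h; rewrite mulrBr mulr1; lra.
Qed.

End fejer_concentration.

(** * Poisson summation bound *)

Lemma EFin_Rintegral (R : realType) dT (T : measurableType dT)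
    (mu : {measure set T -> \bar R}) (D : set T) (f : T -> R) : measurable D ->
  mu.-integrable D (EFin \o f) ->
  (\int[mu]_(x in D) (f x)%:E = (\int[mu]_(x in D) f x)%R%:E)%E.
Proof. by move=> mD fi; rewrite /Rintegral fineK//; exact: integrable_fin_num. Qed.

Section ball_overlap.
Context (R : realType) (d : nat).
Local Notation lambda := (@lebesgue_rV R d).
Implicit Types (x y v w : 'rV[R]_d) (r : R).

Definition ball_overlap r y : \bar R :=
  (\int[lambda]_x (\1_(eball r) x * \1_(eball r) (x + y))%:E)%E.

Lemma measurable_indic_eball_comp dT (T : measurableType dT) (f : T -> 'rV[R]_d) r :
  measurable_fun setT f -> measurable_fun setT (fun t => \1_(eball r) (f t) : R).
Proof.
move=> mf; apply: (@measurable_comp_rV _ _ _ _ _ _ (\1_(eball r) : 'rV[R]_d -> R)) => //.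
exact: measurable_ball_indic.
Qed.

Lemma ball_overlap_ge0 r y : (0 <= ball_overlap r y)%E.
Proof. by apply: integral_ge0 => x _; rewrite lee_fin mulr_ge0. Qed.

Lemma measurable_overlap_integrand r : measurable_fun setT
  (fun p : 'rV[R]_d * 'rV[R]_d => (\1_(eball r) p.1 * \1_(eball r) (p.1 + p.2))%:E : \bar R).
Proof.
apply/measurable_EFinP; apply: measurable_funM; apply: measurable_indic_eball_comp => //.
by apply: measurable_funD_rV.
Qed.

Lemma measurable_ball_overlap r : measurable_fun setT (ball_overlap r).
Proof.
apply: (@measurable_fun_fubini_tonelli_G _ _ _ _ R lambda
  (fun p => (\1_(eball r) p.1 * \1_(eball r) (p.1 + p.2))%:E)).
  exact: measurable_overlap_integrand.
by move=> p; rewrite lee_fin mulr_ge0.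
Qed.

Lemma indic_eball_ler r s x y : enorm y + s <= r -> \1_(eball s) x <= \1_(eball r) (x + y) :> R.
Proof.
move=> ys; rewrite !indicE; case: (boolP (x \in _)) => [|_]; last by case: (_ \in _).
rewrite inE /eball/= => xs; rewrite mem_set// /eball/=.
by rewrite (le_trans (ler_enormD _ _))//; lra.
Qed.

(** The larger radius absorbs the displacement [w]; this lets an average of overlaps over small [w]
    dominate the value at a point. *)
Lemma ball_overlap_mono r (eps : R) y w : enorm w <= eps ->
  (ball_overlap r y <= ball_overlap (r + eps) (y + w))%E.
Proof.
move=> we; have e0 : 0 <= eps by apply: le_trans we; exact: enorm_ge0.
have m1 z s : measurable_fun setT (fun x => (\1_(eball s) x * \1_(eball s) (x + z))%:E : \bar R).
  apply/measurable_EFinP; apply: measurable_funM; apply: measurable_indic_eball_comp => //.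
  exact: measurable_addcst.
apply: ge0_le_integral => //.
- move=> x _; rewrite lee_fin ler_pM//.
    by rewrite -[x in leRHS]addr0; apply: indic_eball_ler; rewrite enorm0; lra.
  by rewrite addrA; apply: indic_eball_ler; lra.
Qed.

Lemma integral_indic_eball r : (\int[lambda]_x (\1_(eball r) x)%:E = lambda (eball r))%E.
Proof. by rewrite integral_indic ?setIT//; exact: measurable_eball. Qed.

Lemma ball_overlap_le r y : (ball_overlap r y <= lambda (eball r))%E.
Proof.
have mB := @measurable_eball R d r.
rewrite -integral_indic_eball.
apply: ge0_le_integral => //.
- apply/measurable_EFinP; apply: measurable_funM; apply: measurable_indic_eball_comp => //.
  exact: measurable_addcst.
- by apply/measurable_EFinP; exact: measurable_ball_indic.
- by move=> x _; rewrite lee_fin ler_piMr// indicE; case: (_ \in _).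
Qed.

(** By the triangle inequality, moving a point of the smaller ball by [y] keeps it in the ball of
    radius [r]. *)
Lemma ball_overlap_ge r y : enorm y < r ->
  (lambda (eball (r - enorm y)) <= ball_overlap r y)%E.
Proof.
move=> yr; have mB := @measurable_eball R d (r - enorm y).
have y0 := enorm_ge0 y.
rewrite -integral_indic_eball.
apply: ge0_le_integral => //.
- by apply/measurable_EFinP; exact: measurable_ball_indic.
- apply/measurable_EFinP; apply: measurable_funM; apply: measurable_indic_eball_comp => //.
  exact: measurable_addcst.
move=> x _; rewrite lee_fin.
apply: (@le_trans _ _ (\1_(eball (r - enorm y)) x * \1_(eball (r - enorm y)) x)).
  by rewrite !indicE; case: (x \in _); rewrite ?mulr1 ?mulr0.
rewrite ler_pM//; last by apply: indic_eball_ler; lra.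
by rewrite -[x in leRHS]addr0; apply: indic_eball_ler; rewrite enorm0; lra.
Qed.

(* The odd part of the integrand contributes nothing since the ball is symmetric. *)
Lemma ball_transform_shift r kappa w :
  \int[lambda]_y (\1_(eball r) y * cos (dotv kappa (y - w))) =
  cos (dotv kappa w) * ball_transform r kappa.
Proof.
have ic : lambda.-integrable setT (EFin \o (fun y => \1_(eball r) y * cos (dotv kappa y))).
  apply: (@integrable_indicM _ _ r 1) => [|x _]; last exact: normr_cos_le1.
  by apply: measurable_cosM; exact: measurable_dotvr.
have is_ : lambda.-integrable setT (EFin \o (fun y => \1_(eball r) y * sin (dotv kappa y))).
  apply: (@integrable_indicM _ _ r 1) => [|x _]; last exact: normr_sin_le1.
  by apply: measurable_sinM; exact: measurable_dotvr.
have s0 : \int[lambda]_y (\1_(eball r) y * sin (dotv kappa y)) = 0.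
  have N1 : -1 != 0 :> R by rewrite oppr_eq0 oner_eq0.
  have := Rintegral_affine 0 N1 is_; rewrite normrN1 expr1n mul1r.
  rewrite (@eq_Rintegral _ _ _ _ _ (fun x => -1 * (\1_(eball r) x * sin (dotv kappa x)))).
    by rewrite RintegralZl// mulN1r; lra.
  move=> x _; rewrite addr0 dotvZr !mulN1r sinN scaleN1r mulrN; congr (- (_ * _)).
  by rewrite !indicE; congr (nat_of_bool _)%:R; apply/idP/idP; rewrite !inE eballN.
transitivity (\int[lambda]_y (cos (dotv kappa w) * (\1_(eball r) y * cos (dotv kappa y)) +
   sin (dotv kappa w) * (\1_(eball r) y * sin (dotv kappa y)))).
  apply: eq_Rintegral => y _; rewrite dotvDr -[X in dotv _ y + dotv _ X]scaleN1r dotvZr mulN1r cosB; ring.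
rewrite RintegralD//; [|exact: (integrableZl measurableT _ ic)|exact: (integrableZl measurableT _ is_)].
by rewrite RintegralZl// RintegralZl// s0 mulr0 addr0.
Qed.

End ball_overlap.

Section poisson_upper.
Context (R : realType) (d : nat) (a : d.-tuple 'rV[R]_d).
Local Notation lambda := (@lebesgue_rV R d).
Variable M : nat.
Local Notation I := {ffun 'I_d -> 'I_M.+1}.

Definition fejer_overlap (r : R) (v : 'rV[R]_d) : R :=
  (M.+1%:R ^+ d)^-1 * \sum_(p : I * I)
    cos (dotv (wave a (freq_diff p)) v) * ball_transform r (wave a (freq_diff p)) ^+ 2.

Let integrable_wave_sum r (w : 'rV[R]_d) (c : I * I -> R) :
  lambda.-integrable setT (EFin \o (fun y => \1_(eball r) y *
     \sum_(p : I * I) c p * cos (dotv (wave a (freq_diff p)) (y - w)))).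
Proof.
apply: (@integrable_indicM _ _ r (\sum_p `|c p|)) => [|x _].
  by apply: measurable_sum => p; apply: measurable_funM => //; exact: measurable_cos_wave_shift.
rewrite (le_trans (ler_norm_sum _ _ _))// ler_sum// => p _.
by rewrite normrM ler_piMr// normr_cos_le1.
Qed.

Let wave_int r (w : 'rV[R]_d) (c : I * I -> R) :
  (\int[lambda]_y (\1_(eball r) y *
     \sum_(p : I * I) c p * cos (dotv (wave a (freq_diff p)) (y - w)))%:E)%E =
  (\sum_(p : I * I) c p * (cos (dotv (wave a (freq_diff p)) w) * ball_transform r (wave a (freq_diff p))))%:E.
Proof.
pose F (p : I * I) y := c p * (\1_(eball r) y * cos (dotv (wave a (freq_diff p)) (y - w))).
have i1 (p : I * I) : lambda.-integrable setT
    (EFin \o (fun y => \1_(eball r) y * cos (dotv (wave a (freq_diff p)) (y - w)))).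
  apply: (@integrable_indicM _ _ r 1) => [|x _]; last exact: normr_cos_le1.
  exact: measurable_cos_wave_shift.
have iF p : lambda.-integrable setT (EFin \o F p).
  exact: (integrableZl measurableT (c p) (i1 p)).
have E y : \1_(eball r) y * (\sum_(p : I * I) c p * cos (dotv (wave a (freq_diff p)) (y - w))) = \sum_p F p y.
  by rewrite mulr_sumr; apply: eq_bigr => p _; rewrite /F mulrCA.
transitivity (\int[lambda]_y (\sum_(p : I * I) F p y)%:E)%E.
  by apply: eq_integral => y _; rewrite E.
rewrite EFin_Rintegral//; last exact: integrable_sumR.
rewrite Rintegral_sum//; congr (_%:E); apply: eq_bigr => p _.
by rewrite RintegralZl// ball_transform_shift.
Qed.

(** In the variables [x] and [y = x + v + w] the kernel depends on [y - (x + v)], and each of its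
    cosines yields two ball transforms, one from the integral in [y] and one from that in [x]. The
    exchange of integrals is done on the whole kernel, which is nonnegative, and not on single
    cosines. *)
Lemma integral_fejer_overlap r v :
  (\int[lambda]_w ((fejer a M w)%:E * ball_overlap r (v + w)) = (fejer_overlap r v)%:E)%E.
Proof.
have mK : measurable_fun setT (fun w => (fejer a M w)%:E).
  apply/measurable_EFinP; have := measurable_fejer a M (0 : 'rV[R]_d).
  by under eq_fun do rewrite addr0.
have K0 w : 0 <= fejer a M w by exact: fejer_ge0.
pose f (p : 'rV[R]_d * 'rV[R]_d) : \bar R :=
  (fejer a M p.2 * (\1_(eball r) p.1 * \1_(eball r) (p.1 + (v + p.2))))%:E.
have mf : measurable_fun setT f.
  apply/measurable_EFinP; apply: measurable_funM.
    apply: (@measurable_comp_rV _ _ _ _ _ _ (fejer a M)) => //.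
    exact/measurable_EFinP.
  apply: measurable_funM; apply: measurable_indic_eball_comp => //.
  apply: measurable_funD_rV => //.
  exact: (@measurable_funD_rV _ _ _ _ (cst v) snd).
have f0 p : (0 <= f p)%E.
  by rewrite lee_fin; apply: mulr_ge0; [exact: K0|exact: mulr_ge0].
transitivity (\int[lambda]_w \int[lambda]_x f (x, w))%E.
  apply: eq_integral => w _; rewrite /ball_overlap -ge0_integralZl//=.
  - apply/measurable_EFinP; apply: measurable_funM; apply: measurable_indic_eball_comp => //.
    exact: measurable_addcst.
  - by rewrite lee_fin K0.
rewrite -(fubini_tonelli f mf f0).
pose J (x : 'rV[R]_d) : R := (M.+1%:R ^+ d)^-1 * \sum_(p : I * I)
  ball_transform r (wave a (freq_diff p)) * cos (dotv (wave a (freq_diff p)) (x - (- v))).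
transitivity (\int[lambda]_x (\1_(eball r) x * J x)%:E)%E.
  apply: eq_integral => x _.
  pose h (y : 'rV[R]_d) : \bar R :=
    (fejer a M (y + (- (x + v))) * (\1_(eball r) x * \1_(eball r) y))%:E.
  have mh : measurable_fun setT h.
    apply/measurable_EFinP; apply: measurable_funM; first exact: measurable_fejer.
    by apply: measurable_funM => //; apply: measurable_ball_indic.
  have h0 y : (0 <= h y)%E.
    by rewrite lee_fin; apply: mulr_ge0; [exact: K0|exact: mulr_ge0].
  transitivity (\int[lambda]_y h y)%E.
    rewrite -(ge0_integral_translation (x + v) mh h0); apply: eq_integral => w _.
    rewrite /f /h/= addrK; congr (_ * (_ * \1_(eball r) _))%:E.
    by rewrite [RHS]addrC addrA.
  transitivity (\int[lambda]_y (((\1_(eball r) x * (M.+1%:R ^+ d)^-1)%:E *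
      (\1_(eball r) y * \sum_(p : I * I) 1 * cos (dotv (wave a (freq_diff p)) (y - (x + v))))%:E))%E)%E.
    apply: eq_integral => y _; rewrite -EFinM; congr (_%:E); rewrite /fejer.
    under [in RHS]eq_bigr do rewrite mul1r; ring.
  rewrite integralZl//; last exact: integrable_wave_sum.
  rewrite wave_int -EFinM; congr (_%:E); rewrite /J -mulrA; congr (_ * (_ * _)).
  by apply: eq_bigr => p _; rewrite mul1r mulrC opprK.
transitivity (\int[lambda]_x ((M.+1%:R ^+ d)^-1%:E * (\1_(eball r) x * \sum_(p : I * I)
  ball_transform r (wave a (freq_diff p)) * cos (dotv (wave a (freq_diff p)) (x - (- v))))%:E))%E.
  by apply: eq_integral => x _; rewrite -EFinM /J; congr (_%:E); ring.
rewrite integralZl//; last exact: integrable_wave_sum.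
rewrite wave_int -EFinM /fejer_overlap; congr (_ * _)%:E; apply: eq_bigr => p _.
by rewrite -scaleN1r dotvZr mulN1r cosN; ring.
Qed.

End poisson_upper.

Section poisson_bound.
Context (R : realType) (d : nat) (a : d.-tuple 'rV[R]_d).
Hypothesis a_basis : basis_of fullv a.
Hypothesis d0 : (0 < d)%N.
Local Notation lambda := (@lebesgue_rV R d).
Local Notation D := (fundamental_domain a).
Local Notation Z := {ffun 'I_d -> int}.
Local Notation v1 := (vol1 R d).

Definition spectral_const : R :=
  decay_const R d * asum a ^+ d.+1 * (2 ^+ d.+3 * 3 ^+ d).

Section fixed_cutoff.
Variable M : nat.
Local Notation I := {ffun 'I_d -> 'I_M.+1}.

Let rho (n n' : I) : nat := \max_(j < d) `|((n j : nat)%:Z - (n' j : nat)%:Z)%R|%N.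

Let transform_le (r : R) (n n' : I) : 0 < r -> n' != n ->
  ball_transform r (wave a (freq_diff (n, n'))) ^+ 2 <=
  decay_const R d * asum a ^+ d.+1 * r ^+ d.-1 * (rho n n')%:R ^- d.+1.
Proof.
move=> r0 nn'.
have rj j : (`|((n j : nat)%:Z - (n' j : nat)%:Z)%R| <= rho n n')%N.
  exact: (@leq_bigmax _ (fun j => `|((n j : nat)%:Z - (n' j : nat)%:Z)%R|%N)).
have rho0 : (0 < rho n n')%N.
  have [j nj] : exists j, n' j != n j.
    apply/existsP; apply: contraNT nn'; rewrite negb_exists => /forallP h.
    by apply/eqP/ffunP => j; apply/eqP; have := h j; rewrite negbK.
  apply: leq_trans (rj j); rewrite absz_gt0 subr_eq0.
  by apply: contra nj => /eqP[] h; apply/eqP/val_inj.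
set kappa := wave a _.
have kr : (rho n n')%:R <= enorm kappa * asum a :> R.
  rewrite /rho; have [|j ->] := @bigop.eq_bigmax _ (fun j => `|((n j : nat)%:Z - (n' j : nat)%:Z)%R|%N).
    by rewrite card_ord.
  have := wave_coord_le a_basis (freq_diff (n, n')) j.
  rewrite /freq_diff !ffunE => /(le_trans _); apply.
  by rewrite -intr_norm natr_absz.
rewrite ler_pdivlMr ?exprn_gt0 ?ltr0n//.
apply: (@le_trans _ _ (ball_transform r kappa ^+ 2 * (enorm kappa * asum a) ^+ d.+1)).
  apply: ler_wpM2l; first exact: sqr_ge0.
  by rewrite lerXn2r ?nnegrE// mulr_ge0 ?enorm_ge0 ?asum_ge0.
have := ball_transform_decay kappa d0 r0; rewrite exprMn mulrA => h.
rewrite [leRHS]mulrAC; apply: ler_wpM2r h.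
by rewrite exprn_ge0// asum_ge0.
Qed.

(** Bounding the cosine by 1 makes the estimate uniform in [v]. For each [n] the diagonal term is
    the squared volume, and the other terms sum to at most [spectral_const * r ^+ d.-1]; the
    normalisation cancels the number of indices [n]. *)
Lemma fejer_overlap_le (r : R) v : 0 < r ->
  fejer_overlap a M r v <= (r ^+ d * v1) ^+ 2 + spectral_const * r ^+ d.-1.
Proof.
move=> r0.
have Nd : 0 < M.+1%:R ^+ d :> R by rewrite exprn_gt0.
rewrite /fejer_overlap ler_pdivrMl//.
apply: (@le_trans _ _ (\sum_(p : I * I) ball_transform r (wave a (freq_diff p)) ^+ 2)).
  by apply: ler_sum => p _; rewrite ler_piMl ?sqr_ge0// cos_le1.
rewrite -(pair_bigA _ (fun n n' => ball_transform r (wave a (freq_diff (n, n'))) ^+ 2))/=.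
have -> : M.+1%:R ^+ d * ((r ^+ d * v1) ^+ 2 + spectral_const * r ^+ d.-1) =
    \sum_(n : I) ((r ^+ d * v1) ^+ 2 + spectral_const * r ^+ d.-1).
  by rewrite sumr_const card_ffun !card_ord -[RHS]mulr_natl natrX.
apply: ler_sum => n _; rewrite (bigD1 n)//=; apply: lerD.
  rewrite /freq_diff/= subrr.
  have -> : ball_transform r (wave a 0) = r ^+ d * v1.
    rewrite /ball_transform (@eq_Rintegral _ _ _ _ _ (\1_(eball r))).
      by rewrite Rintegral_indic_eball lebesgue_eballE.
    move=> x _; rewrite dotv_wave big1 ?mulr0 ?cos0 ?mulr1// => j _.
    by rewrite ffunE mul0r.
  exact: lexx.
apply: (@le_trans _ _ (\sum_(n' | n' != n)
   decay_const R d * asum a ^+ d.+1 * r ^+ d.-1 * (rho n n')%:R ^- d.+1)).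
  by apply: ler_sum => n' n'n; exact: transform_le.
rewrite -mulr_sumr /spectral_const [leRHS]mulrAC; apply: ler_wpM2l.
  rewrite mulr_ge0 ?exprn_ge0 ?(ltW r0)//.
  by rewrite mulr_ge0 ?decay_const_ge0// exprn_ge0// asum_ge0.
have rj (n' : I) j : (`|((n j : nat)%:Z - (n' j : nat)%:Z)%R| <= rho n n')%N.
  exact: (@leq_bigmax _ (fun j => `|((n j : nat)%:Z - (n' j : nat)%:Z)%R|%N)).
apply: (@lattice_sum_bound R d M.+1 n (rho n)) => //.
- move=> n' nn'.
  have [j nj] : exists j, n' j != n j.
    apply/existsP; apply: contraNT nn'; rewrite negb_exists => /forallP h.
    by apply/eqP/ffunP => j; apply/eqP; have := h j; rewrite negbK.
  apply: leq_trans (rj n' j); rewrite absz_gt0 subr_eq0.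
  by apply: contra nj => /eqP[] h; apply/eqP/val_inj.
- move=> n'; apply/bigmax_leqP => j _.
  have := ltn_ord (n j); have := ltn_ord (n' j).
  by move: (n j : nat) (n' j : nat) => x y; lia.
Qed.

End fixed_cutoff.

Local Open Scope ereal_scope.

Definition lattice_overlap (r : R) v : \bar R := \esum_(z in [set: Z]) ball_overlap r (v + lat a z)%R.

Lemma lattice_overlap_ge0 r v : 0 <= lattice_overlap r v.
Proof. by apply: esum_ge0 => z _; exact: ball_overlap_ge0. Qed.

(** The integral over the space is tiled by translates of [D]. The kernel takes the same values in
    each by periodicity, and within [eps] of the centre the overlap at radius [r + eps] dominates
    the overlap of radius [r] at [v + lat a z]. *)
Lemma lattice_overlap_fejer M (r eps : R) v : (0 < eps)%R ->
  lattice_overlap r v *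
    (\int[lambda]_(u in D) (fejer a M (u - centerD a) * \1_(eball eps) (u - centerD a)))%R%:E <=
  (fejer_overlap a M (r + eps) v)%:E.
Proof.
move=> e0; have mD := measurable_fundamental_domain a_basis.
pose c := centerD a.
have K0 w : (0 <= fejer a M w)%R by exact: fejer_ge0.
have mK : measurable_fun setT (fun w => (fejer a M w)%:E).
  apply/measurable_EFinP; have := measurable_fejer a M (0 : 'rV[R]_d).
  by under eq_fun do rewrite addr0.
have mO s y : measurable_fun [set: 'rV[R]_d] (fun w => ball_overlap s (y + w)%R).
  apply: (@measurable_comp_rV _ _ _ _ _ _ (ball_overlap s)).
    exact: measurable_ball_overlap.
  exact: measurable_cstadd.
pose h (w : 'rV[R]_d) := (fejer a M w)%:E * ball_overlap (r + eps) (v + w)%R.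
have mh : measurable_fun setT h by exact: emeasurable_funM.
have h0 w : 0 <= h w by rewrite mule_ge0 ?lee_fin ?ball_overlap_ge0.
rewrite -integral_fejer_overlap// -[leRHS](ge0_integral_translation (- c)%R mh h0).
have mh' : measurable_fun [set: 'rV[R]_d] (fun w => h (w - c)%R).
  by apply: (@measurable_comp_rV _ _ _ _ _ _ h) => //; exact: measurable_addcst.
rewrite (ge0_integral_tile a_basis mh')//.
have iI : lambda.-integrable D (EFin \o (fun u => fejer a M (u - c) * \1_(eball eps) (u - c)))%R.
  apply: (@integrable_boundedD _ _ _ a_basis _ (M.+1%:R ^+ d)).
    apply: measurable_funM => //; first exact: measurable_fejer.
    by apply: measurable_indic_eball_comp; exact: measurable_addcst.
  move=> x; rewrite normrM -[leRHS]mulr1 ler_pM//; first exact: normr_fejer_le.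
  by rewrite indicE; case: (_ \in _); rewrite /= ?normr1 ?normr0.
rewrite -EFin_Rintegral// muleC /lattice_overlap -esumZl; last 2 first.
- by apply: integral_ge0 => x _; rewrite lee_fin mulr_ge0.
- by move=> z; exact: ball_overlap_ge0.
apply: le_esum => z _.
have g0 := ball_overlap_ge0 r (v + lat a z).
have mKI : measurable_fun [set: 'rV[R]_d] (fun u => (fejer a M (u - c) * \1_(eball eps) (u - c))%:E : \bar R).
  apply/measurable_EFinP; apply: measurable_funM => //; first exact: measurable_fejer.
  by apply: measurable_indic_eball_comp; exact: measurable_addcst.
have KI0 u : D u -> 0 <= (fejer a M (u - c) * \1_(eball eps) (u - c))%:E.
  by move=> _; rewrite lee_fin mulr_ge0.
rewrite -(ge0_integralZr lambda mD (measurable_funTS mKI) KI0 g0).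
apply: ge0_le_integral; first exact: mD.
- by move=> u Du; rewrite mule_ge0 ?KI0.
- by apply: emeasurable_funM; [exact: measurable_funTS|exact: measurable_cst].
- apply: measurable_funTS; apply: (@measurable_comp_rV _ _ _ _ _ _ (fun w => h (w - c)%R)) => //.
  exact: measurable_cstadd.
move=> u _; rewrite /h.
have -> : fejer a M (lat a z + u - c) = fejer a M (u - c).
  rewrite -addrA addrC /fejer; congr (_ * _)%R; apply: eq_bigr => p _.
  by rewrite -[X in cos X]addr0 cos_wave_lat// addr0.
rewrite EFinM -muleA; apply: lee_wpmul2l; first by rewrite lee_fin.
rewrite indicE; case: (boolP (_ \in _)) => [|_]; last by rewrite mul0e ball_overlap_ge0.
rewrite inE /eball/= mul1e => ue.
have -> : (v + (lat a z + u - c) = v + lat a z + (u - c))%R by rewrite !addrA.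
exact: ball_overlap_mono.
Qed.

Let bound (s : R) : R := (s ^+ d * v1) ^+ 2 + spectral_const * s ^+ d.-1.

Let continuous_bound (r : R) : {for r, continuous bound}.
Proof.
have -> : bound = (((@GRing.exp R)^~ d * cst v1) ^+ 2 + cst spectral_const * (@GRing.exp R)^~ d.-1)%R.
  by apply/funext => s; rewrite /bound !fctE.
apply: differentiable_continuous; apply/derivable1_diffP.
apply: derivableD.
  apply: derivableX; apply: derivableM; [exact: exprn_derivable|exact: derivable_cst].
by apply: derivableM; [exact: derivable_cst|exact: exprn_derivable].
Qed.

(** The cutoff goes to infinity at fixed [eps], which recovers the full mass of the kernel; then
    [eps] goes to 0, by continuity of [bound]. *)
Theorem lattice_overlap_bound (r : R) v : (0 < r)%R ->
  lattice_overlap r v * (volD a)%:E <= (bound r)%:E.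
Proof.
move=> r0; have G0 := lattice_overlap_ge0 r v; have v0 := volD_gt0 a_basis.
have H eps : (0 < eps)%R -> exists2 C : R, (0 <= C)%R & forall M,
    lattice_overlap r v * (volD a * (1 - C / M.+1%:R))%:E <= (bound (r + eps))%:E.
  move=> e0; have [C C0 HC] := fejer_concentration a_basis e0; exists C => // M.
  have := HC M; rewrite -lee_fin => /(lee_wpmul2l G0)/le_trans; apply.
  apply: (le_trans (lattice_overlap_fejer M r v e0)); rewrite lee_fin.
  by apply: fejer_overlap_le; rewrite addr_gt0.
have inv_small (C : R) (e : R) : (0 <= C)%R -> (0 < e)%R -> exists M : nat, (C / M.+1%:R <= e)%R.
  move=> C0 e0; exists (Num.truncn (C / e)).
  rewrite ler_pdivrMr// mulrC -ler_pdivrMr//.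
  by apply: ltW; apply: truncnS_gt.
(* Finiteness first: for [eps = 1], a cutoff with [C / M.+1 <= 1/2] leaves a positive factor, so an
   infinite lattice sum would contradict the finite bound. *)
have [g Gg] : exists g, lattice_overlap r v = g%:E.
  have [C C0 HC] := H 1%R ltr01.
  have [M HM] := inv_small C 2^-1%R C0 ltac:(by rewrite invr_gt0).
  have c0 : (0 < volD a * (1 - C / M.+1%:R))%R
    by rewrite mulr_gt0//; move: HM; move: (C / M.+1%:R)%R => q; lra.
  move: (HC M) G0; case: (lattice_overlap r v) => [g _ _|h _|]//; first by exists g.
  by move: h; rewrite gt0_mulye ?lte_fin.
have {}G0 : (0 <= g)%R by rewrite -lee_fin -Gg.
rewrite Gg -EFinM lee_fin.
have H2 eps : (0 < eps)%R -> (g * volD a <= bound (r + eps))%R.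
  move=> e0; have [C C0 HC] := H eps e0.
  have gv : (0 <= g * volD a)%R by rewrite mulr_ge0// ltW.
  apply/ler_addgt0Pr => e e_gt0.
  have [M HM] := inv_small C (e / (g * volD a + 1))%R C0 ltac:(by rewrite divr_gt0// ltr_wpDl).
  have := HC M; rewrite Gg -EFinM lee_fin => h.
  have : (g * volD a * (C / M.+1%:R) <= e)%R.
    apply: (le_trans (ler_wpM2l gv HM)).
    by rewrite mulrCA ler_piMr ?(ltW e_gt0)// ler_pdivrMr ?ltr_wpDl// mul1r lerDl.
  move: h; move: (C / M.+1%:R)%R => q; lra.
rewrite leNgt; apply/negP => lt.
have nb := @cvgr_lt _ _ _ _ bound (bound r) (@continuous_bound r) _ lt.
have [e /= e0 eb] := (nbhs_ballP r _).1 (nb _).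
have e2 : (0 < e / 2)%R by rewrite divr_gt0.
have : (bound (r + e / 2) < g * volD a)%R.
  by apply: eb; rewrite /ball/= opprD addNKr normrN gtr0_norm//; lra.
by rewrite ltNge H2.
Qed.

End poisson_bound.

(** * Moments of the perturbed lattice *)

Section laws.
Context (R : realType) dO (Omega : measurableType dO) (P : probability Omega R).
Local Open Scope ereal_scope.

Lemma eq_law_integral dS (S : measurableType dS) (X Y : {RV P >-> S}) (f : S -> \bar R) :
  (forall C, measurable C -> P (X @^-1` C) = P (Y @^-1` C)) ->
  measurable_fun setT f -> (forall s, 0 <= f s) ->
  \int[P]_w f (X w) = \int[P]_w f (Y w).
Proof.
move=> XY mf f0.
transitivity (\int[distribution P X]_s f s); first by rewrite ge0_integral_distribution.
transitivity (\int[distribution P Y]_s f s); last by rewrite ge0_integral_distribution.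
by apply: eq_measure_integral => C mC _; exact: XY.
Qed.

(** Independence identifies the joint law with the product law on rectangles, hence everywhere, and
    Tonelli's theorem applies. *)
Lemma ge0_integral_indep dS dT (S : measurableType dS) (T : measurableType dT)
    (X : {RV P >-> S}) (Y : {RV P >-> T}) (f : S * T -> \bar R) :
  (forall A B, measurable A -> measurable B ->
    P (X @^-1` A `&` Y @^-1` B) = P (X @^-1` A) * P (Y @^-1` B)) ->
  measurable_fun setT f -> (forall s, 0 <= f s) ->
  \int[P]_w f (X w, Y w) = \int[P]_w \int[P]_w' f (X w, Y w').
Proof.
move=> ind mf f0.
pose XY w := (X w, Y w).
have mXY : measurable_fun setT XY by exact: measurable_fun_pair.
pose H := isMeasurableFun.Build _ _ _ _ XY mXY.
pose Z : {RV P >-> (S * T)%type} := HB.pack XY H.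
transitivity (\int[distribution P Z]_s f s); first by rewrite ge0_integral_distribution.
transitivity (\int[distribution P X \x distribution P Y]_s f s).
  apply: eq_measure_integral => C mC _; apply/esym; apply: product_measure_unique => //.
rewrite fubini_tonelli1// ge0_integral_distribution//.
- by apply: eq_integral => w _; rewrite /fubini_F/= ge0_integral_distribution//; exact: measurableT_comp.
- exact: measurable_fun_fubini_tonelli_F.
- by move=> x; exact: integral_ge0.
Qed.

(** The sets [C] with this property form a sigma-algebra containing the rectangles. Stationarity and
    independence of [U] are expressed through [field_sigma]; this brings functions of two
    displacements within their reach. *)
Lemma field_sigma_pair dS (S : measurableType dS) (I : Type) (La : set I) (i j : I) (C : set (S * S)) :
  La i -> La j -> measurable C -> field_sigma La [set f : I -> S | C (f i, f j)].
Proof.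
move=> Li Lj; rewrite /= measurable_prod_measurableType.
pose G := [set A | exists i B, [/\ La i, measurable B & A = [set f : I -> S | B (f i)]]].
suff : <<s [set A `*` B | A in @measurable _ S & B in @measurable _ S] >> `<=`
    [set C : set (S * S) | <<s G >> [set f : I -> S | C (f i, f j)]] by move=> h /h.
apply: smallest_sub; first split.
- by rewrite /= (_ : mkset _ = set0)//; exact: sigma_algebra0.
- move=> B /= mB; have := sigma_algebraC mB; congr (<<s G >> _).
  by apply/seteqP; split => f /= => [h|[]].
- move=> F /= mF.
  rewrite (_ : mkset _ = \bigcup_k [set f : I -> S | F k (f i, f j)])//.
  exact: sigma_algebra_bigcup.
move=> _ [A mA [B mB <-]] /=.
have gA : <<s G >> [set f | A (f i)].
  by apply: sub_sigma_algebra; exists i, A.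
have gB : <<s G >> [set f | B (f j)].
  by apply: sub_sigma_algebra; exists j, B.
rewrite (_ : mkset _ = [set f : I -> S | A (f i)] `&` [set f | B (f j)])//.
have := @measurableI _ (g_sigma_algebraType G) _ _ gA gB; exact.
Qed.

Definition pair_fun dS (S : measurableType dS) (X Y : {RV P >-> S}) (w : Omega) : S * S :=
  (X w, Y w).

Lemma measurable_pair_fun dS (S : measurableType dS) (X Y : {RV P >-> S}) :
  measurable_fun setT (pair_fun X Y).
Proof. exact: measurable_fun_pair. Qed.

HB.instance Definition _ dS (S : measurableType dS) (X Y : {RV P >-> S}) :=
  isMeasurableFun.Build _ _ _ _ (pair_fun X Y) (measurable_pair_fun X Y).

End laws.

Section perturbed_lattice_moments.
Context (R : realType) (d : nat) (a : d.-tuple 'rV[R]_d).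
Hypothesis a_basis : basis_of fullv a.
Context (dO : measure_display) (Omega : measurableType dO) (P : probability Omega R).
Variables (p : 'rV[R]_d -> {RV P >-> 'rV[R]_d}) (U : {RV P >-> 'rV[R]_d}).
Hypothesis p_stationary : strictly_stationary (lattice a) p.
Hypothesis U_uniform : uniform_on (fundamental_domain a) U.
Hypothesis U_indep : independent_of_field (lattice a) U p.
Local Open Scope ereal_scope.
Local Notation lambda := (@lebesgue_rV R d).
Local Notation D := (fundamental_domain a).
Local Notation Z := {ffun 'I_d -> int}.
Local Notation V := 'rV[R]_d.

Let mD := measurable_fundamental_domain a_basis.
Let v0 := volD_gt0 a_basis.

Let volDV : (lambda D)^-1 = (volD a)^-1%:E.
Proof. by rewrite lebesgue_fundamental_domain// inver gt_eqF. Qed.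

Lemma ge0_integral_uniform (h : V -> \bar R) : measurable_fun setT h ->
  (forall x, 0 <= h x) ->
  \int[P]_w h (U w) = (volD a)^-1%:E * \int[lambda]_(u in D) h u.
Proof.
move=> mh h0; have vi : (0 <= (volD a)^-1)%R by rewrite invr_ge0 ltW.
transitivity (\int[distribution P U]_x h x); first by rewrite ge0_integral_distribution.
rewrite (@ge0_negligible_integral _ _ _ _ _ (~` D))//; last 2 first.
- exact: measurableC.
- by rewrite /= U_uniform ?setICl ?measure0 ?mul0e//; exact: measurableC.
rewrite setTD setCK.
rewrite (@eq_measure_integral _ _ _ _ (mscale (NngNum vi) lambda)); last first.
  move=> A mA AD; rewrite /= U_uniform// setIidl//.
  by rewrite volDV muleC.
by rewrite ge0_integral_mscale//; exact: measurable_funTS.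
Qed.

Definition pz (z : Z) : {RV P >-> V} := p (lat a z).

Lemma stationary_pair (z k : Z) (f : V * V -> \bar R) :
  measurable_fun setT f -> (forall s, 0 <= f s) ->
  \int[P]_w f (pz z w, pz (z + k)%R w) = \int[P]_w f (pz 0%R w, pz k w).
Proof.
move=> mf f0.
apply/esym.
have := @eq_law_integral _ _ _ P _ _ (pair_fun (pz 0%R) (pz k)) (pair_fun (pz z) (pz (z + k)%R)) f.
move=> H; refine (H _ mf f0) => C mC.
pose La : set V := [set lat a 0%R; lat a k].
have LaL : La `<=` lattice a by move=> x [->|->]; exact: lat_lattice.
have FC : field_sigma La [set f : V -> V | C (f (lat a 0%R), f (lat a k))].
  by apply: field_sigma_pair => //; [left|right].
have := p_stationary LaL (lat_lattice a z) FC.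
by rewrite /= -!latD add0r (addrC k).
Qed.

Lemma stationary_single (z : Z) (f : V -> \bar R) :
  measurable_fun setT f -> (forall s, 0 <= f s) ->
  \int[P]_w f (pz z w) = \int[P]_w f (pz 0%R w).
Proof.
move=> mf f0.
by apply: (stationary_pair z 0%R (f := fun s => f s.1)) => //; exact: measurableT_comp.
Qed.

Lemma indep_uniform (z k : Z) (f : (V * V) * V -> \bar R) :
  measurable_fun setT f -> (forall s, 0 <= f s) ->
  \int[P]_w f ((pz z w, pz k w), U w) =
  \int[P]_w ((volD a)^-1%:E * \int[lambda]_(u in D) f ((pz z w, pz k w), u)).
Proof.
move=> mf f0.
rewrite (@ge0_integral_indep _ _ _ P _ _ _ _ (pair_fun (pz z) (pz k)) U f)//.
  apply: eq_integral => w _; apply: ge0_integral_uniform => //.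
  by apply: measurableT_comp => //; exact: pair1_measurable.
move=> A B mA mB.
have FA : field_sigma (lattice a) [set f : V -> V | A (f (lat a z), f (lat a k))].
  by apply: field_sigma_pair => //; exact: lat_lattice.
exact: (U_indep FA mB).
Qed.

(* Campbell's formula for pairs of points: summing over the lattice undoes the
   averaging over the fundamental domain. *)
Lemma mass_transport (k : Z) (phi : V * V -> \bar R) :
  measurable_fun setT phi -> (forall s, 0 <= phi s) ->
  \esum_(z in [set: Z]) \int[P]_w phi (lat a z + pz z w + U w, lat a z + pz (z + k)%R w + U w)%R =
  (volD a)^-1%:E * \int[P]_w \int[lambda]_x phi (x + pz 0%R w, x + pz k w)%R.
Proof.
move=> mphi phi0.
pose g (z : Z) (s : (V * V) * V) : \bar R := phi (lat a z + s.1.1 + s.2, lat a z + s.1.2 + s.2)%R.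
have mg z : measurable_fun setT (g z).
  apply: measurableT_comp => //; apply/measurable_fun_pair.
    apply: measurable_funD_rV => //; apply: (@measurable_funD_rV _ _ _ _ (cst (lat a z))) => //.
    by apply: measurableT_comp.
  apply: measurable_funD_rV => //; apply: (@measurable_funD_rV _ _ _ _ (cst (lat a z))) => //.
  by apply: measurableT_comp.
have g0 z s : 0 <= g z s by exact: phi0.
(* [U] is integrated out before stationarity is used, because stationarity concerns the
   displacements alone: [G z] is a function of the pair only. *)
pose G (z : Z) (s : V * V) : \bar R := (volD a)^-1%:E * \int[lambda]_(u in D) g z (s, u).
have G0 z s : 0 <= G z s.
  by rewrite mule_ge0 ?lee_fin ?invr_ge0 ?(ltW v0)//; apply: integral_ge0.
have mG z : measurable_fun setT (G z).
  apply: emeasurable_funM => //.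
  under eq_fun do rewrite integral_indicE//.
  apply: (@measurable_fun_fubini_tonelli_F _ _ _ _ R lambda (fun q => g z q * (\1_D q.2)%:E)).
    apply: emeasurable_funM => //; apply/measurable_EFinP.
    by apply: (@measurable_comp_rV _ _ _ _ _ _ (\1_D : V -> R)) => //; exact: measurable_indic.
  by move=> q; rewrite mule_ge0.
transitivity (\esum_(z in [set: Z]) \int[P]_w G z (pz 0%R w, pz k w)).
  apply: eq_esum => z _.
  by rewrite (indep_uniform z (z + k)%R (mg z) (g0 z)) (stationary_pair z k (mG z) (G0 z)).
rewrite -ge0_integral_esum//; last first.
  move=> z; apply: (@measurableT_comp _ _ _ _ _ _ (G z) _ (fun w => (pz 0%R w, pz k w))) => //.
  exact: measurable_fun_pair.
have mphi2 :  measurable_fun setT (fun q : (V * V) * V => phi (q.2 + q.1.1, q.2 + q.1.2)%R).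
  apply: measurableT_comp => //; apply/measurable_fun_pair; apply: measurable_funD_rV => //;
  by apply: measurableT_comp.
rewrite -ge0_integralZl//; last 3 first.
- apply: (@measurableT_comp _ _ _ _ _ _ (fun s => \int[lambda]_x phi (x + s.1, x + s.2)%R)
    _ (fun w => (pz 0%R w, pz k w))).
    exact: (@measurable_fun_fubini_tonelli_F _ _ _ _ R lambda (fun q => phi (q.2 + q.1.1, q.2 + q.1.2)%R)).
  exact: measurable_fun_pair.
- by move=> w _; exact: integral_ge0.
- by rewrite lee_fin invr_ge0 ltW.
apply: eq_integral => w _.
rewrite /G esumZl; last 2 first.
- by rewrite lee_fin invr_ge0 ltW.
- by move=> z; exact: integral_ge0.
congr (_ * _).
rewrite (ge0_integral_tile a_basis (h := fun x => phi (x + pz 0%R w, x + pz k w)%R))//; last first.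
  by apply: measurableT_comp => //; apply/measurable_fun_pair; exact: measurable_addcst.
apply: eq_esum => z _; apply: eq_integral => u _; rewrite /g/=.
by congr (phi (_, _)); rewrite addrAC.
Qed.

End perturbed_lattice_moments.

Section second_moment.
Context (R : realType) (d : nat) (a : d.-tuple 'rV[R]_d).
Hypothesis a_basis : basis_of fullv a.
Context (dO : measure_display) (Omega : measurableType dO) (P : probability Omega R).
Variables (p : 'rV[R]_d -> {RV P >-> 'rV[R]_d}) (U : {RV P >-> 'rV[R]_d}).
Hypothesis p_stationary : strictly_stationary (lattice a) p.
Hypothesis U_uniform : uniform_on (fundamental_domain a) U.
Hypothesis U_indep : independent_of_field (lattice a) U p.
Local Open Scope ereal_scope.
Local Notation lambda := (@lebesgue_rV R d).
Local Notation Z := {ffun 'I_d -> int}.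
Local Notation V := 'rV[R]_d.
Local Notation pz := (pz a p).
Local Notation B := (@eball R d).

Definition hit (r : R) (z : Z) (w : Omega) : \bar R :=
  (\1_(B r) (lat a z + pz z w + U w)%R)%:E.

Definition point_count (r : R) (w : Omega) : \bar R := \esum_(z in [set: Z]) hit r z w.

Lemma perturbed_lattice_count r w :
  perturbed_lattice (lattice a) p U w (B r) = point_count r w.
Proof.
by rewrite /perturbed_lattice esum_lattice//; apply: eq_esum => z _; rewrite diracE /hit indicE.
Qed.

Lemma hit_ge0 r z w : 0 <= hit r z w. Proof. by rewrite lee_fin. Qed.

Lemma point_count_ge0 r w : 0 <= point_count r w. Proof. by apply: esum_ge0 => z _; exact: hit_ge0. Qed.

Lemma measurable_hit r z : measurable_fun setT (hit r z).
Proof.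
apply/measurable_EFinP; apply: (measurable_indic_eball_comp (f := fun w => (lat a z + pz z w + U w)%R)).
apply: measurable_funD_rV => //.
by apply: (@measurable_funD_rV _ _ _ _ (cst (lat a z))).
Qed.

Lemma measurable_point_count r : measurable_fun setT (point_count r).
Proof. by apply: measurable_esum => z; [exact: hit_ge0|exact: measurable_hit]. Qed.

Lemma integral_point_count r : \int[P]_w point_count r w = (volD a)^-1%:E * lambda (B r).
Proof.
rewrite /point_count ge0_integral_esum//; last 2 first.
- by move=> z w; exact: hit_ge0.
- by move=> z; exact: measurable_hit.
have m1 : measurable_fun setT (fun s : V * V => (\1_(B r) s.1)%:E : \bar R).
  by apply/measurable_EFinP; apply: measurable_indic_eball_comp.
rewrite (mass_transport a_basis p_stationary U_uniform U_indep 0%R m1); last first.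
  by move=> s; rewrite lee_fin.
congr (_ * _).
under eq_integral => w _.
  rewrite (@ge0_integral_translation _ _ (pz 0%R w) (fun x => (\1_(B r) x)%:E)); last 2 first.
  - by apply/measurable_EFinP; exact: measurable_indic_eball_comp.
  - by move=> x; rewrite lee_fin.
  rewrite integral_indic_eball; over.
by have PT := @probability_setT _ _ _ P; rewrite integral_cst//= PT mule1.
Qed.

Lemma esum_exchange (I J : countType) (F : I -> J -> \bar R) : (forall i j, 0 <= F i j) ->
  \esum_(i in [set: I]) \esum_(j in [set: J]) F i j =
  \esum_(j in [set: J]) \esum_(i in [set: I]) F i j.
Proof.
move=> F0; rewrite esum_esum// esum_esum//.
rewrite (reindex_esum ([set: J] `*`` fun=> [set: I]) _ (fun k => (k.2, k.1)))//.
split => //.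
- by move=> [i j] [k l] _ _ /= [-> ->].
- by move=> [i j] _; exists (j, i).
Qed.

(** Ordered pairs of lattice points are grouped by their difference [k], the form in which
    [mass_transport] applies. The count may be infinite, which [esumZl] allows. *)
Lemma point_count_sqr r w : point_count r w * point_count r w =
  \esum_(k in [set: Z]) \esum_(z in [set: Z]) (hit r z w * hit r (z + k)%R w).
Proof.
rewrite {1}/point_count [LHS]muleC -esumZl ?point_count_ge0//; last by move=> z; exact: hit_ge0.
rewrite esum_exchange; last by move=> k z; rewrite mule_ge0 ?hit_ge0.
apply: eq_esum => z _; rewrite muleC esumZl ?hit_ge0//; last by move=> k; exact: hit_ge0.
congr (_ * _); apply: (reindex_esum [set: Z] [set: Z] (fun k => z + k)%R (fun k => hit r k w)); split => //.
Qed.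

Definition pair_overlap r (k : Z) : \bar R :=
  \int[P]_w ball_overlap r (lat a k + pz k w - pz 0%R w)%R.

Lemma pair_overlap_ge0 r k : 0 <= pair_overlap r k.
Proof. by apply: integral_ge0 => w _; exact: ball_overlap_ge0. Qed.

Lemma integral_point_count_sqr r : \int[P]_w (point_count r w * point_count r w) =
  (volD a)^-1%:E * \esum_(k in [set: Z]) pair_overlap r k.
Proof.
have vi : (0 <= (volD a)^-1)%R by rewrite invr_ge0 ltW// volD_gt0.
have h0 z z' w : 0 <= hit r z w * hit r z' w by rewrite mule_ge0 ?hit_ge0.
have mh z z' : measurable_fun setT (fun w => hit r z w * hit r z' w).
  by apply: emeasurable_funM; exact: measurable_hit.
under eq_integral do rewrite point_count_sqr.
rewrite ge0_integral_esum//; last 2 first.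
- by move=> k w; apply: esum_ge0 => z _.
- by move=> k; apply: measurable_esum.
rewrite -esumZl//; last by move=> k; exact: pair_overlap_ge0.
apply: eq_esum => k _; rewrite ge0_integral_esum//.
(* [mass_transport] places both points over [lat a z]; the offset [lat a k] of the second one is
   moved into [phi]. *)
pose phi (s : V * V) : \bar R := (\1_(B r) s.1)%:E * (\1_(B r) (s.2 + lat a k)%R)%:E.
have mphi : measurable_fun setT phi.
  apply: emeasurable_funM; apply/measurable_EFinP; apply: measurable_indic_eball_comp => //.
  by apply: (@measurable_funD_rV _ _ _ _ _ (cst (lat a k))).
have phi0 s : 0 <= phi s by rewrite mule_ge0 ?lee_fin.
transitivity (\esum_(z in [set: Z]) \int[P]_w phi (lat a z + pz z w + U w, lat a z + pz (z + k)%R w + U w)%R).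
  apply: eq_esum => z _; apply: eq_integral => w _; rewrite /phi /hit/=.
  by congr (_ * (\1_(B r) _)%:E); rewrite latD [RHS]addrC !addrA (addrC (lat a z)).
apply: (etrans (mass_transport a_basis p_stationary U_uniform U_indep k mphi phi0)).
apply: (congr1 (mule (volD a)^-1%:E)); apply: eq_integral => w _.
rewrite /phi /= /ball_overlap.
pose g x : \bar R := (\1_(B r) x * \1_(B r) (x + (lat a k + pz k w - pz 0 w)))%R%:E.
rewrite -(@ge0_integral_translation _ _ (pz 0%R w) g)/=; last 2 first.
- apply/measurable_EFinP; apply: measurable_funM; apply: measurable_indic_eball_comp => //.
  exact: measurable_addcst.
- by move=> x; rewrite lee_fin mulr_ge0.
apply: eq_integral => x _; rewrite /g EFinM; congr (_ * (\1_(B r) _)%:E).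
by rewrite -!addrA; congr (_ + _)%R; rewrite [RHS]addrC -!addrA addNr addr0 addrC.
Qed.

End second_moment.

(** * Comparison with independent displacements and the variance bound *)

Section variance_bound.
Context (R : realType) (d : nat) (a : d.-tuple 'rV[R]_d).
Hypothesis a_basis : basis_of fullv a.
Hypothesis d0 : (0 < d)%N.
Context (dO : measure_display) (Omega : measurableType dO) (P : probability Omega R).
Variables (m : nat) (p : 'rV[R]_d -> {RV P >-> 'rV[R]_d}).
Hypothesis p_stationary : strictly_stationary (lattice a) p.
Hypothesis p_mdep : m_dependent (lattice a) m p.
Local Open Scope ereal_scope.
Local Notation lambda := (@lebesgue_rV R d).
Local Notation Z := {ffun 'I_d -> int}.
Local Notation V := 'rV[R]_d.
Local Notation pz := (pz a p).
Local Notation B := (@eball R d).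

Lemma measurable_overlap_shift r (k : Z) :
  measurable_fun setT (fun s : V * V => ball_overlap r (lat a k + s.2 - s.1)%R).
Proof.
apply: (@measurable_comp_rV _ _ _ _ _ _ (ball_overlap r)); first exact: measurable_ball_overlap.
apply: measurable_funB_rV => //.
by apply: (@measurable_funD_rV _ _ _ _ (cst (lat a k))).
Qed.

(** The independent copy of the displacement at 0 is its value at a second sample point [w'],
    integrated separately; the probability space is not enlarged. *)
Definition mean_overlap r (k : Z) : \bar R :=
  \int[P]_w \int[P]_w' ball_overlap r (lat a k + pz 0%R w' - pz 0%R w)%R.

Lemma mean_overlap_ge0 r k : 0 <= mean_overlap r k.
Proof. by apply: integral_ge0 => w _; apply: integral_ge0 => w' _; exact: ball_overlap_ge0. Qed.

(** Independence splits the expectation into an iterated one; stationarity then replaces the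
    displacement at [k] by the one at 0 in the inner integral. *)
Lemma pair_overlap_far r (k : Z) : (m%:R < enorm (lat a k))%R ->
  pair_overlap a p r k = mean_overlap r k.
Proof.
move=> mk; have mf := measurable_overlap_shift r k.
pose f (s : V * V) := ball_overlap r (lat a k + s.2 - s.1)%R.
have f0 s : 0 <= f s by exact: ball_overlap_ge0.
have ind A C : measurable A -> measurable C ->
    P (pz 0%R @^-1` A `&` pz k @^-1` C) = P (pz 0%R @^-1` A) * P (pz k @^-1` C).
  have L0 : lattice a 0%R by rewrite -(lat0 a); exact: lat_lattice.
  rewrite /pz lat0; apply: (p_mdep L0 (lat_lattice a k)).
  by rewrite sub0r enormN.
have := @ge0_integral_indep _ _ _ P _ _ _ _ (pz 0%R) (pz k) f ind mf f0.
rewrite /pair_overlap => ->; rewrite /mean_overlap; apply: eq_integral => w _.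
have m1 : measurable_fun setT (fun y => f (pz 0%R w, y)).
  by apply: measurableT_comp => //; exact: pair1_measurable.
exact: (stationary_single p_stationary k m1).
Qed.

Lemma measurable_overlap_sample r (k : Z) : measurable_fun setT
  (fun s : Omega * Omega => ball_overlap r (lat a k + pz 0%R s.2 - pz 0%R s.1)%R).
Proof.
apply: (@measurable_comp_rV _ _ _ _ _ _ (ball_overlap r)); first exact: measurable_ball_overlap.
apply: measurable_funB_rV; last by apply: measurableT_comp.
by apply: (@measurable_funD_rV _ _ _ _ (cst (lat a k))) => //; apply: measurableT_comp.
Qed.

Lemma measurable_overlap_inner r (k : Z) : measurable_fun setT
  (fun w => \int[P]_w' ball_overlap r (lat a k + pz 0%R w' - pz 0%R w)%R).
Proof.
apply: (@measurable_fun_fubini_tonelli_F _ _ _ _ R P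
  (fun s => ball_overlap r (lat a k + pz 0%R s.2 - pz 0%R s.1)%R)).
  exact: measurable_overlap_sample.
by move=> s; exact: ball_overlap_ge0.
Qed.

Lemma probability_integral_le (f : Omega -> \bar R) (c : \bar R) : measurable_fun setT f ->
  (forall w, 0 <= f w) -> (forall w, f w <= c) -> \int[P]_w f w <= c.
Proof.
move=> mf f0 fc.
have c0 : 0 <= c by apply: (le_trans (f0 point)); exact: fc.
apply: (@le_trans _ _ (\int[P]_w cst c w)); first by apply: ge0_le_integral => //.
by have PT := @probability_setT _ _ _ P; rewrite integral_cst//= PT mule1.
Qed.

Lemma mean_overlap_le r k : mean_overlap r k <= lambda (B r).
Proof.
apply: probability_integral_le; first exact: measurable_overlap_inner.
  by move=> w; apply: integral_ge0 => w' _; exact: ball_overlap_ge0.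
move=> w; apply: probability_integral_le.
- apply: (@measurableT_comp _ _ _ _ _ _ (fun s : Omega * Omega =>
    ball_overlap r (lat a k + pz 0%R s.2 - pz 0%R s.1)%R) _ (pair w)).
    exact: measurable_overlap_sample.
  exact: pair1_measurable.
- by move=> w'; exact: ball_overlap_ge0.
- by move=> w'; exact: ball_overlap_le.
Qed.

(** The lattice bound is uniform in the shift, so it holds for the difference of displacements at
    any two sample points and survives integration over both. *)
Lemma esum_mean_overlap_le r : (0 < r)%R ->
  \esum_(k in [set: Z]) mean_overlap r k <=
  ((volD a)^-1 * ((r ^+ d * vol1 R d) ^+ 2 + spectral_const a * r ^+ d.-1))%:E.
Proof.
move=> r0; have v0 := volD_gt0 a_basis.
have o0 y : 0 <= ball_overlap r y by exact: ball_overlap_ge0.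
have m1 k w : measurable_fun setT (fun w' => ball_overlap r (lat a k + pz 0%R w' - pz 0%R w)%R).
  apply: (@measurableT_comp _ _ _ _ _ _ (fun s : Omega * Omega =>
    ball_overlap r (lat a k + pz 0%R s.2 - pz 0%R s.1)%R) _ (pair w)).
    exact: measurable_overlap_sample.
  exact: pair1_measurable.
rewrite /mean_overlap -ge0_integral_esum//; last 2 first.
- by move=> k w; exact: integral_ge0.
- by move=> k; exact: measurable_overlap_inner.
apply: probability_integral_le.
- apply: measurable_esum => k; first by move=> w; exact: integral_ge0.
  exact: measurable_overlap_inner.
- by move=> w; apply: esum_ge0 => k _; exact: integral_ge0.
move=> w; rewrite -ge0_integral_esum//; apply: probability_integral_le.
- exact: measurable_esum.
- by move=> w'; exact: esum_ge0.
move=> w'.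
have := lattice_overlap_bound a_basis d0 (pz 0%R w' - pz 0%R w)%R r0.
rewrite EFinM lee_pdivlMl// muleC /lattice_overlap.
have E : \esum_(k in [set: Z]) ball_overlap r (lat a k + pz 0%R w' - pz 0%R w)%R =
  \esum_(k in [set: Z]) ball_overlap r (pz 0%R w' - pz 0%R w + lat a k)%R.
  by apply: eq_esum => k _; congr ball_overlap; rewrite [RHS]addrC addrA.
by rewrite E => H; exact: H.
Qed.

End variance_bound.

Section hyperuniform_bound.
Context (R : realType) (d : nat) (a : d.-tuple 'rV[R]_d).
Hypothesis a_basis : basis_of fullv a.
Hypothesis d0 : (0 < d)%N.
Context (dO : measure_display) (Omega : measurableType dO) (P : probability Omega R).
Variables (m : nat) (p : 'rV[R]_d -> {RV P >-> 'rV[R]_d}) (U : {RV P >-> 'rV[R]_d}).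
Hypothesis p_stationary : strictly_stationary (lattice a) p.
Hypothesis p_mdep : m_dependent (lattice a) m p.
Hypothesis U_uniform : uniform_on (fundamental_domain a) U.
Hypothesis U_indep : independent_of_field (lattice a) U p.
Local Open Scope ereal_scope.
Local Notation lambda := (@lebesgue_rV R d).
Local Notation Z := {ffun 'I_d -> int}.
Local Notation V := 'rV[R]_d.
Local Notation pz := (pz a p).
Local Notation B := (@eball R d).

Definition near_lat : set Z := [set k | (enorm (lat a k) <= m%:R)%R].

(** Cauchy-Schwarz against the dual basis bounds every integer coordinate by [M]; adding [M] encodes
    [k] in a finite cube of side [2 M + 1]. *)
Lemma finite_near_lat : finite_set near_lat.
Proof.
pose K (j : 'I_d) := Num.truncn (enorm (dual_vec a j) * m%:R).
pose M := (\max_(j < d) K j)%N.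
have MK j : (K j <= M)%N by exact: (@leq_bigmax _ K).
pose g (f : {ffun 'I_d -> 'I_(M.*2.+1)}) : Z := [ffun j => (f j)%:Z - M%:Z]%R.
apply: (@sub_finite_set _ _ [set g f | f in setT]); last exact/finite_image/finite_finset.
move=> k /= km.
have kM j : (`|k j| <= M%:Z)%R.
  rewrite -(ler_int R) intr_norm -(dual_vec_lat a_basis).
  have t0 : (0 <= enorm (dual_vec a j) * m%:R)%R by rewrite mulr_ge0 ?enorm_ge0.
  apply: (@le_trans _ _ (K j)%:R%R); last by rewrite -pmulrn ler_nat.
  rewrite (dual_vec_lat a_basis) -intr_norm -natr_absz ler_nat truncn_ge_nat//.
  rewrite natr_absz intr_norm -(dual_vec_lat a_basis).
  by apply: (le_trans (ler_dotv _ _)); rewrite ler_wpM2l ?enorm_ge0.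
exists [ffun j => inord (absz (k j + M%:Z)%R)] => //.
apply/ffunP => j; rewrite !ffunE inordK; last by have := kM j; lia.
by rewrite gez0_abs ?addrK//; have := kM j; rewrite ler_norml; lia.
Qed.

Definition near_seq : seq Z := finmap.enum_fset (fset_set near_lat).

(** The far pairs equal their decoupled means, which the means of the near pairs complete to the
    full lattice sum; the near pairs are bounded by the volume of the ball. Adding on both sides
    avoids a difference of possibly infinite quantities. *)
Lemma esum_pair_overlap_le r : (0 < r)%R ->
  \esum_(k in [set: Z]) pair_overlap a p r k + \sum_(k <- near_seq) mean_overlap a p r k <=
  \sum_(k <- near_seq) lambda (B r) +
  ((volD a)^-1 * ((r ^+ d * vol1 R d) ^+ 2 + spectral_const a * r ^+ d.-1))%:E.
Proof.
move=> r0.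
have b0 k : 0 <= pair_overlap a p r k by exact: pair_overlap_ge0.
have e0 k : 0 <= mean_overlap a p r k by exact: mean_overlap_ge0.
have fS := finite_near_lat.
have SE (f : Z -> \bar R) : (forall k, 0 <= f k) ->
    \esum_(k in near_lat) f k = \sum_(k <- near_seq) f k.
  by move=> f0; rewrite esum_fset// fsbig_finite.
rewrite -SE// (esumID near_lat)// setTI.
rewrite (_ : \esum_(i in _ `&` ~` _) _ = \esum_(k in ~` near_lat) mean_overlap a p r k); last first.
  rewrite setTI; apply: eq_esum => k /= /negP; rewrite -ltNge; exact: (pair_overlap_far p_stationary p_mdep).
rewrite -addeA; apply: leeD.
  rewrite SE//; apply: lee_sum => k _; apply: probability_integral_le.
  - apply: (@measurableT_comp _ _ _ _ _ _ (fun s : V * V => ball_overlap r (lat a k + s.2 - s.1)%R)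
      _ (fun w => (pz 0%R w, pz k w))); first exact: measurable_overlap_shift.
    exact: measurable_fun_pair.
  - by move=> w; exact: ball_overlap_ge0.
  - by move=> w; exact: ball_overlap_le.
apply: le_trans (esum_mean_overlap_le a_basis d0 p r0).
by rewrite [leRHS](esumID near_lat)// !setTI addeC.
Qed.

Definition overlap_defect r (k : Z) : R := (r ^+ d * vol1 R d - fine (mean_overlap a p r k))%R.

Lemma evariance_point_count_le r : (0 < r)%R ->
  evariance P (point_count a p U r) <=
  ((volD a)^-1 * ((volD a)^-1 * (spectral_const a * r ^+ d.-1) +
     \sum_(k <- near_seq) overlap_defect r k))%:E.
Proof.
move=> r0; have v0 := volD_gt0 a_basis.
have vi : (0 <= (volD a)^-1)%R by rewrite invr_ge0 ltW.
pose vr : R := (r ^+ d * vol1 R d)%R.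
have vrE : lambda (B r) = vr%:E by exact: lebesgue_eballE.
have vr0 : (0 <= vr)%R by rewrite mulr_ge0 ?exprn_ge0 ?(ltW r0)// ltW// vol1_gt0.
pose c : R := ((volD a)^-1 * (vr ^+ 2 + spectral_const a * r ^+ d.-1))%R.
pose ef k := fine (mean_overlap a p r k).
have efE k : mean_overlap a p r k = (ef k)%:E.
  rewrite fineK// ge0_fin_numE ?mean_overlap_ge0//.
  by apply: (le_lt_trans (mean_overlap_le a p r k)); rewrite vrE ltry.
have Hb : \esum_(k in [set: Z]) pair_overlap a p r k <=
    (c + \sum_(k <- near_seq) overlap_defect r k)%:E.
  have := esum_pair_overlap_le r0.
  rewrite vrE (eq_bigr _ (fun k _ => efE k)) !sumEFin -EFinD -leeBrDr//= -EFinB.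
  move=> /le_trans; apply; rewrite lee_fin /overlap_defect sumrB -/vr -/ef.
  by rewrite /c /vr; lra.
pose M : R := ((volD a)^-1 * vr)%R.
have M0 : (0 <= M)%R by rewrite mulr_ge0.
have EN : \int[P]_w point_count a p U r w = M%:E.
  by rewrite (integral_point_count a_basis p_stationary U_uniform U_indep) vrE.
have mN : measurable_fun setT (point_count a p U r) by exact: measurable_point_count.
have N0 w : 0 <= point_count a p U r w by exact: point_count_ge0.
(* The square is expanded without subtraction on the right: the identity also holds where the count
   is [+oo], so it can be integrated before the second moment is known to be finite. *)
have ptw w : (point_count a p U r w - M%:E) ^+ 2 + (2 * M)%:E * point_count a p U r w =
    point_count a p U r w * point_count a p U r w + (M ^+ 2)%:E.
  move: (N0 w); case: (point_count a p U r w) => [x _|_|]//.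
    by rewrite -EFinB -EFin_expe -!EFinM -!EFinD; congr (_%:E); ring.
  by rewrite addye// gt_eqF//; apply: (lt_le_trans (ltNyr 0%R)); rewrite mule_ge0// lee_fin mulr_ge0.
have E1 : evariance P (point_count a p U r) + (2 * M)%:E * M%:E =
    \int[P]_w (point_count a p U r w * point_count a p U r w) + (M ^+ 2)%:E.
  rewrite /evariance EN -[in (2 * M)%:E * _]EN -ge0_integralZl//; last first.
    by rewrite lee_fin mulr_ge0.
  have PT := @probability_setT _ _ _ P.
  have -> : (M ^+ 2)%:E = \int[P]_w cst (M ^+ 2)%:E w by rewrite integral_cst//= PT mule1.
  have msq : measurable_fun setT (fun w => (point_count a p U r w - M%:E) ^+ 2).
    under eq_fun do rewrite expe2.
    by apply: emeasurable_funM; apply: emeasurable_funB.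
  rewrite -!ge0_integralD//; first by apply: eq_integral => w _; exact: ptw.
  - by move=> w _; rewrite mule_ge0.
  - exact: emeasurable_funM.
  - by move=> w _; rewrite lee_fin sqr_ge0.
  - by move=> w _; exact: sqre_ge0.
  - by move=> w _; rewrite mule_ge0// lee_fin mulr_ge0.
  - exact: emeasurable_funM.
move: E1; rewrite (integral_point_count_sqr a_basis p_stationary U_uniform U_indep).
have : ((volD a)^-1%:E * (\esum_(k in [set: Z]) pair_overlap a p r k) <=
    ((volD a)^-1 * (c + \sum_(k <- near_seq) overlap_defect r k))%:E)%E.
  by rewrite EFinM lee_wpmul2l.
move: (_ * \esum_(k in _) _) => W WH E1.
have : evariance P (point_count a p U r) + (2 * M * M)%:E <=
   ((volD a)^-1 * (c + \sum_(k <- near_seq) overlap_defect r k) + M ^+ 2)%:E.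
  by rewrite EFinM E1 EFinD leeD2r.
rewrite -leeBrDr// -EFinB => /le_trans; apply; rewrite lee_fin.
(* The leading terms cancel: [M ^+ 2] occurs once in the lattice sum, as [(volD a)^-1] squared times
   [vr ^+ 2], and once as the square of the mean, against [2 * M * M]. *)
move: (\sum_(k <- near_seq) overlap_defect r k)%R => S; rewrite /c /M.
rewrite le_eqVlt; apply/orP; left; apply/eqP; ring.
Qed.

End hyperuniform_bound.

(** * Limit of the normalised variance *)

Section hyperuniform_limit.
Context (R : realType) (d : nat) (a : d.-tuple 'rV[R]_d).
Hypothesis a_basis : basis_of fullv a.
Hypothesis d0 : (0 < d)%N.
Context (dO : measure_display) (Omega : measurableType dO) (P : probability Omega R).
Variables (m : nat) (p : 'rV[R]_d -> {RV P >-> 'rV[R]_d}) (U : {RV P >-> 'rV[R]_d}).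
Hypothesis p_stationary : strictly_stationary (lattice a) p.
Hypothesis p_mdep : m_dependent (lattice a) m p.
Hypothesis U_uniform : uniform_on (fundamental_domain a) U.
Hypothesis U_indep : independent_of_field (lattice a) U p.
Local Open Scope ereal_scope.
Local Notation lambda := (@lebesgue_rV R d).
Local Notation V := 'rV[R]_d.
Local Notation pz := (pz a p).
Local Notation B := (@eball R d).

(** Bounded convergence for a real parameter, obtained along arbitrary sequences tending to
    infinity. *)
Lemma probability_cvg1 (f : R -> Omega -> \bar R) : (forall r, measurable_fun setT (f r)) ->
  (forall r w, 0 <= f r w <= 1) -> (forall w, f r w @[r --> +oo%R] --> 1) ->
  \int[P]_w f r w @[r --> +oo%R] --> 1.
Proof.
move=> mf f01 f1; apply/cvge_pinftyP => u uoo.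
have PT := @probability_setT _ _ _ P.
have -> : 1 = \int[P]_w (cst 1 w) :> \bar R by rewrite integral_cst//= PT mule1.
have i1 : P.-integrable setT (cst 1 : Omega -> \bar R).
  by apply/integrableP; split => //; under eq_integral do rewrite /= normr1;
    rewrite integral_cst//= PT mule1 ltry.
have [] := @dominated_convergence _ _ _ P setT measurableT (fun n => f (u n)) (cst 1) (cst 1) _ _ _ i1 => //.
- by apply: aeW => w _; apply: (cvge_pinftyP (fun r => f r w) 1).1.
- by apply: aeW => w n _; have /andP[f0 fle] := f01 (u n) w; rewrite gee0_abs.
Qed.

Lemma cvg_inv_pinfty (c : R) : (c / r)%R @[r --> +oo%R] --> (0 : R)%R.
Proof.
rewrite -(mulr0 c); apply: cvgMr.
by apply/gtr0_cvgV0; [exact: nbhs_pinfty_gt|exact: cvg_id].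
Qed.

Definition overlap_ratio r (y : V) : \bar R := ball_overlap r y * ((fine (lambda (B r)))^-1)%:E.

Lemma overlap_ratio_ge0 r y : 0 <= overlap_ratio r y.
Proof. by rewrite mule_ge0 ?ball_overlap_ge0// lee_fin invr_ge0 fine_ge0. Qed.

Lemma overlap_ratio_le1 r y : overlap_ratio r y <= 1.
Proof.
have /fineK E : lambda (B r) \is a fin_num by rewrite ge0_fin_numE// lebesgue_eball_fin.
have : (0 <= fine (lambda (B r)))%R by rewrite fine_ge0.
(* When the ball has measure zero the inverse is 0 by convention and so is the ratio; thus the bound
   holds for every [r], as [probability_cvg1] asks. *)
rewrite /overlap_ratio le_eqVlt => /predU1P[<-|v0]; first by rewrite invr0 mule0.
by rewrite lee_pdivrMr// mul1e E ball_overlap_le.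
Qed.

(** By [ball_overlap_ge], for large [r] the ratio lies between [(1 - |y| / r)^d] and 1. *)
Lemma cvg_overlap_ratio y : overlap_ratio r y @[r --> +oo%R] --> 1.
Proof.
have y0 := enorm_ge0 y.
apply: (@squeeze_cvge _ _ _ _ (fun r => ((1 - enorm y / r) ^+ d)%:E) _ (cst 1)); last 2 first.
- apply/fine_cvgP; split; first by apply: nearW.
  have H : (1 - enorm y / r)%R @[r --> +oo%R] --> (1 - 0 : R)%R.
    by apply: cvgB; [exact: cvg_cst|exact: cvg_inv_pinfty].
  have := cvg_comp _ _ H (@exprn_continuous R d (1 - 0)%R).
  by rewrite subr0 expr1n.
- exact: cvg_cst.
near=> r; rewrite overlap_ratio_le1 andbT.
have r0 : (0 < r)%R by near: r; exact: nbhs_pinfty_gt.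
have yr : (enorm y < r)%R by near: r; apply: nbhs_pinfty_gt; exact: num_real.
have v1 := @vol1_gt0 R d.
rewrite /overlap_ratio lebesgue_eballE//= lee_pdivlMr ?mulr_gt0 ?exprn_gt0//.
apply: le_trans (ball_overlap_ge yr).
rewrite lebesgue_eballE ?subr_gt0// -EFinM lee_fin mulrA -exprMn mulrBl mul1r divfK//.
by rewrite gt_eqF.
Unshelve. all: by end_near. Qed.

(** Bounded convergence is applied twice, in [w'] at fixed [w] and then in [w], to ratios that stay
    in [[0, 1]] and tend to 1 for each shift. *)
Lemma cvg_mean_overlap k :
  mean_overlap a p r k * ((fine (lambda (B r)))^-1)%:E @[r --> +oo%R] --> 1.
Proof.
pose f r w w' := overlap_ratio r (lat a k + pz 0%R w' - pz 0%R w)%R.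
have mf r : measurable_fun setT (fun s : Omega * Omega => f r s.1 s.2).
  by apply: emeasurable_funM => //; exact: measurable_overlap_sample.
have mf2 r w : measurable_fun setT (f r w).
  by apply: (@measurableT_comp _ _ _ _ _ _ (fun s : Omega * Omega => f r s.1 s.2) _ (pair w)).
have f0 r w w' : 0 <= f r w w' by exact: overlap_ratio_ge0.
rewrite (_ : (fun r => _) = (fun r => \int[P]_w \int[P]_w' f r w w')); last first.
  apply/funext => r; rewrite muleC /mean_overlap -ge0_integralZl//; last 3 first.
  - exact: measurable_overlap_inner.
  - by move=> w _; apply: integral_ge0 => w' _; exact: ball_overlap_ge0.
  - by rewrite lee_fin invr_ge0 fine_ge0.
  apply: eq_integral => w _; rewrite -ge0_integralZl//; last 3 first.
  - apply: (@measurableT_comp _ _ _ _ _ _ (fun s : Omega * Omega =>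
      ball_overlap r (lat a k + pz 0%R s.2 - pz 0%R s.1)%R) _ (pair w)) => //.
    exact: measurable_overlap_sample.
  - by move=> w' _; exact: ball_overlap_ge0.
  - by rewrite lee_fin invr_ge0 fine_ge0.
  by apply: eq_integral => w' _; rewrite muleC.
apply: probability_cvg1.
- by move=> r; apply: (measurable_fun_fubini_tonelli_F (m2 := P) _ (mf r)) => s.
- move=> r w; rewrite integral_ge0//=; apply: probability_integral_le => // w'.
  exact: overlap_ratio_le1.
- move=> w; apply: probability_cvg1 => // [r w'|w']; last exact: cvg_overlap_ratio.
  by rewrite f0 overlap_ratio_le1.
Qed.

Lemma cvg_overlap_defect k :
  (overlap_defect a p r k / (r ^+ d * vol1 R d))%R @[r --> +oo%R] --> (0 : R)%R.
Proof.
have v1 := @vol1_gt0 R d.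
have /fine_cvgP[_ H] := cvg_mean_overlap k.
have : (1 - fine (mean_overlap a p r k * ((fine (lambda (B r)))^-1)%:E)%E)%R @[r --> +oo%R] --> (1 - 1 : R)%R.
  by apply: cvgB => //; exact: cvg_cst.
rewrite subrr; apply: cvg_trans; apply: near_eq_cvg; near=> r.
have r0 : (0 < r)%R by near: r; exact: nbhs_pinfty_gt.
rewrite lebesgue_eballE//= /overlap_defect mulrBl divff ?mulf_neq0 ?expf_neq0 ?gt_eqF//.
rewrite fineM//; rewrite ge0_fin_numE ?mean_overlap_ge0//.
by apply: (le_lt_trans (mean_overlap_le a p r k)); rewrite lebesgue_eballE// ltry.
Unshelve. all: by end_near. Qed.

Theorem perturbed_lattice_hyperuniform : hyperuniform P (perturbed_lattice (lattice a) p U).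
Proof.
have v1 := @vol1_gt0 R d; have v0 := volD_gt0 a_basis.
rewrite /hyperuniform.
under eq_fun => r do under [in X in evariance _ X]eq_fun do rewrite (perturbed_lattice_count a_basis).
(* Dividing the variance bound by the volume of the ball turns the spectral term, of order
   [r ^+ d.-1], into a constant over [r]; the finitely many defects vanish one by one. *)
pose g (r : R) : R := ((volD a)^-1 * ((volD a)^-1 * spectral_const a / vol1 R d / r +
  \sum_(k <- near_seq a m) overlap_defect a p r k / (r ^+ d * vol1 R d)))%R.
apply: (@squeeze_cvge _ _ _ _ (cst 0) _ (fun r => (g r)%:E)); last 2 first.
- exact: cvg_cst.
- apply/fine_cvgP; split; first by apply: nearW.
  rewrite /comp/= -[X in _ --> X](mulr0 (volD a)^-1%R); apply: cvgMr.
  rewrite -[X in _ --> X](addr0 0%R); apply: cvgD; first exact: cvg_inv_pinfty.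
  elim: (near_seq a m) => [|k s IH]; first by under eq_fun do rewrite big_nil; exact: cvg_cst.
  have : (overlap_defect a p r k / (r ^+ d * vol1 R d) +
      \sum_(k <- s) overlap_defect a p r k / (r ^+ d * vol1 R d))%R @[r --> +oo%R] --> (0 + 0 : R)%R.
    by apply: cvgD => //; exact: cvg_overlap_defect.
  by rewrite addr0; apply: cvg_trans; apply: near_eq_cvg; apply: nearW => r; rewrite big_cons.
near=> r.
have r0 : (0 < r)%R by near: r; exact: nbhs_pinfty_gt.
have w0 : (0 < r ^+ d * vol1 R d)%R by rewrite mulr_gt0// exprn_gt0.
rewrite lebesgue_eballE// inver gt_eqF//; apply/andP; split.
  rewrite mule_ge0 ?lee_fin ?invr_ge0 ?(ltW w0)//; apply: integral_ge0 => w _; exact: sqre_ge0.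
rewrite lee_pdivrMr// -EFinM.
apply: (le_trans (evariance_point_count_le a_basis d0 p_stationary p_mdep U_uniform U_indep r0)).
rewrite lee_fin /g -[leRHS]mulrA; apply: ler_wpM2l; first by rewrite invr_ge0 ltW.
rewrite mulrDl; apply: lerD; last first.
  by rewrite big_distrl/=; apply: ler_sum => k _; rewrite divfK// gt_eqF.
have -> : (r ^+ d = r * r ^+ d.-1)%R by rewrite -exprS prednK.
rewrite le_eqVlt; apply/orP; left; apply/eqP; field.
by rewrite !gt_eqF.
Unshelve. all: by end_near. Qed.

End hyperuniform_limit.

Theorem corollary2 (R : realType) (d : nat) (d_ge1 : (1 <= d)%N)
    (a : d.-tuple 'rV[R]_d) (a_basis : basis_of fullv a)
    (dO : measure_display) (Omega : measurableType dO)
    (P : probability Omega R) (m : nat)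
    (p : 'rV[R]_d -> {RV P >-> 'rV[R]_d})
    (p_stationary : strictly_stationary (lattice a) p)
    (p_mdep : m_dependent (lattice a) m p)
    (p_moment : ('E_P[(fun w => enorm (p 0 w) ^+ d)%R] < +oo)%E)
    (U : {RV P >-> 'rV[R]_d})
    (U_uniform : uniform_on (fundamental_domain a) U)
    (U_indep : independent_of_field (lattice a) U p) :
  hyperuniform P (perturbed_lattice (lattice a) p U).
Proof.
exact: (perturbed_lattice_hyperuniform a_basis d_ge1 p_stationary p_mdep U_uniform U_indep).
Qed.
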